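(* Let $R$ be a Cohen-Macaulay local ring of dimension $n$. Let $I$ be an Ulrich ideal of $R$ such that $R/I$ is Gorenstein. Then the following hold. (1) If $R/I$ satisfies (SAC) and $n\ge 2$, then $R/I^\ell$ satisfies (SAC) for all $2\le \ell\le n$. (2) If $R/I^\ell$ satisfies (SAC) for some integer $\ell>0$ and $\mu_R(I)-\dim R>1$, then $R$ satisfies (SAC).
   Context: All rings are commutative Noetherian with identity. A ring $R$ satisfies (SAC) if for each finitely generated $R$-module $M$: whenever $\mathrm{Ext}_R^i(M,R)=0$ for all $i>0$ and $\mathrm{Ext}_R^i(M,M)=0$ for all sufficiently large $i$, one has $\mathrm{Ext}_R^i(M,M)=0$ for all $i>0$. For a Cohen-Macaulay local ring $(R,\mathfrak m)$, an $\mathfrak m$-primary ideal $I$ is an Ulrich ideal of $R$ if $I^2=QI$ for some parameter ideal $Q\subseteq I$ and $I/I^2$ is a free $R/I$-module (parameter ideals are included). $\mu_R(I)$ denotes the minimal number of generators of $I$. *)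

(* Defs.v *)
From HB Require Import structures.
From mathcomp Require Import all_boot all_algebra.
From mathcomp Require Import ring_quotient boolp.

Set Implicit Arguments.
Unset Strict Implicit.
Unset Printing Implicit Defensive.

Import GRing.Theory.
Local Open Scope ring_scope.
Local Open Scope quotient_scope.

(* An ideal is a boolean predicate, possibly obtained from a proposition by    *)
(* classical reflection (asbool). [idealr R] is the library's type of proper   *)
(* ideals of R and [prime_idealr R] its type of prime ideals.                  *)

Section Ideals.
Variable R : comNzRingType.
Implicit Types (I J m : idealr R) (A B : {pred R}) (s : seq R).

Definition ideal_gen s : {pred R} :=
  fun x => `[< exists c : 'I_(size s) -> R, x = \sum_i c i * s`_i >].

Definition ideal_mul A B : {pred R} :=
  fun x => `[< exists2 t : seq (R * R),
      all (fun p => (p.1 \in A) && (p.2 \in B)) t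
    & x = \sum_(p <- t) p.1 * p.2 >].

Fixpoint ideal_exp A (l : nat) : {pred R} :=
  if l is k.+1 then ideal_mul A (ideal_exp A k) else predT.

Lemma ideal_mulP A B x :
  reflect (exists2 t : seq (R * R),
      all (fun p => (p.1 \in A) && (p.2 \in B)) t
    & x = \sum_(p <- t) p.1 * p.2) (x \in ideal_mul A B).
Proof. exact: asboolP. Qed.

Lemma ideal_mul0 A B : 0 \in ideal_mul A B.
Proof. by apply/ideal_mulP; exists [::]; rewrite ?big_nil. Qed.

Lemma ideal_mulD A B x y :
  x \in ideal_mul A B -> y \in ideal_mul A B -> x + y \in ideal_mul A B.
Proof.
move=> /ideal_mulP[t tP ->] /ideal_mulP[u uP ->].
by apply/ideal_mulP; exists (t ++ u); rewrite ?all_cat ?tP ?big_cat.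
Qed.

Lemma ideal_mulM I B a x : x \in ideal_mul I B -> a * x \in ideal_mul I B.
Proof.
move=> /ideal_mulP[t tP ->]; apply/ideal_mulP.
exists [seq (a * p.1, p.2) | p <- t].
  rewrite all_map; apply: sub_all tP => p /= /andP[pI ->].
  by rewrite idealMr.
by rewrite big_map mulr_sumr; apply: eq_bigr => p _; rewrite mulrA.
Qed.

Lemma ideal_mul_sub I B : {subset ideal_mul I B <= I}.
Proof.
move=> x /ideal_mulP[t /allP tP ->]; rewrite big_seq rpred_sum // => p /tP.
by move=> /andP[pI _]; rewrite mulrC idealMr.
Qed.

Lemma mem_ideal_mul A B x y : x \in A -> y \in B -> x * y \in ideal_mul A B.
Proof.
by move=> xA yB; apply/ideal_mulP; exists [:: (x, y)]; rewrite /= ?xA ?yB ?big_seq1.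
Qed.

Lemma ideal_exp_sub I l : (0 < l)%N -> {subset ideal_exp I l <= I}.
Proof. by case: l => // l _; apply: ideal_mul_sub. Qed.

Lemma ideal_exp_closed I l : (0 < l)%N -> idealr_closed (ideal_exp I l).
Proof.
case: l => // l _; split; first exact: ideal_mul0.
  by apply/negP => /ideal_mul_sub; rewrite idealr1.
by move=> a x y xI yI; rewrite ideal_mulD // ideal_mulM.
Qed.

(* The positive power I^l, as a proper ideal. *)
Section Power.
Variables (I : idealr R) (l : nat) (l_gt0 : (0 < l)%N).
Definition ideal_powp of (0 < l)%N : R -> bool := ideal_exp I l.
HB.instance Definition _ :=
  isIdealr.Build R (ideal_powp l_gt0) (ideal_exp_closed I l_gt0).
Definition ideal_pow : idealr R := ideal_powp l_gt0.
End Power.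

Definition noetherian := forall I, exists s, I =i ideal_gen s.

Definition min_generators I (k : nat) :=
  (exists2 s, size s = k & I =i ideal_gen s) /\
  (forall s, I =i ideal_gen s -> (k <= size s)%N).

Definition maximal_ideal m := forall J, {subset m <= J} -> {subset J <= m}.

Definition is_local m :=
  maximal_ideal m /\ forall m', maximal_ideal m' -> m' =i m.

Definition prime_chain (d : nat) :=
  exists p : 'I_d.+1 -> prime_idealr R,
    forall i j : 'I_d.+1, (i < j)%N ->
      {subset p i <= p j} /\ exists2 x, x \in p j & x \notin p i.

Definition krull_dim (d : nat) := prime_chain d /\ ~ prime_chain d.+1.

Definition regular_seq s :=
  (forall i, (i < size s)%N ->
     forall r, s`_i * r \in ideal_gen (take i s) -> r \in ideal_gen (take i s))
  /\ 1 \notin ideal_gen s.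

Definition depth m (d : nat) :=
  (exists s, [/\ size s = d, {subset s <= m} & regular_seq s]) /\
  (forall s, {subset s <= m} -> regular_seq s -> (size s <= d)%N).

Definition cohen_macaulay_local m :=
  [/\ noetherian, is_local m & exists2 d, krull_dim d & depth m d].

Definition primary_to m I :=
  (forall x y, x * y \in I -> x \in I \/ exists k, y ^+ k \in I) /\
  (forall x, x \in m <-> exists k, x ^+ k \in I).

Definition parameter_ideal m I :=
  exists s, [/\ krull_dim (size s), I =i ideal_gen s & primary_to m I].

End Ideals.

Arguments noetherian : clear implicits.
Arguments krull_dim : clear implicits.
Arguments ideal_pow {R} I {l} l_gt0.

(* The R/I-module I/I^2, realized as the ideal I(R/I^2) of R/I^2. *)
Section Conormal.
Variables (R : comNzRingType) (I : idealr R).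
Let I2 : idealr R := ideal_pow I (isT : (0 < 2)%N).
Local Notation Q1 := {ideal_quot I}.
Local Notation Q2 := {ideal_quot I2}.

Definition conormal_pred : {pred Q2} := fun y => repr y \in I.

Let I2_sub : {subset I2 <= I}.
Proof. exact: ideal_exp_sub. Qed.

Lemma conormal_predE (x : R) : (\pi_Q2 x \in conormal_pred) = (x \in I).
Proof.
rewrite unfold_in /conormal_pred.
have /I2_sub dI : repr (\pi_Q2 x) - x \in I2.
  by rewrite Quotient.idealrBE reprK.
by rewrite -(subrK x (repr _)) rpredDl.
Qed.

Lemma conormal_closed : zmod_closed conormal_pred.
Proof.
split=> [|x y]; first by rewrite -(rmorph0 (\pi_Q2)) conormal_predE rpred0.
rewrite -[x]reprK -[y]reprK !conormal_predE => xI yI.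
by rewrite -rmorphB conormal_predE rpredB.
Qed.

HB.instance Definition _ := GRing.isZmodClosed.Build Q2 conormal_pred conormal_closed.

Record conormal := Conormal
  { conormal_val :> Q2; conormal_valP : conormal_val \in conormal_pred }.
HB.instance Definition _ := [isSub for conormal_val].
HB.instance Definition _ := [Choice of conormal by <:].
HB.instance Definition _ := [SubChoice_isSubZmodule of conormal by <:].

Lemma conormal_scale_subproof (a : Q1) (x : conormal) :
  \pi_Q2 (repr a) * val x \in conormal_pred.
Proof.
case: x => x; rewrite /= -[x]reprK conormal_predE => xI.
by rewrite -rmorphM conormal_predE idealMr.
Qed.

Definition conormal_scale (a : Q1) (x : conormal) : conormal :=
  Conormal (conormal_scale_subproof a x).

Lemma conormal_scaleE (r : R) (x : conormal) :
  val (conormal_scale (\pi_Q1 r) x) = \pi_Q2 r * val x.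
Proof.
case: x => x; rewrite /= -[x]reprK conormal_predE => xI.
apply/eqP; rewrite -!rmorphM -Quotient.idealrBE -mulrBl.
have dI : repr (\pi_Q1 r) - r \in I by rewrite Quotient.idealrBE reprK.
apply: mem_ideal_mul => //; rewrite -[repr x]mulr1; exact: mem_ideal_mul.
Qed.

Fact conormal_scaleA a b x :
  conormal_scale a (conormal_scale b x) = conormal_scale (a * b) x.
Proof.
apply: val_inj; rewrite -[a]reprK -[b]reprK -rmorphM !conormal_scaleE.
by rewrite rmorphM mulrA.
Qed.

Fact conormal_scale1 : left_id 1 conormal_scale.
Proof.
by move=> x; apply: val_inj; rewrite -(rmorph1 (\pi_Q1)) conormal_scaleE rmorph1 mul1r.
Qed.

Fact conormal_scaleDr : right_distributive conormal_scale +%R.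
Proof. by move=> a x y; apply: val_inj; rewrite /= mulrDr. Qed.

Fact conormal_scaleDl x : {morph conormal_scale^~ x : a b / a + b}.
Proof.
move=> a b; apply: val_inj; rewrite -[a]reprK -[b]reprK -rmorphD /=.
by rewrite [LHS]conormal_scaleE !reprK rmorphD mulrDl.
Qed.

HB.instance Definition _ := GRing.Zmodule_isLmodule.Build Q1 conormal
  conormal_scaleA conormal_scale1 conormal_scaleDr conormal_scaleDl.

End Conormal.

Section Modules.
Variable R : comNzRingType.
Implicit Types M N P E : lmodType R.

Definition fin_generated M :=
  exists k (g : 'I_k -> M), forall x, exists c : 'I_k -> R, x = \sum_i c i *: g i.

(* Freeness with a finite basis; for a finitely generated module this is the *)
(* same as freeness.                                                         *)
Definition free_module M :=
  exists k (b : 'I_k -> M), forall x, exists! c : 'rV[R]_k, x = \sum_i c 0 i *: b i.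

Definition projective P :=
  forall (A B : lmodType R) (p : {linear A -> B}) (f : {linear P -> B}),
    (forall b, exists a, p a = b) ->
    exists g : {linear P -> A}, forall x, p (g x) = f x.

Definition injective_module E :=
  forall (A B : lmodType R) (i : {linear A -> B}) (f : {linear A -> E}),
    injective i ->
    exists g : {linear B -> E}, forall x, g (i x) = f x.

(* ... -> P 2 -> P 1 -> P 0 -> M -> 0 *)
Record proj_resolution M := ProjResolution {
  pr_mod : nat -> lmodType R;
  pr_diff : forall i, {linear pr_mod i.+1 -> pr_mod i};
  pr_aug : {linear pr_mod 0%N -> M};
  pr_proj : forall i, projective (pr_mod i);
  pr_aug_surj : forall y, exists x, pr_aug x = y;
  pr_exact0 : forall x, pr_aug x = 0 <-> exists z, pr_diff 0 z = x;
  pr_exactS : forall i x, pr_diff i x = 0 <-> exists z, pr_diff i.+1 z = x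
}.

(* The i-th cohomology of the complex Hom(P, N) is zero. *)
Definition hom_cohomology_zero M (P : proj_resolution M) N (i : nat) :=
  forall f : {linear pr_mod P i -> N},
    (forall x, f (pr_diff P i x) = 0) ->
    match i return (pr_mod P i -> N) -> Prop with
    | 0 => fun f => forall x, f x = 0
    | j.+1 => fun f => exists g : {linear pr_mod P j -> N},
                         forall x, f x = g (pr_diff P j x)
    end f.

(* Ext^i(M, N) = 0; Ext does not depend on the projective resolution. *)
Definition Ext_zero (i : nat) M N :=
  exists P : proj_resolution M, hom_cohomology_zero P N i.

(* 0 -> M -> E 0 -> E 1 -> ... *)
Record inj_resolution M := InjResolution {
  ir_mod : nat -> lmodType R;
  ir_diff : forall i, {linear ir_mod i -> ir_mod i.+1};
  ir_aug : {linear M -> ir_mod 0%N};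
  ir_inj : forall i, injective_module (ir_mod i);
  ir_aug_inj : injective ir_aug;
  ir_exact0 : forall x, ir_diff 0 x = 0 <-> exists z, ir_aug z = x;
  ir_exactS : forall i x, ir_diff i.+1 x = 0 <-> exists z, ir_diff i z = x
}.

Definition finite_injdim M :=
  exists (E : inj_resolution M) (d : nat),
    forall i, (d < i)%N -> forall x : ir_mod E i, x = 0.

Definition gorenstein_local :=
  [/\ noetherian R, exists m : idealr R, is_local m & finite_injdim R^o].

Definition SAC :=
  forall M, fin_generated M ->
    (forall i, (0 < i)%N -> Ext_zero i M R^o) ->
    (exists k, forall i, (k <= i)%N -> Ext_zero i M M) ->
    forall i, (0 < i)%N -> Ext_zero i M M.

End Modules.

Arguments gorenstein_local : clear implicits.
Arguments SAC : clear implicits.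

Definition ulrich_ideal (R : comNzRingType) (m I : idealr R) :=
  [/\ primary_to m I,
      exists Q : idealr R, [/\ parameter_ideal m Q, {subset Q <= I}
                            & ideal_exp I 2 =i ideal_mul Q I]
    & free_module (conormal I)].

(* Main.v *)
(* Fix a resolution D of M by finite free modules.  If X has a filtration whose
   successive quotients are k copies of Y at the bottom and s copies of Y above,
   and if H^i(Hom(D, X)) vanishes for large i, then the lengths l_i of
   H^i(Hom(D, Y)) satisfy k l_(i+1) <= s l_i; when s < k they are eventually 0,
   and a long exact sequence propagates the vanishing down to smaller i.

   Write A = R/I and let Q = (t) be the parameter ideal with I^2 = Q I.  In a
   Cohen-Macaulay ring t is a regular, hence quasi-regular, sequence, so that
   every I^j / I^(j+1) is free over A, and so is I/Q, of rank at least mu(I) - n.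
   For l <= n the rank of I^(l-1) / I^l exceeds the sum of the ranks of the
   previous ones, and the rank of I/Q exceeds 1 when mu(I) - n > 1; so the length
   argument applies to R/I^l, respectively to R/Q.

   Applied to Y = A it turns Ext^i(M, R/I^l) = 0 (respectively
   Ext^i(M, R/Q) = 0) into Ext^i(M, A) = 0 for i > 0.  As A is self-injective,
   this means that D tensored with A is a resolution of M/IM, and the filtrations
   of R/I^l and R/Q induce filtrations of M/I^l M and M/QM by copies of M/IM.
   The length argument with Y = M/IM moves the vanishing of Ext to M/IM, and
   back.  Finally R and R/Q are compared after replacing M by a high syzygy, on
   which t is a regular sequence, and Nakayama's lemma concludes. *)

Require Import Defs.
From HB Require Import structures.
From mathcomp Require Import all_boot all_algebra.
From mathcomp Require Import ring_quotient boolp zify.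

Set Implicit Arguments.
Unset Strict Implicit.
Unset Printing Implicit Defensive.

Import GRing.Theory.
Local Open Scope ring_scope.
Local Open Scope quotient_scope.

(** * Submodules and quotient modules *)

(** Both parts are instances of [SAC_descent], over a ring B with ideals q, I and d: SAC for B/d
    controls the vanishing with coefficients modulo q. Part (1) takes B = R/I^l, q = 0 and d = I;
    part (2) takes B = R, q = Q and d = I^l. To compare B/q, B/I and M/IM without base change, one
    complex of matrices [D] over B is kept and every coefficient module is a quotient of submodules
    of a row space, so that all cohomologies are subquotients of the same matrix modules and lengths
    are strict chains in them. Three inputs need separate work. Regularity of t comes from Koszul
    homology, since Cohen-Macaulayness only provides some regular sequence of length n.
    Self-injectivity of R/I is extracted from a finite injective resolution. Freeness of I/Q is
    deduced from that of I/I^2 through an idempotent matrix modulo I. The bound l <= n is the range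
    in which the binomial coefficients that count ranks still increase along a row. *)

Definition submodule (B : comNzRingType) (X : lmodType B) (U : X -> Prop) :=
  U 0 /\ forall a u v, U u -> U v -> U (a *: u + v).

Section SubQuot.
Variables (B : comNzRingType) (X : lmodType B) (U : X -> Prop) (hU : submodule U).

(** The closure proof is an argument so that the canonical structures below can be found from the
    term; [linear_of], [prop_ideal] and [rmorphism_of] use the same device. *)
Definition sub_pred of submodule U : X -> bool := fun x => `[< U x >].

Fact sub_pred_closed : submod_closed (sub_pred hU).
Proof.
split; first by apply/asboolP; case: hU.
by move=> a u v /asboolP uU /asboolP vU; apply/asboolP; apply: hU.2.
Qed.

Fact sub_pred_zmod : zmod_closed (sub_pred hU).
Proof. exact: GRing.submod_closedB sub_pred_closed. Qed.

HB.instance Definition _ := GRing.isZmodClosed.Build X (sub_pred hU) sub_pred_zmod.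
HB.instance Definition _ := GRing.isSubmodClosed.Build B X (sub_pred hU) sub_pred_closed.

Record sub_type := SubType_ { sub_val : X; sub_valP : sub_val \in sub_pred hU }.
HB.instance Definition _ := [isSub for sub_val].
HB.instance Definition _ := [Choice of sub_type by <:].
HB.instance Definition _ := [SubChoice_isSubLmodule of sub_type by <:].

Definition sub_zmod : zmodClosed X := GRing.ZmodClosed.clone X (sub_pred hU) _.
Local Notation Qt := (Quotient.quot sub_zmod).
Definition quot_type := Qt.
HB.instance Definition _ := GRing.Zmodule.on quot_type.

Definition quot_pi (x : X) : quot_type := \pi_Qt x.

Lemma quot_piE x y : quot_pi x = quot_pi y <-> U (x - y).
Proof.
split=> [|xy].
  by move/eqP; rewrite -Quotient.idealrBE => /asboolP.
by apply/eqP; rewrite -Quotient.idealrBE; apply/asboolP.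
Qed.

Definition quot_scale (a : B) (x : quot_type) : quot_type :=
  quot_pi (a *: repr (x : Qt)).

Lemma quot_repr (x : quot_type) : quot_pi (repr (x : Qt)) = x.
Proof. exact: reprK. Qed.

Lemma quot_scaleE a x : quot_scale a (quot_pi x) = quot_pi (a *: x).
Proof.
apply/quot_piE; rewrite -scalerBr -[a *: _]addr0; apply: hU.2; last exact: hU.1.
by apply/quot_piE; rewrite quot_repr.
Qed.

Lemma quot_piD : {morph quot_pi : x y / x + y}.
Proof. by move=> x y; rewrite /quot_pi raddfD. Qed.

Fact quot_scaleA a b x : quot_scale a (quot_scale b x) = quot_scale (a * b) x.
Proof. by rewrite -[x]quot_repr !quot_scaleE scalerA. Qed.
Fact quot_scale1 : left_id 1 quot_scale.
Proof. by move=> x; rewrite -[x]quot_repr quot_scaleE scale1r. Qed.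
Fact quot_scaleDr : right_distributive quot_scale +%R.
Proof.
move=> a x y; rewrite -[x]quot_repr -[y]quot_repr -quot_piD !quot_scaleE.
by rewrite scalerDr quot_piD.
Qed.
Fact quot_scaleDl x : {morph quot_scale^~ x : a b / a + b}.
Proof. by move=> a b; rewrite -[x]quot_repr !quot_scaleE scalerDl quot_piD. Qed.

HB.instance Definition _ := GRing.Zmodule_isLmodule.Build B quot_type
  quot_scaleA quot_scale1 quot_scaleDr quot_scaleDl.

Fact quot_pi_linear : linear quot_pi.
Proof. by move=> a x y; rewrite quot_piD -quot_scaleE. Qed.
HB.instance Definition _ := GRing.isLinear.Build B X quot_type _ quot_pi quot_pi_linear.

Lemma ex_submodule : exists (Y : lmodType B) (i : {linear Y -> X}),
  injective i /\ forall x, U x <-> exists y, i y = x.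
Proof.
exists sub_type, (GRing.Linear.clone _ _ _ _ (val : sub_type -> X) _).
split=> [|x]; first exact: val_inj.
split=> [xU|[y <-]]; last by apply/asboolP; exact: sub_valP.
have h : x \in sub_pred hU by apply/asboolP.
by exists (SubType_ h).
Qed.

Lemma ex_quotient : exists (Y : lmodType B) (p : {linear X -> Y}),
  (forall y, exists x, p x = y) /\ forall x, U x <-> p x = 0.
Proof.
exists quot_type, quot_pi; split=> [y|x]; first by exists (repr y); exact: quot_repr.
by rewrite -(linear0 quot_pi) -{1}[x]subr0; split=> /quot_piE.
Qed.

End SubQuot.

(** * Comparison of projective resolutions *)

Section LinearOf.
Variables (B : comNzRingType) (X Y : lmodType B) (f : X -> Y) (fL : linear f).
Definition linear_of of linear f := f.
HB.instance Definition _ := GRing.isLinear.Build B X Y _ (linear_of fL) fL.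
Lemma ex_linear : exists g : {linear X -> Y}, g =1 f.
Proof. by exists (linear_of fL). Qed.
End LinearOf.

(** Chain maps, homotopies and ascending chains of ideals are built with it: [Q] is the invariant
    that makes the next choice possible, [R] the link between consecutive choices. *)
Lemma dependent_choice (T : nat -> Type) (Q : forall i, T i -> Prop)
    (R : forall i, T i -> T i.+1 -> Prop) :
  (exists x, Q 0%N x) ->
  (forall i x, Q i x -> exists y, Q i.+1 y /\ R i x y) ->
  exists f : forall i, T i, forall i, Q i (f i) /\ R i (f i) (f i.+1).
Proof.
move=> /cid[x0 Qx0] step.
pose next i (x : {x : T i | Q i x}) : {y : T i.+1 | Q i.+1 y /\ R i (sval x) y} :=
  cid (step i (sval x) (svalP x)).
pose g := fix g i : {x : T i | Q i x} :=
  if i is j.+1 then exist _ (sval (next j (g j))) (svalP (next j (g j))).1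
  else exist _ x0 Qx0.
exists (fun i => sval (g i)) => i; split; first exact: svalP.
exact: (svalP (next i (g i))).2.
Qed.

Section Comparison.
Variable B : comNzRingType.
Implicit Types M N P X Y Z : lmodType B.

Lemma linear_factor X Y Z (i : {linear Y -> Z}) (f : {linear X -> Z}) :
  injective i -> (forall x, exists y, i y = f x) ->
  exists g : {linear X -> Y}, forall x, i (g x) = f x.
Proof.
move=> i_inj /choice[g gE].
have gL : linear g by move=> a u v; apply: i_inj; rewrite !linearP !gE linearP.
by have [h hE] := ex_linear gL; exists h => x; rewrite hE.
Qed.

Lemma image_submodule X Y (f : {linear X -> Y}) : submodule (fun y => exists x, f x = y).
Proof.
split; first by exists 0; rewrite linear0.
by move=> a _ _ [u <-] [v <-]; exists (a *: u + v); rewrite linearP.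
Qed.

(** Projectivity speaks of surjections only; corestricting to the image of [p] reduces to that
    case. *)
Lemma projective_lift P X Y (p : {linear X -> Y}) (f : {linear P -> Y}) :
  projective P -> (forall x, exists y, p y = f x) ->
  exists g : {linear P -> X}, forall x, p (g x) = f x.
Proof.
move=> Pp fp; have [Z [i [i_inj iE]]] := ex_submodule (image_submodule p).
have [p' p'E] : exists p' : {linear X -> Z}, forall x, i (p' x) = p x.
  by apply: linear_factor => // x; apply/iE; exists x.
have [f' f'E] : exists f' : {linear P -> Z}, forall x, i (f' x) = f x.
  by apply: linear_factor => // x; apply/iE.
have [|g gE] := Pp _ _ p' f'.
  move=> z; have /iE[x xE] : exists y, i y = i z by exists z.
  by exists x; apply: i_inj; rewrite p'E.
by exists g => x; rewrite -p'E gE f'E.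
Qed.

Section Resolutions.
Variable M : lmodType B.

Definition pr_cycle (P : proj_resolution M) i : pr_mod P i -> Prop :=
  match i return pr_mod P i -> Prop with
  | 0 => fun x => pr_aug P x = 0
  | j.+1 => fun x => pr_diff P j x = 0
  end.
Arguments pr_cycle : clear implicits.

Lemma pr_cycleP (P : proj_resolution M) i x :
  pr_cycle P i x <-> exists z, pr_diff P i z = x.
Proof. by case: i x => [|i] x /=; [exact: pr_exact0 | exact: pr_exactS]. Qed.

Lemma pr_diff_cycle (P : proj_resolution M) i z : pr_cycle P i (pr_diff P i z).
Proof. by apply/pr_cycleP; exists z. Qed.

Lemma pr_diffK (P : proj_resolution M) i z : pr_diff P i (pr_diff P i.+1 z) = 0.
Proof. exact: (pr_diff_cycle (i := i.+1)). Qed.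

Definition chain_map (P P' : proj_resolution M)
    (f : forall i, {linear pr_mod P i -> pr_mod P' i}) :=
  (forall x, pr_aug P' (f 0%N x) = pr_aug P x) /\
  forall i x, pr_diff P' i (f i.+1 x) = f i (pr_diff P i x).

Lemma ex_chain_map (P P' : proj_resolution M) :
  exists f : forall i, {linear pr_mod P i -> pr_mod P' i}, chain_map f.
Proof.
pose T i := {linear pr_mod P i -> pr_mod P' i} : Type.
pose Q i (f : T i) := (forall z, pr_cycle P' i (f (pr_diff P i z))) /\
  match i return T i -> Prop with
  | 0 => fun f => forall x, pr_aug P' (f x) = pr_aug P x
  | _ => fun=> True end f.
pose R i (f : T i) (g : T i.+1) := forall x, pr_diff P' i (g x) = f (pr_diff P i x).
have [||f fP] := @dependent_choice T Q R.
- have [|f fE] := projective_lift (p := pr_aug P') (f := pr_aug P) (@pr_proj _ _ P 0).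
    by move=> x; exact: pr_aug_surj.
  by exists f; split=> // z; rewrite /= fE; exact: (pr_diff_cycle (i := 0)).
- move=> i f [fQ _].
  have [|g gE] := projective_lift (p := pr_diff P' i) (f := f \o pr_diff P i) (@pr_proj _ _ P i.+1).
    by move=> x; apply/pr_cycleP; exact: fQ.
  exists g; split=> //; split=> // z.
  by rewrite /= gE /= pr_diffK linear0.
exists f; split=> [x|i x]; first exact: (fP 0%N).1.2.
exact: (fP i).2.
Qed.

Lemma chain_homotopy (P P' : proj_resolution M)
    (f g : forall i, {linear pr_mod P i -> pr_mod P' i}) :
  chain_map f -> chain_map g ->
  exists s : forall i, {linear pr_mod P i -> pr_mod P' i.+1},
    forall i x, f i.+1 x - g i.+1 x = pr_diff P' i.+1 (s i.+1 x) + s i (pr_diff P i x).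
Proof.
move=> [f0 fS] [g0 gS].
pose T i := {linear pr_mod P i -> pr_mod P' i.+1} : Type.
pose Q i (s : T i) := forall z, pr_diff P' i (s (pr_diff P i z)) =
   f i (pr_diff P i z) - g i (pr_diff P i z).
pose R i (s : T i) (t : T i.+1) :=
  forall x, pr_diff P' i.+1 (t x) = f i.+1 x - g i.+1 x - s (pr_diff P i x).
have [||s sP] := @dependent_choice T Q R.
- have [|s sE] := projective_lift (p := pr_diff P' 0) (f := f 0%N \- g 0%N) (@pr_proj _ _ P 0).
    by move=> x; apply/(@pr_cycleP P' 0); rewrite /= linearB f0 g0 subrr.
  by exists s => z; rewrite sE.
- move=> i s sQ.
  have [|t tE] := projective_lift (p := pr_diff P' i.+1)
      (f := (f i.+1 \- g i.+1) \- (s \o pr_diff P i)) (@pr_proj _ _ P i.+1).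
    move=> x; apply/pr_cycleP; rewrite /= linearB linearB fS gS sQ subrr //.
  exists t; split=> // z.
  by rewrite tE /= pr_diffK linear0 subr0.
by exists s => i x; rewrite (sP i).2 subrK.
Qed.

Lemma cohomology_zero_indep (P P' : proj_resolution M) N i :
  hom_cohomology_zero P N i.+1 -> hom_cohomology_zero P' N i.+1.
Proof.
move=> PN f fd.
have [a [a0 aS]] := ex_chain_map P P'; have [b [b0 bS]] := ex_chain_map P' P.
have [|h hE] := PN (f \o a i.+1); first by move=> x; rewrite /= -aS fd.
have [||s sE] := @chain_homotopy P' P' (fun i => a i \o b i) (fun i => idfun).
- by split=> [x|j x] /=; rewrite ?a0 ?b0 // aS bS.
- by split.
(* Pulled back to P the cocycle is a coboundary; pulling it back again along b, the homotopy between
   a b and the identity supplies the second term. *)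
exists ((h \o b i) \- (f \o s i)) => x /=.
have := sE i x; rewrite /= => /(congr1 f); rewrite linearB linearD fd add0r.
move=> /(canRL (subrK _)) faE.
have : f (a i.+1 (b i.+1 x)) = h (pr_diff P i (b i.+1 x)) by exact: hE.
rewrite faE bS => <-; rewrite addrAC subrr add0r //.
Qed.

End Resolutions.
End Comparison.

(** * Ext by matrices *)

Definition rowspan (B : comNzRingType) p q (A : 'M[B]_(p, q)) : 'rV[B]_q -> Prop :=
  fun v => exists w, v = w *m A.

Definition rowsin (B : comNzRingType) m b (U : 'rV[B]_b -> Prop) (y : 'M[B]_(m, b)) :=
  forall i, U (row i y).

Definition zerov (B : comNzRingType) b : 'rV[B]_b -> Prop := fun v => v = 0.
Definition allv (B : comNzRingType) b : 'rV[B]_b -> Prop := fun=> True.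
Arguments zerov {B b}.
Arguments allv {B b}.

Definition complex_mx (B : comNzRingType) (e : nat -> nat)
    (D : forall i, 'M[B]_(e i.+1, e i)) := forall i, D i.+1 *m D i = 0.
Definition exact_mx (B : comNzRingType) (e : nat -> nat)
    (D : forall i, 'M[B]_(e i.+1, e i)) :=
  forall i (v : 'rV_(e i.+1)), v *m D i = 0 -> rowspan (D i.+1) v.

(* A cochain in Hom(B^(e i), V/U) is a matrix with e i rows in V, one row for *)
(* the image of each basis vector.  Hz V U i says that the cohomology of      *)
(* Hom(D, V/U) in degree i + 1 vanishes.                                      *)
Definition Hz (B : comNzRingType) (e : nat -> nat) (D : forall i, 'M[B]_(e i.+1, e i))
    b (V U : 'rV[B]_b -> Prop) (i : nat) :=
  forall y : 'M_(e i.+1, b), rowsin V y -> rowsin U (D i.+1 *m y) ->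
  exists2 z : 'M_(e i, b), rowsin V z & rowsin U (y - D i *m z).

(** M is the cokernel of [D 0]: coefficients modulo [zerov] with b = 1 give Ext(M, B), modulo
    [rowspan (D 0)] they give Ext(M, M). As [Hz] at i is Ext in degree i + 1, all i means all
    positive degrees. *)
Definition SAC_mx (B : comNzRingType) :=
  forall e (D : forall i, 'M[B]_(e i.+1, e i)), complex_mx D -> exact_mx D ->
  (forall i, Hz D (b := 1) allv zerov i) ->
  (exists c, forall i, (c <= i)%N -> Hz D allv (rowspan (D 0%N)) i) ->
  forall i, Hz D allv (rowspan (D 0%N)) i.

Definition noetherian_mx (B : comNzRingType) :=
  forall n (U : 'rV[B]_n -> Prop), submodule U ->
  exists k (A : 'M_(k, n)), forall v, U v <-> rowspan A v.

Section RowSpan.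
Variable B : comNzRingType.
Implicit Types X Y : lmodType B.

Lemma rowspan_submodule p q (A : 'M[B]_(p, q)) : submodule (rowspan A).
Proof.
split; first by exists 0; rewrite mul0mx.
by move=> a _ _ [u ->] [v ->]; exists (a *: u + v); rewrite mulmxDl scalemxAl.
Qed.

Lemma rowspan_row p q (A : 'M[B]_(p, q)) i : rowspan A (row i A).
Proof. by exists (delta_mx 0 i); rewrite -rowE. Qed.

Lemma rowsin_rowspan m p q (A : 'M[B]_(p, q)) (y : 'M_(m, q)) :
  rowsin (rowspan A) y <-> exists w, y = w *m A.
Proof.
split=> [/choice[w wE]|[w ->] i]; last by rewrite row_mul; exists (row i w).
exists (\matrix_i w i); apply/row_matrixP => i.
by rewrite row_mul rowK.
Qed.

Lemma rowsin_zero m q (y : 'M[B]_(m, q)) : rowsin zerov y <-> y = 0.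
Proof.
split=> [h|-> i]; last by rewrite /zerov row0.
by apply/row_matrixP => i; rewrite row0; exact: h.
Qed.

Lemma submodule_zero (X : lmodType B) (U : X -> Prop) : submodule U -> U 0.
Proof. by case. Qed.
Lemma submoduleD (X : lmodType B) (U : X -> Prop) u v :
  submodule U -> U u -> U v -> U (u + v).
Proof. by move=> [_ h] uU vU; rewrite -[u]scale1r; apply: h. Qed.
Lemma submoduleZ (X : lmodType B) (U : X -> Prop) a u :
  submodule U -> U u -> U (a *: u).
Proof. by move=> [h0 h] uU; rewrite -[_ *: _]addr0; apply: h. Qed.
Lemma submoduleN (X : lmodType B) (U : X -> Prop) u : submodule U -> U u -> U (- u).
Proof. by move=> hU uU; rewrite -scaleN1r; apply: submoduleZ. Qed.
Lemma submoduleB (X : lmodType B) (U : X -> Prop) u v :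
  submodule U -> U u -> U v -> U (u - v).
Proof. by move=> hU uU vU; apply: submoduleD => //; apply: submoduleN. Qed.
Lemma submodule_sum (X : lmodType B) (U : X -> Prop) I (r : seq I) (F : I -> X) :
  submodule U -> (forall i, U (F i)) -> U (\sum_(i <- r) F i).
Proof.
move=> hU h; elim: r => [|i r IH]; first by rewrite big_nil; case: hU.
by rewrite big_cons; apply: submoduleD.
Qed.

Lemma rowsin_submodule m b (U : 'rV[B]_b -> Prop) :
  submodule U -> submodule (rowsin U (m := m)).
Proof.
move=> hU; split=> [i|a u v uU vU i]; first by rewrite row0; exact: submodule_zero hU.
by rewrite linearP; exact: hU.2 _ _ _ (uU i) (vU i).
Qed.

Lemma rowsin_mul m p b (U : 'rV[B]_b -> Prop) (A : 'M_(m, p)) (y : 'M_(p, b)) :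
  submodule U -> rowsin U y -> rowsin U (A *m y).
Proof.
move=> hU yU i; rewrite row_mul mulmx_sum_row.
by apply: submodule_sum => // j; apply: submoduleZ.
Qed.

Lemma linear_row (X : lmodType B) n (f : {linear 'rV[B]_n -> X}) v :
  f v = \sum_i v 0 i *: f (delta_mx 0 i).
Proof. by rewrite {1}[v]row_sum_delta linear_sum; under eq_bigr do rewrite linearZ. Qed.

Lemma free_lift X Y n (p : {linear X -> Y}) (f : {linear 'rV[B]_n -> Y}) :
  (forall v, exists x, p x = f v) ->
  exists g : {linear 'rV[B]_n -> X}, forall v, p (g v) = f v.
Proof.
move=> pf; have /choice[x xE] : forall i, exists x, p x = f (delta_mx 0 i).
  by move=> i; exact: pf.
have gL : linear (fun v : 'rV[B]_n => \sum_i v 0 i *: x i).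
  move=> a u v; rewrite scaler_sumr -big_split /=.
  by apply: eq_bigr => i _; rewrite !mxE scalerDl scalerA.
have [g gE] := ex_linear gL; exists g => v.
rewrite gE linear_sum linear_row.
by apply: eq_bigr => i _; rewrite linearZ /= xE.
Qed.

Lemma free_projective n : projective ('rV[B]_n : lmodType B).
Proof. by move=> X Y p f p_surj; apply: free_lift => v; exact: p_surj. Qed.

Lemma free_lift_mx Y n b (p : {linear 'rV[B]_b -> Y}) (f : {linear 'rV[B]_n -> Y}) :
  (forall y, exists x, p x = y) -> exists z : 'M_(n, b), forall v, f v = p (v *m z).
Proof.
move=> p_surj; have [g gE] := free_lift (p := p) (fun v => p_surj (f v)).
by exists (lin1_mx g) => v; rewrite mul_rV_lin1 gE.
Qed.

End RowSpan.

Section MatrixResolution.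
Variables (B : comNzRingType) (M : lmodType B) (e : nat -> nat).
Variables (D : forall i, 'M[B]_(e i.+1, e i)) (p : {linear 'rV[B]_(e 0%N) -> M}).
Hypotheses (DD : complex_mx D) (Dex : exact_mx D).
Hypotheses (p_surj : forall x, exists v, p v = x).
Hypotheses (p_ker : forall v, rowspan (D 0%N) v <-> p v = 0).

Let diff i : {linear 'rV[B]_(e i.+1) -> 'rV[B]_(e i)} := mulmxr (D i).

Let exact0 x : p x = 0 <-> exists z, diff 0 z = x.
Proof. by rewrite -p_ker; split=> -[w wE]; exists w; exact: esym wE. Qed.

Let exactS i x : diff i x = 0 <-> exists z, diff i.+1 z = x.
Proof.
split=> [/Dex[w ->]|[w <-]]; first by exists w.
by rewrite /diff /= -mulmxA DD mulmx0.
Qed.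

Definition mx_resolution : proj_resolution M :=
  ProjResolution (fun i => @free_projective B (e i)) p_surj exact0 exactS.

Variables (N : lmodType B) (b : nat) (q : {linear 'rV[B]_b -> N}) (U : 'rV[B]_b -> Prop).
Hypotheses (q_surj : forall x, exists v, q v = x) (q_ker : forall v, U v <-> q v = 0).

Let q_rows m (y : 'M[B]_(m, b)) : rowsin U y <-> forall v, q (v *m y) = 0.
Proof.
split=> [yU v|h i]; last by apply/q_ker; rewrite rowE.
rewrite mulmx_sum_row linear_sum big1 // => i _.
by rewrite linearZ /= (iffLR (q_ker _)) ?scaler0.
Qed.

Lemma hom_cohomology_mx i :
  hom_cohomology_zero mx_resolution N i.+1 <-> Hz D allv U i.
Proof.
split=> [H y _ /q_rows Dy|H f fD].
  have [|g gE] := H (q \o mulmxr y); first by move=> x; rewrite /= -mulmxA Dy.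
  have [z zE] := free_lift_mx g q_surj.
  exists z => //; apply/q_rows => v.
  rewrite mulmxBr linearB mulmxA -zE; apply/eqP; rewrite subr_eq0; apply/eqP.
  exact: gE.
have [y yE] := free_lift_mx f q_surj.
have [//||z _ /q_rows zE] := H y.
  by apply/q_rows => v; rewrite mulmxA -yE; exact: fD.
exists (q \o mulmxr z) => v /=; rewrite yE; apply/eqP.
by rewrite -subr_eq0 -linearB -mulmxA -mulmxBr zE.
Qed.

(** [Ext_zero] only provides some resolution; the comparison of resolutions moves the vanishing to
    the one given by [D]. *)
Lemma Ext_zero_mx i : Ext_zero i.+1 M N <-> Hz D allv U i.
Proof.
rewrite -hom_cohomology_mx; split=> [[P PN]|]; last by exists mx_resolution.
exact: cohomology_zero_indep PN.
Qed.

End MatrixResolution.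

Lemma ex_mx_resolution (B : comNzRingType) (M : lmodType B) :
  noetherian_mx B -> fin_generated M ->
  exists e (D : forall i, 'M[B]_(e i.+1, e i)) (p : {linear 'rV[B]_(e 0%N) -> M}),
    [/\ complex_mx D, exact_mx D, forall x, exists v, p v = x &
        forall v, rowspan (D 0%N) v <-> p v = 0].
Proof.
move=> nB [k [g gE]].
have ker (X : lmodType B) n (f : {linear 'rV[B]_n -> X}) :
    exists k (A : 'M_(k, n)), forall v, rowspan A v <-> f v = 0.
  have [|k' [A AE]] := nB _ (fun v => f v = 0).
    by split=> [|a u v fu fv]; rewrite ?linear0 // linearP fu fv scaler0 addr0.
  by exists k', A => v; rewrite -AE.
have pL : linear (fun v : 'rV[B]_k => \sum_i v 0 i *: g i).
  move=> a u v; rewrite scaler_sumr -big_split /=.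
  by apply: eq_bigr => i _; rewrite !mxE scalerDl scalerA.
have [p pE] := ex_linear pL.
have [k0 [A0 A0E]] := ker _ _ p.
have syz (s : {n & {k & 'M[B]_(k, n)}}) :
    exists t : {k' & 'M[B]_(k', projT1 (projT2 s))},
      forall v, rowspan (projT2 t) v <-> v *m projT2 (projT2 s) = 0.
  have [k' [A' A'E]] := ker _ _ (mulmxr (projT2 (projT2 s))).
  by exists (existT _ k' A').
pose nxt s := sval (cid (syz s)); have nxtE s := svalP (cid (syz s)).
(* The state is a matrix with its sizes. The column count of the next state is by definition the row
   count of the current one, so the [D i] compose without casts. *)
pose st := fix st i : {n & {k & 'M[B]_(k, n)}} :=
  if i is j.+1 then existT _ (projT1 (projT2 (st j))) (nxt (st j))
  else existT _ k (existT _ k0 A0).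
pose e i := projT1 (st i).
pose D i : 'M[B]_(e i.+1, e i) := projT2 (projT2 (st i)).
have DE i v : rowspan (D i.+1) v <-> v *m D i = 0 by exact: nxtE.
exists e, D, p; split.
- move=> i; apply/row_matrixP => j; rewrite row0 row_mul.
  by apply/DE; exact: rowspan_row.
- by move=> i v /DE.
- move=> x; have [c ->] := gE x; exists (\row_i c i).
  by rewrite pE; apply: eq_bigr => i _; rewrite mxE.
- exact: A0E.
Qed.

Section SACmx.
Variable B : comNzRingType.

Let ex_mx11 : exists q : {linear 'rV[B]_1 -> B^o},
  (forall x, exists v, q v = x) /\ forall v, zerov v <-> q v = 0.
Proof.
have fL : linear (fun v : 'rV[B]_1 => v 0 0 : B^o) by move=> a u v; rewrite !mxE.
have [q qE] := ex_linear fL; exists q; split=> [x|v].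
  by exists (const_mx x); rewrite qE mxE.
rewrite qE; split=> [->|v0]; first by rewrite mxE.
by apply/rowP => i; rewrite ord1 v0 mxE.
Qed.

Lemma SAC_of_mx : noetherian_mx B -> SAC_mx B -> SAC B.
Proof.
move=> nB sB M Mfg MB [c MM].
have [e [D [p [DD Dex p_surj p_ker]]]] := ex_mx_resolution nB Mfg.
have [q [q_surj q_ker]] := ex_mx11.
have M_B i := Ext_zero_mx DD Dex p_surj p_ker q_surj q_ker i.
have M_M i := Ext_zero_mx DD Dex p_surj p_ker p_surj p_ker i.
case=> // i _; apply/M_M; apply: sB => // [j|]; first by apply/M_B/MB.
by exists c => j cj; apply/M_M/MM; exact: leqW.
Qed.

Lemma SAC_mx_of : SAC B -> SAC_mx B.
Proof.
move=> sB e D DD Dex DB [c DM].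
have [M [p [p_surj p_ker]]] := ex_quotient (rowspan_submodule (D 0%N)).
have [q [q_surj q_ker]] := ex_mx11.
have M_B i := Ext_zero_mx DD Dex p_surj p_ker q_surj q_ker i.
have M_M i := Ext_zero_mx DD Dex p_surj p_ker p_surj p_ker i.
move=> i; apply/M_M; apply: sB => //.
- exists (e 0%N), (fun i => p (delta_mx 0 i)) => x.
  have [v <-] := p_surj x; exists (fun i => v 0 i); exact: linear_row.
- by case=> // j _; apply/M_B/DB.
by exists c.+1; case=> // j cj; apply/M_M/DM.
Qed.

End SACmx.

(** * Length and composition series *)

Section Length.
Variable B : comNzRingType.
Implicit Types X Y : lmodType B.

Definition incl (T : Type) (U V : T -> Prop) := forall x, U x -> V x.
Definition cap (T : Type) (U V : T -> Prop) : T -> Prop := fun x => U x /\ V x.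
Definition sumv X (U V : X -> Prop) : X -> Prop :=
  fun x => exists u v, [/\ U u, V v & x = u + v].
Definition addx X (U : X -> Prop) (x : X) : X -> Prop :=
  fun y => exists a u, U u /\ y = a *: x + u.

Lemma pred_ext (T : Type) (U V : T -> Prop) : (forall x, U x <-> V x) -> U = V.
Proof. by move=> UV; apply/funext => x; apply/propext. Qed.

Lemma cap_submodule X (U V : X -> Prop) : submodule U -> submodule V -> submodule (cap U V).
Proof.
move=> [U0 hU] [V0 hV]; split=> // a u v [uU uV] [vU vV].
by split; [apply: hU | apply: hV].
Qed.

Lemma sumv_submodule X (U V : X -> Prop) :
  submodule U -> submodule V -> submodule (sumv U V).
Proof.
move=> [U0 hU] [V0 hV]; split; first by exists 0, 0; rewrite addr0.
move=> a _ _ [u [v [uU vV ->]]] [u' [v' [u'U v'V ->]]].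
exists (a *: u + u'), (a *: v + v'); split; [exact: hU | exact: hV |].
by rewrite scalerDr addrACA.
Qed.

Lemma addx_submodule X (U : X -> Prop) x : submodule U -> submodule (addx U x).
Proof.
move=> [U0 hU]; split; first by exists 0, 0; rewrite scale0r addr0.
move=> a _ _ [c [u [uU ->]]] [c' [u' [u'U ->]]].
exists (a * c + c'), (a *: u + u'); split; first exact: hU.
by rewrite scalerDr scalerDl scalerA addrACA.
Qed.

Lemma incl_addx X (U : X -> Prop) x : incl U (addx U x).
Proof. by move=> u uU; exists 0, u; rewrite scale0r add0r. Qed.

Lemma mem_addx X (U : X -> Prop) x : submodule U -> addx U x x.
Proof. by case=> U0 _; exists 1, 0; rewrite scale1r addr0. Qed.

(* lge n U W: the module W/U has length at least n. *)
Fixpoint lge X n (U W : X -> Prop) : Prop :=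
  if n is k.+1 then
    exists V, [/\ submodule V, incl U V, incl V W, ~ incl V U & lge k V W]
  else True.

Lemma lge_mono X n (U U' W W' : X -> Prop) :
  incl U U' -> incl W' W -> lge n U' W' -> lge n U W.
Proof.
elim: n U U' => //= n IH U U' UU' WW' [V [hV UV VW VU VWn]].
exists V; split=> //.
- by move=> x /UU'/UV.
- by move=> x /VW/WW'.
- by move=> VU'; apply: VU => x /VU'/UU'.
- exact: IH VWn.
Qed.

Lemma lge_leq X m n (U W : X -> Prop) : (m <= n)%N -> lge n U W -> lge m U W.
Proof.
elim: n m U => [|n IH] [|m] U //= mn [V [hV UV VW VU VWn]].
by exists V; split=> //; exact: IH VWn.
Qed.

Lemma lge_cat X m n (U V W : X -> Prop) :
  incl U V -> incl V W -> lge m U V -> lge n V W -> lge (m + n) U W.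
Proof.
move=> UV VW; elim: m U UV => [|m IH] U UV /=.
  by move=> _; exact: lge_mono.
move=> [V' [hV' UV' V'V V'U lm]] ln; exists V'; split=> //.
  by move=> x /V'V/VW.
exact: IH.
Qed.

(** By the modular law a strict inclusion stays strict after intersecting with V or after adding V,
    so each step survives in one of the two chains. *)
Lemma lge_split X n (U V W : X -> Prop) : submodule U -> submodule V ->
  lge n U W -> exists a b, [/\ (n <= a + b)%N, lge a (cap U V) (cap W V) &
                              lge b (sumv U V) (sumv W V)].
Proof.
move=> + hV; elim: n U => [|n IH] U hU; first by exists 0%N, 0%N.
move=> [U1 [hU1 UU1 U1W U1U /IH]] => -[//|a [b [nab la lb]]].
have UcU1 : incl (cap U V) (cap U1 V) by move=> x [/UU1].
have UsU1 : incl (sumv U V) (sumv U1 V).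
  by move=> x [u [v [uU vV ->]]]; exists u, v; split=> //; apply: UU1.
have [capU|capU] := pselect (incl (cap U1 V) (cap U V)); last first.
  exists a.+1, b; split=> //; last exact: lge_mono lb.
  exists (cap U1 V); split=> //; first exact: cap_submodule.
  by move=> x [/U1W].
exists a, b.+1; split; rewrite ?addnS //; first exact: lge_mono la.
exists (sumv U1 V); split=> //; first exact: sumv_submodule.
  by move=> x [u [v [uU vV ->]]]; exists u, v; split=> //; apply: U1W.
move=> sU; apply: U1U => x xU1.
have [|u [v [uU vV xE]]] := sU x.
  by exists x, 0; rewrite addr0; split=> //; exact: submodule_zero hV.
have [|vU _] := capU v; first split=> //.
  by rewrite (canRL (addKr _) (esym xE)) addrC; apply: submoduleB => //; exact: UU1.
by rewrite xE; exact: submoduleD.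
Qed.

(** This replaces isomorphisms of subquotients: an operation that is monotone, and reflects
    inclusions between U and W, preserves strict chains. *)
Lemma lge_map X Y n (U W : X -> Prop) (F : (X -> Prop) -> (Y -> Prop)) :
  submodule U -> incl U W ->
  (forall C, submodule C -> incl U C -> submodule (F C)) ->
  (forall C C', incl C C' -> incl (F C) (F C')) ->
  (forall C C', submodule C -> submodule C' -> incl U C -> incl U C' -> incl C W -> incl C' W ->
     incl (F C) (F C') -> incl C C') ->
  lge n U W -> lge n (F U) (F W).
Proof.
move=> + + Fsub Fmono Frefl.
have : incl U U by [].
(* The bottom of the chain moves up in the induction, while the conditions on [F] still refer to the
   original U. *)
move: {2 3 4 5 6}U => U'; elim: n U' => //= n IH U' UU' hU' U'W.
move=> [V [hV U'V VW VU' lV]]; exists (F V).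
have UV : incl U V by move=> x /UU'/U'V.
split; [exact: Fsub | exact: Fmono | exact: Fmono | | exact: IH].
by move=> /Frefl-/(_ hV hU' UV UU' VW U'W)/VU'.
Qed.

Lemma lge1 X (U W : X -> Prop) : submodule W -> incl U W -> ~ incl W U -> lge 1 U W.
Proof. by move=> hW UW WU; exists W; split=> // x. Qed.

End Length.

Section CompositionSeries.
Variables (B : comNzRingType) (J : B -> Prop).
Implicit Types X : lmodType B.

(** When B/J is a field each step adds a copy of B/J. Building from the bottom makes the first step
    an element of the socle of W/U. *)
Inductive cseries X : (X -> Prop) -> (X -> Prop) -> Prop :=
| cseries_nil U : cseries U U
| cseries_cons U x W : (forall a, J a -> U (a *: x)) -> ~ U x ->
    cseries (addx U x) W -> cseries U W.

Lemma cseries_incl X (U W : X -> Prop) : cseries U W -> incl U W.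
Proof.
by elim=> {U W} [U u //|U x W _ _ _ IH u uU]; apply: IH; exact: incl_addx.
Qed.

Lemma cseries_submodule X (U W : X -> Prop) : cseries U W -> submodule U -> submodule W.
Proof. by elim=> {U W} // U x W _ _ _ IH hU; apply/IH/addx_submodule. Qed.

Lemma cseries_trans X (U V W : X -> Prop) : cseries U V -> cseries V W -> cseries U W.
Proof. by elim=> {U V} // U x V Jx Ux _ IH /IH; exact: cseries_cons. Qed.

Lemma cseries_socle X (U W : X -> Prop) : cseries U W -> submodule U -> ~ incl W U ->
  exists x, [/\ W x, ~ U x & forall a, J a -> U (a *: x)].
Proof.
case=> {U W} [U _ [] x //|U x W Jx Ux cs hU _].
exists x; split=> //; apply: (cseries_incl cs); exact: mem_addx.
Qed.

(* [lspan s] is the ideal generated by [s], a recursive form of [ideal_gen]. *)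
Fixpoint lspan (s : seq B) (r : B) : Prop :=
  if s is x :: t then exists c r', lspan t r' /\ r = c * x + r' else r = 0.

Lemma cseries_addx X (s : seq B) (U : X -> Prop) x : submodule U ->
  (forall a, a \in s -> exists t, U (a ^+ t *: x)) ->
  (forall c, J c -> exists c', lspan s (c - c') /\ U (c' *: x)) ->
  cseries U (addx U x).
Proof.
elim: s U x => [|a s IH] U x hU sx Jx.
  have [xU|xU] := pselect (U x).
    rewrite (_ : addx U x = U); first exact: cseries_nil.
    apply: pred_ext => y; split=> [[c [u [uU ->]]]|]; last exact: incl_addx.
    by apply: submoduleD => //; apply: submoduleZ.
  apply: cseries_cons xU _; last exact: cseries_nil.
  move=> c /Jx[c' [/eqP]]; rewrite subr_eq0 => /eqP ->//.
have [t] := sx a (mem_head _ _).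
elim: t x sx Jx => [|t IHt] x sx Jx atx.
  rewrite (_ : addx U x = U); first exact: cseries_nil.
  apply: pred_ext => y; split=> [[c [u [uU ->]]]|]; last exact: incl_addx.
  by apply: submoduleD => //; apply: submoduleZ => //; move: atx; rewrite scale1r.
have IH1 : cseries U (addx U (a *: x)).
  apply: IHt.
  - move=> b /sx[k bk]; exists k.
    by rewrite scalerA mulrC -scalerA; apply: submoduleZ.
  - move=> c /Jx[c' [cc' c'x]]; exists c'; split=> //.
    by rewrite scalerA mulrC -scalerA; apply: submoduleZ.
  - by rewrite scalerA -exprSr.
apply: cseries_trans IH1 _.
have hU' := addx_submodule (a *: x) hU.
have -> : addx U x = addx (addx U (a *: x)) x.
  apply: pred_ext => y; split=> [[c [u [uU ->]]]|[c [_ [[d [u [uU ->]]] ->]]]].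
    by exists c, u; split=> //; exact: incl_addx.
  by exists (c + d * a), u; rewrite scalerDl -scalerA addrA.
apply: IH => //.
  move=> b bs; have [|k bk] := sx b; first by rewrite inE bs orbT.
  by exists k; exact: incl_addx.
move=> c /Jx[c' [[d [r [rs cc']]] c'x]]; exists (c' + d * a); split.
  by rewrite opprD addrA cc' addrAC subrr add0r.
by exists d, (c' *: x); rewrite scalerDl -scalerA addrC.
Qed.

Hypothesis J_field : forall a, ~ J a -> exists c, J (1 - c * a).

Lemma simple_not_lge2 X (U : X -> Prop) x : submodule U ->
  (forall a, J a -> U (a *: x)) -> ~ lge 2 U (addx U x).
Proof.
move=> hU Jx [V [hV UV VUx VU [V' [_ _ V'Ux V'V _]]]]; apply: V'V => y /V'Ux.
have [v [vV vU]] : exists v, V v /\ ~ U v.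
  apply: contrapT => h; apply: VU => v vV; apply: contrapT => vU.
  by apply: h; exists v.
have [a [u [uU vE]]] := VUx v vV.
have [|c Jc] := J_field (a := a).
  by move=> /Jx ax; apply: vU; rewrite vE; exact: submoduleD.
suff xV : V x.
  move=> [d [w [wU ->]]]; apply: submoduleD => //; last exact: UV.
  exact: submoduleZ.
have -> : x = (1 - c * a) *: x + c *: (v - u).
  by rewrite vE addrK scalerBl scale1r scalerA subrK.
apply: submoduleD => //; first exact/UV/Jx.
by apply: submoduleZ => //; apply: submoduleB => //; exact: UV.
Qed.

Lemma cseries_finite_length X (U W : X -> Prop) : cseries U W -> submodule U ->
  exists n, ~ lge n U W.
Proof.
elim=> {U W} [U hU|U x W Jx Ux cs IH hU].
  by exists 1%N => -[V [_ _ VU]].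
have hUx := addx_submodule x hU; have [n nlt] := IH hUx.
exists n.+2 => /(lge_split hU hUx)[a [b [nab la lb]]].
have a1 : (a <= 1)%N.
  rewrite leqNgt; apply/negP => a2; apply: (simple_not_lge2 hU Jx).
  apply: lge_mono (lge_leq a2 la); last by move=> y [].
  by move=> u uU; split=> //; exact: incl_addx.
apply: nlt; apply: (@lge_leq _ _ _ b).
  by rewrite -(leq_add2l 2); apply: leq_trans nab _; rewrite leq_add2r ltnW.
apply: lge_mono lb => y.
  by move=> yU; exists 0, y; rewrite add0r; split=> //; exact: submodule_zero hU.
move=> [w [u [wW uU ->]]].
have hW := cseries_submodule cs hUx.
by apply: submoduleD => //; exact: (cseries_incl cs).
Qed.

Lemma cseries_fg X (s : seq B) (U : X -> Prop) (xs : seq X) : submodule U ->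
  (forall a, a \in s -> exists t, forall x, U (a ^+ t *: x)) ->
  (forall c, J c -> lspan s c) ->
  (forall x, exists c : nat -> B, U (x - \sum_(i < size xs) c i *: xs`_i)) ->
  cseries U (fun=> True).
Proof.
elim: xs U => [|x xs IH] U hU sU Js Uxs.
  rewrite (_ : (fun=> True) = U); first exact: cseries_nil.
  by apply: pred_ext => x; split=> // _; have [c] := Uxs x; rewrite big_ord0 subr0.
apply: (@cseries_trans _ _ (addx U x)).
  apply: (cseries_addx (s := s)) => //.
    by move=> a /sU[t at0]; exists t.
  by move=> c /Js cs; exists 0; rewrite subr0 scale0r; split=> //; exact: submodule_zero hU.
apply: IH => //; first exact: addx_submodule.
  by move=> a /sU[t at0]; exists t => y; exact: incl_addx.
move=> y; have [c] := Uxs y; rewrite big_ord_recl /= opprD addrA => yU.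
exists (fun i => c i.+1), (c 0%N), (y - c 0%N *: x - \sum_(i < size xs) c i.+1 *: xs`_i).
by split; [exact: yU | rewrite addrA [c 0%N *: x + _]addrC subrK].
Qed.

Lemma cseries_fin X (s : seq B) (U : X -> Prop) (T : finType) (g : T -> X) : submodule U ->
  (forall a, a \in s -> exists t, forall x, U (a ^+ t *: x)) ->
  (forall c, J c -> lspan s c) ->
  (forall x, exists c : T -> B, x = \sum_t c t *: g t) ->
  cseries U (fun=> True).
Proof.
move=> hU sU Js gX; apply: (cseries_fg (s := s) (xs := [seq g t | t <- enum T])) => // x.
have [c ->] := gX x.
exists (fun k => if insub k is Some i then c (tnth (in_tuple (enum T)) i) else 0).
rewrite size_map -big_enum big_tnth.
rewrite [X in _ - X](eq_bigr (fun i => c (tnth (in_tuple (enum T)) i) *: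
    g (tnth (in_tuple (enum T)) i))) ?subrr; first exact: submodule_zero.
move=> i _; rewrite valK (nth_map (tnth (in_tuple (enum T)) i)) //.
by congr (_ *: g _); exact: esym (tnth_nth _ (in_tuple (enum T)) i).
Qed.

End CompositionSeries.

(** * Lengths of cohomology along a filtration *)

Section Flat.
Variable B : comNzRingType.

Definition stepv b (U : 'rV[B]_b -> Prop) (beta : B) : 'rV[B]_b -> Prop :=
  fun v => exists x u, U u /\ v = beta *: x + u.

(* A filtration from U up to V each step of which is isomorphic, through       *)
(* multiplication by an element of the list, to the quotient of 'rV_b by F.    *)
Inductive mflat b (F : 'rV[B]_b -> Prop) :
  ('rV[B]_b -> Prop) -> seq B -> ('rV[B]_b -> Prop) -> Prop :=
| mflat_nil U : mflat F U [::] U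
| mflat_cons U beta bs V : (forall u, F u -> U (beta *: u)) ->
    (forall u, U (beta *: u) -> F u) ->
    mflat F (stepv U beta) bs V -> mflat F U (beta :: bs) V.

Lemma stepv_submodule b (U : 'rV[B]_b -> Prop) beta : submodule U -> submodule (stepv U beta).
Proof.
move=> hU; split; first by exists 0, 0; rewrite scaler0 addr0; split=> //; case: hU.
move=> a _ _ [x [u [uU ->]]] [y [v [vU ->]]].
exists (a *: x + y), (a *: u + v); split; first exact: hU.2.
by rewrite !scalerDr !scalerA [beta * a]mulrC addrACA.
Qed.

Lemma incl_stepv b (U : 'rV[B]_b -> Prop) beta : incl U (stepv U beta).
Proof. by move=> u uU; exists 0, u; rewrite scaler0 add0r. Qed.

Lemma mem_stepv b (U : 'rV[B]_b -> Prop) beta x : submodule U -> stepv U beta (beta *: x).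
Proof. by case=> U0 _; exists x, 0; rewrite addr0. Qed.

Lemma rowsin_stepv m b (U : 'rV[B]_b -> Prop) beta (y : 'M_(m, b)) :
  rowsin (stepv U beta) y -> exists x u, rowsin U u /\ y = beta *: x + u.
Proof.
move=> /choice[x /choice[u xuE]]; exists (\matrix_i x i), (\matrix_i u i).
split=> [i|]; first by rewrite rowK; case: (xuE i).
by apply/row_matrixP => i; rewrite linearD linearZ /= !rowK; case: (xuE i).
Qed.

Lemma mflat_incl b (F U : 'rV[B]_b -> Prop) bs V : mflat F U bs V -> incl U V.
Proof.
by elim=> {U bs V} [U u //|U beta bs V _ _ _ IH u uU]; apply: IH; exact: incl_stepv.
Qed.

Lemma mflat_submodule b (F U : 'rV[B]_b -> Prop) bs V :
  mflat F U bs V -> submodule U -> submodule V.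
Proof. by elim=> {U bs V} // U beta bs V _ _ _ IH hU; apply/IH/stepv_submodule. Qed.

Lemma mflat_cat b (F U : 'rV[B]_b -> Prop) bs1 V bs2 W :
  mflat F U bs1 V -> mflat F V bs2 W -> mflat F U (bs1 ++ bs2) W.
Proof. by elim=> {U bs1 V} // U beta bs V FU UF _ IH /IH; exact: mflat_cons. Qed.

Lemma mflat_top b (F : 'rV[B]_b -> Prop) : submodule F -> mflat F F [:: 1] allv.
Proof.
move=> [F0 _]; have -> : @allv B b = stepv F 1.
  by apply: pred_ext => v; split=> // _; exists v, 0; rewrite scale1r addr0.
by apply: mflat_cons; [move=> u; rewrite scale1r..| exact: mflat_nil].
Qed.

End Flat.

Section Rows.
Variables (B : comNzRingType) (m b : nat).
Implicit Types (U V : 'rV[B]_b -> Prop) (y z : 'M[B]_(m, b)).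

Lemma rowsin_incl U V y : incl U V -> rowsin U y -> rowsin V y.
Proof. by move=> UV yU i; apply: UV; exact: yU. Qed.
Lemma rowsin0 U : submodule U -> rowsin U (0 : 'M_(m, b)).
Proof. by move=> /(rowsin_submodule m)[]. Qed.
Lemma rowsinP U a y z : submodule U -> rowsin U y -> rowsin U z -> rowsin U (a *: y + z).
Proof. by move=> /(rowsin_submodule m)[_]; apply. Qed.
Lemma rowsinD U y z : submodule U -> rowsin U y -> rowsin U z -> rowsin U (y + z).
Proof. by move=> /(rowsin_submodule m); exact: submoduleD. Qed.
Lemma rowsinB U y z : submodule U -> rowsin U y -> rowsin U z -> rowsin U (y - z).
Proof. by move=> /(rowsin_submodule m); exact: submoduleB. Qed.
Lemma rowsinN U y : submodule U -> rowsin U y -> rowsin U (- y).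
Proof. by move=> /(rowsin_submodule m); exact: submoduleN. Qed.
Lemma rowsin_scale U V a y : (forall u, U u -> V (a *: u)) -> rowsin U y -> rowsin V (a *: y).
Proof. by move=> UV yU i; rewrite linearZ; apply: UV; exact: yU. Qed.
Lemma rowsin_unscale U V a y : (forall u, U (a *: u) -> V u) -> rowsin U (a *: y) -> rowsin V y.
Proof. by move=> UV yU i; apply: UV; rewrite -linearZ; exact: yU. Qed.

End Rows.

Section CohomologyLength.
Variables (B : comNzRingType) (e : nat -> nat).
Variable D : forall i, 'M[B]_(e i.+1, e i).
Hypothesis DD : complex_mx D.
Variable b : nat.
Implicit Types U V W F : 'rV[B]_b -> Prop.

(** Cohomology with values in V/U is the quotient of these two submodules of one matrix module.
    Coboundaries include the cochains with rows in U, so different coefficients are compared in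
    place. *)
Definition cocycle V U i : 'M[B]_(e i.+1, b) -> Prop :=
  fun y => rowsin V y /\ rowsin U (D i.+1 *m y).
Definition coboundary V U i : 'M[B]_(e i.+1, b) -> Prop :=
  fun y => rowsin V y /\ exists2 z, rowsin V z & rowsin U (y - D i *m z).
Definition lgeH n V U i := lge n (coboundary V U (i := i)) (cocycle V U (i := i)).

Lemma DDK i m (z : 'M_(e i, m)) : D i.+1 *m (D i *m z) = 0.
Proof. by rewrite mulmxA DD mul0mx. Qed.

Lemma coboundary_cocycle V U i : submodule U -> submodule V -> incl U V ->
  incl (coboundary V U (i := i)) (cocycle V U (i := i)).
Proof.
move=> hU hV UV y [yV [z zV yz]]; split=> //.
rewrite -[y](subrK (D i *m z)) mulmxDr DDK addr0.
exact: rowsin_mul.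
Qed.

Lemma cocycle_submodule V U i :
  submodule U -> submodule V -> submodule (cocycle V U (i := i)).
Proof.
move=> hU hV; split=> [|a u v [uV uU] [vV vU]].
  by split; rewrite ?mulmx0; exact: rowsin0.
split; first exact: rowsinP.
by rewrite mulmxDr -scalemxAr; exact: rowsinP.
Qed.

Lemma coboundary_submodule V U i :
  submodule U -> submodule V -> submodule (coboundary V U (i := i)).
Proof.
move=> hU hV; split=> [|a u v [uV [z zV zu]] [vV [w wV wv]]].
  split; first exact: rowsin0.
  by exists 0; rewrite ?mulmx0 ?subr0; exact: rowsin0.
split; first exact: rowsinP.
exists (a *: z + w); first exact: rowsinP.
rewrite mulmxDr -scalemxAr opprD addrACA -scalerBr.
exact: rowsinP.
Qed.

Lemma coboundary_rows V U i y : submodule U -> submodule V -> incl U V ->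
  rowsin U y -> coboundary V U (i := i) y.
Proof.
move=> hU hV UV yU; split; first exact: rowsin_incl yU.
by exists 0; [exact: rowsin0 | rewrite mulmx0 subr0].
Qed.

Lemma coboundaryI V U i z u : submodule U -> submodule V -> incl U V ->
  rowsin V z -> rowsin U u -> coboundary V U (i := i) (D i *m z + u).
Proof.
move=> hU hV UV zV uU; split.
  by apply: rowsinD => //; [exact: rowsin_mul | exact: rowsin_incl uU].
by exists z; rewrite // addrC addKr.
Qed.

Lemma coboundaryE V U i y : coboundary V U (i := i) y ->
  exists z u, [/\ rowsin V z, rowsin U u & y = D i *m z + u].
Proof.
by case=> yV [z zV yz]; exists z, (y - D i *m z); split; rewrite // addrC subrK.
Qed.

Lemma HzE V U i : Hz D V U i <-> incl (cocycle V U (i := i)) (coboundary V U (i := i)).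
Proof.
split=> [H y [yV yU]|H y yV yU]; first by split=> //; exact: H.
by have [] := H y.
Qed.

(** The connecting map from H(W/V) at i to H(V/U) at i + 1 is onto because H(W/U) vanishes there;
    chains are pulled back along [D i.+1]. *)
Lemma lgeH_connecting n W V U i : submodule U -> submodule V -> submodule W ->
  incl U V -> incl V W -> Hz D W U i.+1 -> lgeH n V U i.+1 -> lgeH n W V i.
Proof.
move=> hU hV hW UV VW HWU.
pose Fn (C : 'M_(e i.+2, b) -> Prop) : 'M_(e i.+1, b) -> Prop :=
  fun y => cocycle W V y /\ C (D i.+1 *m y).
move=> /(lge_map (F := Fn)) H; apply: lge_mono (H _ _ _ _ _) => {H}.
- move=> y yb; split; first exact: coboundary_cocycle yb.
  have [z [v [zW vV ->]]] := coboundaryE yb.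
  rewrite mulmxDr DDK add0r -[_ *m v]addr0.
  by apply: coboundaryI => //; exact: rowsin0.
- by move=> y [].
- exact: coboundary_submodule.
- exact: coboundary_cocycle.
- move=> C hC bC; split.
    by split; [exact: submodule_zero (cocycle_submodule _ hV hW) | rewrite mulmx0; exact: submodule_zero].
  move=> a u v [uz uC] [vz vC]; split; first exact: (cocycle_submodule _ hV hW).2.
  by rewrite mulmxDr -scalemxAr; exact: hC.2.
- by move=> C C' CC' y [yz yC]; split=> //; exact: CC'.
move=> C C' hC hC' bC bC' Cz Cz' CC' c cC.
have [cV cU] := Cz _ cC.
have [z zW cz] := HWU c (rowsin_incl VW cV) cU.
have zV : rowsin V (D i.+1 *m z).
  by rewrite -(subKr c (D i.+1 *m z)); apply: rowsinB => //; exact: rowsin_incl cz.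
have cz' := coboundary_rows hU hV UV cz.
have [|_ zC'] := CC' z.
  split; first by split.
  by rewrite -(subKr c (D i.+1 *m z)); apply: submoduleB => //; exact: bC.
rewrite -(subrK (D i.+1 *m z) c); apply: submoduleD => //; exact: bC'.
Qed.

(** Exactness of H(V/U) -> H(W/U) -> H(W/V) in the middle: a chain is cut by the classes that die in
    H(W/V). *)
Lemma lgeH_split n W V U i : submodule U -> submodule V -> submodule W ->
  incl U V -> incl V W -> lgeH n W U i ->
  exists p q, [/\ (n <= p + q)%N, lgeH p V U i & lgeH q W V i].
Proof.
move=> hU hV hW UV VW.
have UW : incl U W by move=> x /UV/VW.
have hb := coboundary_submodule i hV hW.
move=> /(lge_split (coboundary_submodule i hU hW) hb)[p [q [npq lp lq]]].
exists p, q; split=> //.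
  pose Fn C := cap C (cocycle V U (i := i)).
  have hz := cocycle_submodule i hU hV.
  have bb : incl (coboundary W U (i := i)) (coboundary W V (i := i)).
    by move=> y [yW [z zW yz]]; split=> //; exists z => //; exact: rowsin_incl yz.
  have /(lge_map (F := Fn)) H := lp; apply: lge_mono (H _ _ _ _ _) => {H}.
  - move=> y yb; split; last exact: coboundary_cocycle.
    have {}yb : coboundary W U y.
      have [z [u [zV uU ->]]] := coboundaryE yb.
      by apply: coboundaryI => //; exact: rowsin_incl zV.
    by split=> //; exact: bb.
  - by move=> y [].
  - by apply: cap_submodule => //; exact: coboundary_submodule.
  - by move=> y [yb yb']; split=> //; exact: coboundary_cocycle.
  - by move=> C hC _; exact: cap_submodule.
  - by move=> C C' CC' y [yC yz]; split=> //; exact: CC'.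
  move=> C C' hC hC' bC bC' Cz Cz' CC' c cC.
  have [cz /coboundaryE[z [v [zW vV cE]]]] := Cz _ cC.
  have dz : cap (coboundary W U (i := i)) (coboundary W V (i := i)) (D i *m z).
    by split; rewrite -[_ *m _]addr0; apply: coboundaryI => //; exact: rowsin0.
  have vE : v = c - D i *m z by rewrite cE addrC addKr.
  rewrite cE; apply: submoduleD => //; first exact: bC'.
  have vC : Fn C v.
    split; first by rewrite vE; apply: submoduleB => //; exact: bC.
    by split=> //; rewrite vE mulmxBr DDK subr0; case: cz.
  by case: (CC' v vC).
apply: lge_mono lq => y.
  move=> yb; exists 0, y; rewrite add0r; split=> //.
  exact: submodule_zero (coboundary_submodule i hU hW).
move=> [u [v [[uW uU] vb ->]]].
apply: submoduleD; [exact: cocycle_submodule | split=> // | exact: coboundary_cocycle].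
exact: rowsin_incl uU.
Qed.

(** Multiplication by [beta] identifies the row space modulo F with [stepv U beta] modulo U; chains
    are pulled back along it. *)
Lemma lgeH_step n F U beta i : submodule F -> submodule U ->
  (forall u, F u -> U (beta *: u)) -> (forall u, U (beta *: u) -> F u) ->
  lgeH n (stepv U beta) U i -> lgeH n allv F i.
Proof.
move=> hF hU FU UF.
pose V := stepv U beta; have hV : submodule V := stepv_submodule beta hU.
have UV : incl U V := @incl_stepv _ _ _ _.
have hT : submodule (@allv B b) by [].
pose Fn (C : 'M_(e i.+1, b) -> Prop) : 'M_(e i.+1, b) -> Prop :=
  fun y => cocycle allv F y /\ C (beta *: y).
move=> /(lge_map (F := Fn)) H; apply: lge_mono (H _ _ _ _ _) => {H}.
- move=> y yb; split; first exact: coboundary_cocycle yb.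
  have [z [v [_ vF ->]]] := coboundaryE yb.
  rewrite scalerDr scalemxAr; apply: coboundaryI => //.
    by move=> j; rewrite linearZ; exact: mem_stepv.
  exact: rowsin_scale vF.
- by move=> y [].
- exact: coboundary_submodule.
- exact: coboundary_cocycle.
- move=> C hC bC; split.
    by split; [exact: submodule_zero (cocycle_submodule _ hF hT) | rewrite scaler0; exact: submodule_zero].
  move=> a u v [uz uC] [vz vC]; split; first exact: (cocycle_submodule _ hF hT).2.
  by rewrite scalerDr scalerA mulrC -scalerA; exact: hC.2.
- by move=> C C' CC' y [yz yC]; split=> //; exact: CC'.
move=> C C' hC hC' bC bC' Cz Cz' CC' c cC.
have [/rowsin_stepv[x [u [uU cE]]] cU] := Cz _ cC.
have ub := coboundary_rows (i := i) hU hV UV uU.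
have xE : beta *: x = c - u by rewrite cE addrK.
suff /CC'[_ xC'] : Fn C x by rewrite cE; apply: submoduleD => //; exact: bC'.
split; last by rewrite xE; apply: submoduleB => //; exact: bC.
split=> //; apply: (rowsin_unscale UF).
rewrite scalemxAr xE mulmxBr.
by apply: rowsinB => //; exact: rowsin_mul.
Qed.

(** Modulo U, beta times the row space is a complement of V/U in [stepv V beta], isomorphic to the
    row space modulo F. On a direct sum lengths of cohomology add, with no loss to a connecting
    map. *)
Lemma lgeH_cat p n F U V beta i : submodule F -> submodule U -> submodule V -> incl U V ->
  (forall u, F u -> U (beta *: u)) -> (forall u, V (beta *: u) -> F u) ->
  lgeH p V U i -> lgeH n allv F i -> lgeH (p + n) (stepv V beta) U i.
Proof.
move=> hF hU hV UV FU VF lp ln.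
pose V' := stepv V beta; have hV' : submodule V' := stepv_submodule beta hV.
have VV' : incl V V' := @incl_stepv _ _ _ _; have UV' : incl U V' by move=> x /UV/VV'.
have hT : submodule (@allv B b) by [].
(* The classes coming from V/U: the chain for V/U goes below [mid], the one for the row space modulo
   F above it. *)
pose mid := sumv (cocycle V U (i := i)) (coboundary V' U (i := i)).
have hz := cocycle_submodule i hU hV; have hz' := cocycle_submodule i hU hV'.
have hb := coboundary_submodule i hU hV; have hb' := coboundary_submodule i hU hV'.
have hmid : submodule mid by exact: sumv_submodule.
have zz' : incl (cocycle V U (i := i)) (cocycle V' U (i := i)).
  by move=> y [yV yU]; split=> //; exact: rowsin_incl yV.
have bz' := coboundary_cocycle (i := i) hU hV' UV'.
have UFU u : F u -> V (beta *: u) by move=> /FU/UV.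
have unscale : forall u, V (beta *: u) -> U (beta *: u) by move=> u /VF/FU.
apply: (@lge_cat _ _ _ _ _ mid).
- by move=> y yb; exists 0, y; rewrite add0r; split=> //; exact: submodule_zero hz.
- by move=> _ [y [y' [yz yb ->]]]; apply: submoduleD => //; [exact: zz' | exact: bz'].
- pose Fn C := sumv C (coboundary V' U (i := i)).
  have /(lge_map (F := Fn)) H := lp; apply: lge_mono (H _ _ _ _ _) => {H}.
  + by move=> y yb; exists 0, y; rewrite add0r; split=> //; exact: submodule_zero hb.
  + by [].
  + by [].
  + exact: coboundary_cocycle.
  + by move=> C hC _; exact: sumv_submodule.
  + by move=> C C' CC' _ [c [y [cC yb ->]]]; exists c, y; split=> //; exact: CC'.
  move=> C C' hC hC' bC bC' Cz Cz' CC' c cC.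
  have [|c' [y [c'C yb cE]]] := CC' c.
    by exists c, 0; rewrite addr0; split=> //; exact: submodule_zero hb'.
  rewrite cE; apply: submoduleD => //; apply: bC'.
  have yz : rowsin V y.
    have -> : y = c - c' by rewrite cE addrC addKr.
    by apply: rowsinB => //; [case: (Cz _ cC) | case: (Cz' _ c'C)].
  have [z [u [/rowsin_stepv[w [v [vV zE]]] uU yE]]] := coboundaryE yb.
  have Dw : rowsin U (beta *: (D i *m w)).
    have : rowsin V (beta *: (D i *m w)).
      rewrite scalemxAr (_ : _ *: w = z - v) ?mulmxBr; last by rewrite zE addrK.
      apply: rowsinB => //; last exact: rowsin_mul.
      rewrite (_ : _ *m _ = y - u); last by rewrite yE addrK.
      by apply: rowsinB => //; exact: rowsin_incl UV uU.
    by move=> h j; have := h j; rewrite linearZ; exact: unscale.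
  rewrite yE zE mulmxDr -scalemxAr [X in X + u]addrC -addrA.
  by apply: coboundaryI => //; exact: rowsinD.
pose Fn (C : 'M_(e i.+1, b) -> Prop) : 'M_(e i.+1, b) -> Prop :=
  fun y => exists c m, [/\ C c, mid m & y = beta *: c + m].
have /(lge_map (F := Fn)) H := ln; apply: lge_mono (H _ _ _ _ _) => {H}.
- move=> y ym; exists 0, y; rewrite scaler0 add0r; split=> //.
  exact: submodule_zero (coboundary_submodule i hF hT).
- move=> _ [c [m [[_ cF] mm ->]]]; apply: submoduleD => //.
    split; first by move=> j; rewrite linearZ; exact: mem_stepv.
    by rewrite -scalemxAr; exact: rowsin_scale cF.
  by case: mm => [y [y' [yz yb ->]]]; apply: submoduleD => //; [exact: zz' | exact: bz'].
- exact: coboundary_submodule.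
- exact: coboundary_cocycle.
- move=> C hC _; split.
    exists 0, 0; rewrite scaler0 addr0; split=> //; exact: submodule_zero.
  move=> a _ _ [c [m [cC mm ->]]] [c' [m' [cC' mm' ->]]].
  exists (a *: c + c'), (a *: m + m'); split; [exact: hC.2 | exact: hmid.2|].
  by rewrite !scalerDr !scalerA [beta * a]mulrC addrACA.
- by move=> C C' CC' _ [c [m [cC mm ->]]]; exists c, m; split=> //; exact: CC'.
move=> C C' hC hC' bC bC' Cz Cz' CC' c cC.
have [|c' [m [c'C [y [y' [yz yb ->]]] cE]]] := CC' (beta *: c).
  by exists c, 0; rewrite addr0; split=> //; exact: submodule_zero hmid.
have [z [u [/rowsin_stepv[w [v [vV zE]]] uU yE]]] := coboundaryE yb.
rewrite -(subrK c' c); apply: submoduleD => //; apply: bC'.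
split=> //; exists w => //; apply: (rowsin_unscale VF).
have -> : beta *: (c - c' - D i *m w) = y + D i *m v + u.
  rewrite !scalerBr cE [beta *: c' + _]addrC addrK yE zE mulmxDr -scalemxAr.
  by rewrite -(addrA (beta *: _)) addrCA [beta *: _ + _]addrC !addrA addrK.
apply: rowsinD => //; last exact: rowsin_incl UV uU.
by apply: rowsinD => //; [case: yz | exact: rowsin_mul].
Qed.

Lemma Hz_lge V U i : submodule U -> submodule V -> incl U V ->
  ~ lgeH 1 V U i -> Hz D V U i.
Proof.
move=> hU hV UV nl; apply/HzE; apply: contrapT => h; apply: nl.
by apply: lge1 => //; [exact: cocycle_submodule | exact: coboundary_cocycle].
Qed.

Lemma lge_Hz V U i : submodule U -> submodule V -> Hz D V U i -> ~ lgeH 1 V U i.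
Proof. by move=> hU hV /HzE h [C [_ _ Cz Cb _]]; apply: Cb => y /Cz/h. Qed.

Lemma lgeH_mflat F U bs V i l n : mflat F U bs V -> submodule F -> submodule U ->
  ~ lgeH l.+1 allv F i -> lgeH n V U i -> (n <= size bs * l)%N.
Proof.
move=> fl hF hU nl; elim: fl n hU => {U bs V} [U|U beta bs V FU UF fl IH] n hU.
  case: n => // n [C [_ _ Cz Cb _]]; case: Cb => y /Cz[yU _].
  exact: coboundary_rows.
have hU' := stepv_submodule beta hU.
have := mflat_submodule fl hU' => hV.
move=> /(lgeH_split hU hU' hV (@incl_stepv _ _ _ _) (mflat_incl fl))[p [q [npq lp lq]]].
rewrite mulSn; apply: leq_trans npq (leq_add _ (IH _ hU' lq)).
rewrite leqNgt; apply/negP => lp'; apply: nl.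
exact: lgeH_step FU UF (lge_leq lp' lp).
Qed.

Lemma Hz_mflat F U bs V i : mflat F U bs V -> submodule F -> submodule U ->
  Hz D allv F i -> Hz D V U i.
Proof.
move=> fl hF hU H; apply: Hz_lge => //; [exact: mflat_submodule fl hU | exact: mflat_incl fl|].
have hT : submodule (@allv B b) by [].
by move=> /(lgeH_mflat fl hF hU (lge_Hz hF hT H)); rewrite muln0.
Qed.

(** The lower bound matching [lgeH_mflat]: as every element of the list carries F into the bottom U,
    each step splits off as a direct summand. *)
Lemma lgeH_mflat_low F U V bs V' p i n : mflat F V bs V' ->
  submodule F -> submodule U -> submodule V -> incl U V ->
  (forall beta u, beta \in bs -> F u -> U (beta *: u)) ->
  lgeH p V U i -> lgeH n allv F i -> lgeH (p + size bs * n) V' U i.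
Proof.
move=> fl hF hU; elim: fl p => {V bs V'} [V|V beta bs V' FV VF fl IH] p hV UV FU lp ln.
  by rewrite addn0.
 rewrite mulSn addnA; apply: IH => //.
- exact: stepv_submodule.
- by move=> x /UV; exact: incl_stepv.
- by move=> gamma u gbs; apply: FU; rewrite inE gbs orbT.
by apply: (lgeH_cat hF) => // u; apply: FU; exact: mem_head.
Qed.

Lemma Hz_les V U i : submodule U -> submodule V -> incl U V ->
  Hz D allv U i -> Hz D V U i.+1 -> Hz D allv V i.
Proof.
move=> hU hV UV HU HVU y _ yV.
have [||v vV yv] := HVU (D i.+1 *m y) => //.
  by rewrite DDK; exact: rowsin0.
have [//||z _ zU] := HU (y - v); first by rewrite mulmxBr.
exists z => //; rewrite -(subrK v y) addrAC; apply: rowsinD => //.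
exact: rowsin_incl UV zU.
Qed.

Lemma Hz_mflat_back F U bs i : mflat F U bs F -> submodule F -> submodule U ->
  Hz D allv U i -> Hz D allv F i.+1 -> Hz D allv F i.
Proof.
move=> fl hF hU HU HF; apply: (Hz_les hU hF (mflat_incl fl) HU).
exact: (Hz_mflat fl).
Qed.

(* The lengths l_i of the cohomology with values in 'rV_b / F satisfy          *)
(* size bs1 * l_(i+1) <= (size bs2 + 1) * l_i, hence eventually vanish.        *)
Lemma Hz_mflat_descent F U V bs1 bs2 c :
  mflat F U bs1 V -> mflat F V bs2 F -> ((size bs2).+1 < size bs1)%N ->
  submodule F -> submodule U ->
  (forall beta u, beta \in bs1 -> F u -> U (beta *: u)) ->
  (forall i, exists n, ~ lgeH n allv F i) ->
  (forall i, (c <= i)%N -> Hz D allv U i) ->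
  forall i, (c <= i)%N -> Hz D allv F i.
Proof.
move=> fl1 fl2 szbs hF hU FU fin HU.
have hV := mflat_submodule fl1 hU; have hT : submodule (@allv B b) by [].
(* The row space modulo F is itself the last copy, whence the 1 added to the size of [bs2]. *)
have fl3 : mflat F V (bs2 ++ [:: 1]) allv := mflat_cat fl2 (mflat_top hF).
have /choice[l lP] i : exists l, lgeH l allv F i /\ ~ lgeH l.+1 allv F i.
  have [n] := fin i; elim: n => [[] //|n IH] nl.
  by have [ln|/IH//] := pselect (lgeH n allv F i); exists n.
(* A chain of length [size bs1 * l i.+1] in H(V/U) at i + 1 is carried by the connecting map to
   coefficients [allv] modulo V at i, where [fl3] bounds it. *)
have ineq i : (c <= i)%N -> (size bs1 * l i.+1 <= (size bs2).+1 * l i)%N.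
  move=> ci; have := lgeH_mflat_low fl1 hF hU hU (fun _ => id) FU (p := 0) I (lP i.+1).1.
  rewrite add0n => /(lgeH_connecting hU hV hT (mflat_incl fl1) (fun _ _ => I) (HU _ (leqW ci))).
  by move=> /(lgeH_mflat fl3 hF hV (lP i).2); rewrite size_cat addn1.
have lS i : (c <= i)%N -> (l i.+1 <= (l i).-1)%N.
  move=> /ineq h; case: (posnP (l i)) => [li0|li0].
    by move: h; rewrite li0 muln0 leqn0 muln_eq0 => /orP[/eqP b0|/eqP->//]; rewrite b0 in szbs.
  rewrite -ltnS prednK // -(ltn_pmul2l (m := size bs1)); last exact: leq_trans szbs.
  by apply: leq_ltn_trans h _; rewrite ltn_pmul2r.
have lc k : (l (c + k)%N <= l c - k)%N.
  elim: k => [|k IH]; first by rewrite addn0 subn0.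
  rewrite addnS subnS; apply: leq_trans (lS _ (leq_addr _ _)) _.
  by rewrite -!subn1 leq_sub2r.
have Hev i : (c + l c <= i)%N -> Hz D allv F i.
  move=> ci; apply: Hz_lge => //; suff l0 : l i = 0%N by rewrite -{1}l0; exact: (lP i).2.
  have := lc (i - c)%N; rewrite subnKC; last exact: leq_trans (leq_addr _ _) ci.
  rewrite (_ : l c - _ = 0)%N; first by rewrite leqn0 => /eqP.
  by apply/eqP; rewrite subn_eq0 leq_subRL //; exact: leq_trans (leq_addr _ _) ci.
have fl := mflat_cat fl1 fl2.
have down k : forall i, (c <= i)%N -> (c + l c <= i + k)%N -> Hz D allv F i.
  elim: k => [|k IH] i ci; first by rewrite addn0; exact: Hev.
  rewrite addnS -addSn => /IH h; apply: (Hz_mflat_back fl) => //; first exact: HU.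
  by apply: h; exact: leqW.
by move=> i ci; apply: (down (c + l c)%N) => //; rewrite leq_addl.
Qed.

End CohomologyLength.

(** * Artinian local rings of finite self-injective dimension *)

Section SelfInjective.
Variable A : comNzRingType.
Implicit Types V E X : lmodType A.

Definition linear_on V E (U : V -> Prop) (f : V -> E) :=
  forall a u v, U u -> U v -> f (a *: u + v) = a *: f u + f v.

Lemma linear_on0 V E (U : V -> Prop) (f : V -> E) : submodule U -> linear_on U f -> f 0 = 0.
Proof.
move=> [U0 _] fL; have := fL (-1) 0 0 U0 U0.
by rewrite scaler0 addr0 scaleN1r addNr.
Qed.

Lemma linear_onB V E (U : V -> Prop) (f : V -> E) u v :
  linear_on U f -> U u -> U v -> f (u - v) = f u - f v.
Proof. by move=> fL uU vU; rewrite addrC -scaleN1r fL // scaleN1r addrC. Qed.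

Lemma glue_linear V E (U : V -> Prop) (f : V -> E) x e : submodule U -> linear_on U f ->
  (forall d, U (d *: x) -> f (d *: x) = d *: e) ->
  exists g : V -> E, linear_on (addx U x) g /\
    forall a u, U u -> g (a *: x + u) = a *: e + f u.
Proof.
move=> hU fL fx.
(* The value is forced on [addx U x], and independent of the decomposition by the compatibility
   hypothesis; elsewhere it is 0. *)
have /choice[g gE] y : exists z, forall a u, U u -> y = a *: x + u -> z = a *: e + f u.
  have [[a [u [uU yE]]]|ny] := pselect (addx U x y); last first.
    by exists 0 => a u uU yE; case: ny; exists a, u.
  exists (a *: e + f u) => a' u'  u'U yE'.
  have dE : (a - a') *: x = u' - u.
    by apply/eqP; rewrite scalerBl subr_eq addrAC eq_sym subr_eq [u' + _]addrC -yE' yE.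
  have dU : U ((a - a') *: x) by rewrite dE; apply: submoduleB.
  have := fx _ dU; rewrite dE (linear_onB fL) // scalerBl => /eqP.
  by rewrite eq_sym subr_eq addrAC eq_sym subr_eq [f u' + _]addrC => /eqP->.
have gx a u : U u -> g (a *: x + u) = a *: e + f u by move=> uU; exact: gE.
exists g; split=> // a _ _ [c [u [uU ->]]] [c' [u' [u'U ->]]].
rewrite scalerDr addrACA scalerA -scalerDl !gx //; last exact: hU.2.
by rewrite fL // scalerDr addrACA scalerA -scalerDl.
Qed.

Variables (J : A -> Prop) (s : seq A).
Hypothesis J_field : forall a, ~ J a -> exists c, J (1 - c * a).
Hypothesis J_span : forall a, J a -> lspan s a.
Hypothesis s_nil : forall a, a \in s -> exists t, a ^+ t = 0.

Lemma colon_sub V (U : V -> Prop) x d : submodule U -> ~ U x ->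
  (forall a, J a -> U (a *: x)) -> U (d *: x) -> J d.
Proof.
move=> hU xU Jx dx; apply: contrapT => /J_field[c Jc]; apply: xU.
rewrite -[x]scale1r -(subrK (c * d) 1) scalerDl -scalerA.
by apply: submoduleD => //; [exact: Jx | exact: submoduleZ].
Qed.

(** For an ideal J and a submodule C this is Ext^1(A/J, C) = 0. *)
Definition extends_from_J E (C : E -> Prop) :=
  forall f : A^o -> E, @linear_on (A^o : lmodType A) E J f -> (forall a, J a -> C (f a)) ->
  exists2 e, C e & forall a, J a -> f a = a *: e.

Lemma extend_cseries V E (C : E -> Prop) (U W : V -> Prop) (f : V -> E) :
  submodule C -> extends_from_J C -> cseries J U W -> submodule U ->
  linear_on U f -> (forall u, U u -> C (f u)) ->
  exists g : V -> E, [/\ linear_on W g, forall w, W w -> C (g w) & forall u, U u -> g u = f u].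
Proof.
move=> hC CJ cs; elim: cs f => {U W} [U|U x W Jx Ux cs IH] f hU fL fC; first by exists f.
have [||e Ce eE] := CJ (fun a => f (a *: x)).
- by move=> a b c Jb Jc; rewrite scalerDl -scalerA fL //; exact: Jx.
- by move=> a Ja; apply/fC/Jx.
have [d dU|g [gL gE]] := @glue_linear _ _ U f x e hU fL.
  by apply: eE; exact: colon_sub dU.
have [|h [hL hC' hE]] // := IH g (addx_submodule x hU) gL.
  move=> _ [a [u [uU ->]]]; rewrite gE //; apply: submoduleD => //; last exact: fC.
  exact: submoduleZ.
exists h; split=> // u uU; rewrite hE; last exact: incl_addx.
by rewrite -[u]add0r -(scale0r x) gE // !scale0r !add0r.
Qed.

Lemma cseries_top V (U : V -> Prop) (T : finType) (g : T -> V) : submodule U ->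
  (forall x, exists c : T -> A, x = \sum_t c t *: g t) ->
  cseries J U (fun=> True).
Proof.
move=> hU; apply: (cseries_fin (s := s)) => // a /s_nil[t at0].
by exists t => x; rewrite at0 scale0r; exact: submodule_zero.
Qed.

Lemma cseries_ring (U : A^o -> Prop) : submodule U -> cseries J U (fun=> True).
Proof.
move=> hU; apply: (cseries_top (g := fun _ : 'I_1 => 1 : A^o)) => // x.
by exists (fun=> x); rewrite big_ord1 [_ *: _]mulr1.
Qed.

Lemma ex_socle : exists x : A, x <> 0 /\ forall a, J a -> a * x = 0.
Proof.
have h0 : submodule (fun x : A^o => x = 0).
  by split=> // a u v -> ->; rewrite scaler0 addr0.
have [|x [_ x0 Jx]] := cseries_socle (cseries_ring h0) h0.
  by move=> /(_ 1 I)/eqP; rewrite oner_eq0.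
by exists x.
Qed.

Hypothesis J_sub : submodule (J : A^o -> Prop).

(* Descending induction on j through Ext^1(A/J, K_j) = Ext^2(A/x, K_j) =        *)
(* Ext^1(A/x, K_(j+1)), where K_j is the kernel of the j-th differential and x  *)
(* spans a copy of A/J in the socle.                                           *)
Lemma extends_cosyzygy (E : inj_resolution (A^o : lmodType A)) d j :
  (forall i, (d < i)%N -> forall x : ir_mod E i, x = 0) ->
  extends_from_J (fun x : ir_mod E j => ir_diff E j x = 0).
Proof.
move=> Ed; have [] : exists k, (d < j + k)%N by exists d.+1; rewrite addnS ltnS leq_addl.
move=> k; elim: k j => [|k IH] j djk f fL fC.
  by exists 0 => [|a _]; [rewrite linear0 | rewrite addn0 in djk; rewrite scaler0 [f a]Ed].
have [x [x0 Jx]] := ex_socle.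
have [Y [i [i_inj iE]]] := ex_submodule J_sub.
have iJ y : J (i y) by apply/iE; exists y.
have [fi fiE] : exists fi : {linear Y -> ir_mod E j}, forall y, fi y = f (i y).
  have fiL : linear (fun y => f (i y)) by move=> a u v; rewrite linearP fL.
  by have [fi fiE] := ex_linear fiL; exists fi => y; rewrite fiE.
have [g gE] := @ir_inj _ _ E j _ _ i fi i_inj.
have fg a : J a -> f a = a *: g 1.
  by move=> /iE[y <-]; rewrite -fiE -gE -[RHS]linearZ /= [_ *: 1]mulr1.
(* Injectivity of E j makes f multiplication by g 1, which may lie outside K_j. The defect [gam] is
   killed by J, so sending the socle element x to it is well defined. *)
pose gam := ir_diff E j (g 1).
have Jgam a : J a -> a *: gam = 0.
  by move=> Ja; rewrite /gam -linearZ /= -fg // fC.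
have Cgam : ir_diff E j.+1 gam = 0 by apply/ir_exactS; exists (g 1).
have h0 : submodule (fun x : A^o => x = 0).
  by split=> // a u v -> ->; rewrite scaler0 addr0.
have [||h [hL hE]] := @glue_linear (A^o : lmodType A) (ir_mod E j.+1) (fun x => x = 0)
    (fun=> 0) (x : A^o) gam h0.
- by move=> a u v _ _; rewrite scaler0 addr0.
- by move=> a ax; rewrite Jgam //; exact: (@colon_sub (A^o : lmodType A) (fun x => x = 0) x a h0 x0 Jx ax).
have [||||||h' [h'L h'C h'E]] := @extend_cseries _ _ (fun x : ir_mod E j.+1 => ir_diff E j.+1 x = 0)
    (addx (fun x => x = 0) (x : A^o)) (fun=> True) h.
- by split=> [|a u v u0 v0]; rewrite ?linear0 // linearP u0 v0 scaler0 addr0.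
- by apply: IH; rewrite addSnnS.
- exact/cseries_ring/addx_submodule.
- exact: addx_submodule.
- exact: hL.
- by move=> _ [a [_ [-> ->]]]; rewrite hE // addr0 linearZ /= Cgam scaler0.
have /ir_exactS[v vE] := h'C 1 I.
have xh : x *: h' 1 = gam.
  have <- : h' x = x *: h' 1.
    have := h'L x 1 0 I I; rewrite (linear_on0 _ h'L) //.
    by rewrite !addr0 [x *: 1]mulr1.
  rewrite h'E; last exact: (mem_addx (X := A^o)).
  by have := hE 1 0 erefl; rewrite !scale1r !addr0.
(* Subtracting x v removes the defect and does not change the multiples by J, since J x = 0. *)
exists (g 1 - x *: v); first by rewrite linearB linearZ /= vE xh subrr.
by move=> a Ja; rewrite scalerBr scalerA Jx // scale0r subr0 fg.
Qed.

(* The form in which self-injectivity is used: submodules of free modules are  *)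
(* annihilators.                                                               *)
Lemma rowspan_separation p q (M : 'M[A]_(p, q)) (z : 'rV_q) :
  finite_injdim (A^o : lmodType A) -> ~ rowspan M z ->
  exists2 y : 'cV_q, M *m y = 0 & z *m y <> 0.
Proof.
move=> [E [d Ed]] zM.
have CE := extends_cosyzygy (j := 0) Ed.
have hU := rowspan_submodule M; set U := rowspan M in hU zM *.
have csz : cseries J U (addx U z).
  apply: (cseries_addx (s := s) hU).
  - by move=> a /s_nil[t at0]; exists t; rewrite at0 scale0r; exact: submodule_zero hU.
  - by move=> c /J_span cs; exists 0; rewrite subr0 scale0r; split=> //; exact: submodule_zero hU.
have [|x [[c [u [uU xE]]] xU Jx]] := cseries_socle csz hU.
  by move=> /(_ z (mem_addx z hU)).
(* Here z has been replaced by a socle element x of (U + A z)/U. Sending x to a socle element of A,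
   and U to 0, extends to the whole row space with values in the kernel of the differential on E 0,
   which is A; the extension is therefore a column. *)
have [sg [sg0 Jsg]] := ex_socle.
have [||f [fL fE]] := @glue_linear _ _ U (fun=> 0) x (ir_aug E sg) hU.
- by move=> a v w _ _; rewrite scaler0 addr0.
- move=> a ax; rewrite -linearZ /= [_ *: _]Jsg ?linear0 //.
  exact: colon_sub ax.
have hC0 : submodule (fun x : ir_mod E 0 => ir_diff E 0 x = 0).
  by split=> [|a v w v0 w0]; rewrite ?linear0 // linearP v0 w0 scaler0 addr0.
have [||||g [gL gC gE]] := @extend_cseries _ _ (fun x : ir_mod E 0 => ir_diff E 0 x = 0)
    (addx U x) (fun=> True) f hC0 CE.
- apply: (cseries_top (g := fun i => delta_mx 0 i)); first exact: addx_submodule.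
  by move=> v; exists (fun i => v 0 i); exact: row_sum_delta.
- exact: addx_submodule.
- exact: fL.
- move=> _ [a [v [vU ->]]]; rewrite fE // addr0 linearZ /=.
  by rewrite (iffRL (ir_exact0 _)) ?scaler0 //; exists sg.
have /choice[y yE] i : exists y, ir_aug E y = g (delta_mx 0 i) by apply/ir_exact0/gC.
pose yc := \col_i y i.
have [g' g'E] : exists g' : {linear 'rV[A]_q -> ir_mod E 0}, g' =1 g.
  by apply: ex_linear => a v w; exact: gL.
have gyc v : g v = ir_aug E ((v *m yc) 0 0).
  rewrite -g'E linear_row mxE linear_sum; apply: eq_bigr => i _.
  by rewrite g'E -yE mxE -linearZ.
have fU v : U v -> g v = 0.
  move=> vU; rewrite gE; last exact: incl_addx.
  by have := fE 0 v vU; rewrite !scale0r !add0r.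
have aug0 v : ir_aug E v = 0 -> v = 0.
  by rewrite -(linear0 (ir_aug E)) => /ir_aug_inj.
have UK v : U v -> v *m yc = 0.
  by move=> /fU; rewrite gyc => /aug0 v0; apply/rowP => i; rewrite !ord1 v0 mxE.
exists yc; first by apply/row_matrixP => i; rewrite row0 row_mul UK //; exact: rowspan_row.
move=> zy; apply: sg0; apply: aug0.
have : g x = ir_aug E sg.
  rewrite gE; last exact: mem_addx.
  by have := fE 1 0 (submodule_zero hU); rewrite !scale1r !addr0.
by rewrite gyc xE mulmxDl -scalemxAl zy scaler0 add0r UK // mxE linear0.
Qed.

End SelfInjective.

(** * Filtrations by ideals *)

(** Unlike [idealr], this admits the unit ideal, the top of the filtrations. *)
Definition ideal_p (B : comNzRingType) (a : B -> Prop) :=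
  a 0 /\ forall c u v, a u -> a v -> a (c * u + v).

Definition addr_p (B : comNzRingType) (a : B -> Prop) (beta : B) : B -> Prop :=
  fun r => exists c u, a u /\ r = beta * c + u.

(** The rank one form of [mflat]: (a : beta) = I makes each step from a to a + (beta) a copy of
    B/I. *)
Inductive rflat (B : comNzRingType) (I : B -> Prop) :
  (B -> Prop) -> seq B -> (B -> Prop) -> Prop :=
| rflat_nil a : rflat I a [::] a
| rflat_cons a beta bs a' : (forall c, I c -> a (beta * c)) ->
    (forall c, a (beta * c) -> I c) ->
    rflat I (addr_p a beta) bs a' -> rflat I a (beta :: bs) a'.

(* The submodule a B^b of B^b. *)
Definition idv (B : comNzRingType) b (a : B -> Prop) : 'rV[B]_b -> Prop :=
  fun v => forall j, a (v 0 j).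

Section IdealVectors.
Variable B : comNzRingType.
Implicit Types (a I : B -> Prop).

Lemma ideal_submodule a : ideal_p a -> submodule (a : (B^o : lmodType B) -> Prop).
Proof. by []. Qed.
Lemma ideal0 a : ideal_p a -> a 0. Proof. by case. Qed.
Lemma idealD a x y : ideal_p a -> a x -> a y -> a (x + y).
Proof. by move=> /ideal_submodule ha; exact: (submoduleD ha). Qed.
Lemma idealB a x y : ideal_p a -> a x -> a y -> a (x - y).
Proof. by move=> /ideal_submodule ha; exact: (submoduleB ha). Qed.
Lemma idealN a x : ideal_p a -> a x -> a (- x).
Proof. by move=> /ideal_submodule ha; exact: (submoduleN ha). Qed.
Lemma idealM a c x : ideal_p a -> a x -> a (c * x).
Proof. by move=> /ideal_submodule ha; exact: (submoduleZ (X := B^o) c ha). Qed.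
Lemma ideal_sum a T (r : seq T) F : ideal_p a -> (forall i, a (F i)) -> a (\sum_(i <- r) F i).
Proof. by move=> /ideal_submodule ha; exact: (submodule_sum (X := B^o)). Qed.

Lemma addr_ideal a beta : ideal_p a -> ideal_p (addr_p a beta).
Proof.
move=> ha; split; first by exists 0, 0; rewrite mulr0 addr0; split=> //; exact: ideal0.
move=> c _ _ [x [u [ua ->]]] [y [v [va ->]]]; exists (c * x + y), (c * u + v).
by split; [exact: ha.2 | rewrite !mulrDr mulrCA addrACA].
Qed.

Lemma incl_addr a beta : incl a (addr_p a beta).
Proof. by move=> u ua; exists 0, u; rewrite mulr0 add0r. Qed.

Lemma rflat_incl I a bs a' : rflat I a bs a' -> incl a a'.
Proof.
by elim=> {a bs a'} [a u //|a beta bs a' _ _ _ IH u ua]; apply: IH; exact: incl_addr.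
Qed.

Lemma rflat_ideal I a bs a' : rflat I a bs a' -> ideal_p a -> ideal_p a'.
Proof. by elim=> {a bs a'} // a beta bs a' _ _ _ IH ha; apply/IH/addr_ideal. Qed.

Lemma rflat_cat I a bs1 a' bs2 a'' :
  rflat I a bs1 a' -> rflat I a' bs2 a'' -> rflat I a (bs1 ++ bs2) a''.
Proof. by elim=> {a bs1 a'} // a beta bs a' Ia aI _ IH /IH; exact: rflat_cons. Qed.

Lemma rflat_top I : ideal_p I -> rflat I I [:: 1] (fun=> True).
Proof.
move=> hI; have -> : (fun=> True) = addr_p I 1.
  by apply: pred_ext => v; split=> // _; exists v, 0; rewrite mul1r addr0; split=> //; exact: ideal0.
by apply: rflat_cons; [move=> u; rewrite mul1r..| exact: rflat_nil].
Qed.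

Lemma idv_submodule b a : ideal_p a -> submodule (idv a (b := b)).
Proof.
move=> ha; split=> [j|c u v ua va j]; first by rewrite mxE; exact: ideal0.
by rewrite !mxE; exact: ha.2.
Qed.

Lemma idv_mul p q a (v : 'rV_p) (M : 'M_(p, q)) : ideal_p a -> idv a v -> idv a (v *m M).
Proof.
by move=> ha va j; rewrite mxE; apply: ideal_sum => // k; rewrite mulrC; exact: idealM.
Qed.

Lemma idv_addr b a beta (v : 'rV[B]_b) :
  idv (addr_p a beta) v -> exists x u, idv a u /\ v = beta *: x + u.
Proof.
move=> /choice[x /choice[u xuE]]; exists (\row_j x j), (\row_j u j).
split=> [j|]; first by rewrite mxE; case: (xuE j).
by apply/rowP => j; rewrite !mxE; case: (xuE j).
Qed.

Lemma stepv_idv b a beta : stepv (idv a (b := b)) beta = idv (addr_p a beta) (b := b).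
Proof.
apply: pred_ext => v; split=> [[x [u [ua ->]]] j|/idv_addr //].
by rewrite !mxE; exists (x 0 j), (u 0 j).
Qed.

Lemma mflat_idv b I a bs a' : rflat I a bs a' ->
  mflat (idv I (b := b)) (idv a) bs (idv a').
Proof.
elim=> {a bs a'} [a|a beta bs a' Ia aI _ IH]; first exact: mflat_nil.
apply: mflat_cons; last by rewrite stepv_idv.
  by move=> u uI j; rewrite mxE; exact/Ia/uI.
by move=> u ua j; apply: aI; have := ua j; rewrite mxE.
Qed.

End IdealVectors.

(** * Exactness of a complex modulo an ideal *)

Section ExactModulo.
Variables (B : comNzRingType) (e : nat -> nat).
Variable D : forall i, 'M[B]_(e i.+1, e i).
Hypothesis DD : complex_mx D.
Implicit Types (a I : B -> Prop).

(** For a resolution D of M this is Tor_i(M, B/a) = 0 for all i > 0. *)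
Definition exact_mod a := forall i (v : 'rV_(e i.+1)), idv a (v *m D i) ->
  exists u w, idv a u /\ v = u + w *m D i.+1.

(* The submodule a M of the module M presented by D 0. *)
Definition idK a : 'rV[B]_(e 0%N) -> Prop := sumv (idv a) (rowspan (D 0%N)).

Lemma idK_submodule a : ideal_p a -> submodule (idK a).
Proof. by move=> ha; apply: sumv_submodule; [exact: idv_submodule | exact: rowspan_submodule]. Qed.

Lemma exact_mod_rflat I a bs a' : rflat I a bs a' -> ideal_p I -> ideal_p a ->
  exact_mod I -> exact_mod a' -> exact_mod a.
Proof.
move=> fl hI; elim: fl => {a bs a'} // a beta bs a' Ia aI _ IH ha XI Xa'.
have ha1 := addr_ideal beta ha.
move=> i v va.
have [|u [w [/idv_addr[x [u' [u'a uE]]] vE]]] := IH ha1 XI Xa' i v.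
  by move=> j; exact/incl_addr/va.
have [|y [z [yI xE]]] := XI i x.
  move=> j; apply: aI; have : idv a (beta *: (x *m D i)); last by move/(_ j); rewrite mxE.
  have -> : beta *: (x *m D i) = v *m D i - u' *m D i.
    by rewrite vE uE !mulmxDl -mulmxA DD mulmx0 addr0 addrK scalemxAl.
  by apply: (submoduleB (idv_submodule _ ha)) => //; exact: idv_mul.
exists (beta *: y + u'), (w + beta *: z); split.
  apply: (submoduleD (idv_submodule _ ha)) => //.
  by move=> j; rewrite mxE; exact/Ia/yI.
by rewrite vE uE xE scalerDr mulmxDl -scalemxAl -!addrA; congr (_ + _); rewrite addrC -addrA.
Qed.

Lemma exact_mod_all : exact_mod (fun=> True).
Proof. by move=> i v _; exists v, 0; rewrite mul0mx addr0. Qed.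

(** Multiplication by beta from M/IM to M/aM is injective because D is exact in degree 1 modulo a +
    (beta). *)
Lemma mflat_idK I a bs a' : rflat I a bs a' -> ideal_p I -> ideal_p a ->
  exact_mod I -> exact_mod a' -> mflat (idK I) (idK a) bs (idK a').
Proof.
move=> fl hI + XI; elim: fl => {a bs a'} [a _ _|a beta bs a' Ia aI fl IH ha Xa']; first exact: mflat_nil.
have ha1 := addr_ideal beta ha.
have Xa1 := exact_mod_rflat fl hI ha1 XI Xa'.
have hK := rowspan_submodule (D 0%N).
apply: mflat_cons.
- move=> _ [u [k [uI kK ->]]]; rewrite scalerDr; exists (beta *: u), (beta *: k).
  by split=> //; [move=> j; rewrite mxE; exact/Ia/uI | exact: submoduleZ].
- move=> u [al [_ [ala [t ->] uE]]].
  have [|t' [w [/idv_addr[t2 [al' [al'a t'E]]] tE]]] := Xa1 0%N t.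
    have -> : t *m D 0%N = beta *: u - al by rewrite uE addrC addKr.
    rewrite -stepv_idv; exists u, (- al); split=> //.
    exact: (submoduleN (idv_submodule _ ha)).
  have tD : t *m D 0%N = beta *: (t2 *m D 0%N) + al' *m D 0%N.
    by rewrite tE t'E !mulmxDl -mulmxA DD mulmx0 addr0 -scalemxAl.
  exists (u - t2 *m D 0%N), (t2 *m D 0%N); split; last by rewrite subrK.
    move=> j; apply: aI; have : idv a (beta *: (u - t2 *m D 0%N)); last by move/(_ j); rewrite mxE.
    rewrite scalerBr uE tD [_ + (_ + _)]addrCA [_ + (al + _)]addrC addrK.
    by apply: (submoduleD (idv_submodule _ ha)) => //; exact: idv_mul.
  by exists t2.
have -> : stepv (idK a) beta = idK (addr_p a beta); last exact: IH.
apply: pred_ext => v; split=> [[x [_ [[u [k [ua kK ->]]] ->]]]|].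
  exists (beta *: x + u), k; rewrite addrA; split=> //.
  by rewrite -stepv_idv; exists x, u.
move=> [_ [k [/idv_addr[x [u [ua ->]]] kK ->]]].
by exists x, (u + k); rewrite addrA; split=> //; exists u, k.
Qed.

End ExactModulo.

(** * Passage to a quotient ring *)

Section RingQuotientTransfer.
Variables (B C : comNzRingType) (psi : {rmorphism B -> C}) (a : B -> Prop).
Hypotheses (psi_surj : forall c, exists x, psi x = c) (psi_ker : forall x, psi x = 0 <-> a x).

Lemma ker_ideal : ideal_p a.
Proof.
split; first by apply/psi_ker; rewrite rmorph0.
by move=> c u v /psi_ker u0 /psi_ker v0; apply/psi_ker; rewrite rmorphD rmorphM u0 v0 mulr0 addr0.
Qed.

Lemma map_mx_surj p q (M : 'M[C]_(p, q)) : exists N, M = map_mx psi N.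
Proof.
have /choice[f fE] (ij : 'I_p * 'I_q) : exists x, psi x = M ij.1 ij.2 by exact: psi_surj.
by exists (\matrix_(i, j) f (i, j)); apply/matrixP => i j; rewrite !mxE fE.
Qed.

Lemma map_mx_ker b (v : 'rV[B]_b) : map_mx psi v = 0 <-> idv a v.
Proof.
split=> [/rowP v0 j|va]; first by apply/psi_ker; have := v0 j; rewrite !mxE.
by apply/rowP => j; rewrite !mxE; apply/psi_ker.
Qed.

Variables (e : nat -> nat) (D : forall i, 'M[B]_(e i.+1, e i)).
Hypothesis DD : complex_mx D.
Let Dp i := map_mx psi (D i).

Lemma Hz_map b (U : 'rV[C]_b -> Prop) i :
  Hz Dp allv U i <-> Hz D allv (fun v => U (map_mx psi v)) i.
Proof.
have rowsE m (y : 'M[B]_(m, b)) :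
    rowsin U (map_mx psi y) <-> rowsin (fun v => U (map_mx psi v)) y.
  by split=> h j; have := h j; rewrite map_row.
split=> H y _.
  move=> /rowsE; rewrite map_mxM => yU; have [//|z _ zU] := H _ _ yU.
  have [z' zE] := map_mx_surj z; exists z' => //; apply/rowsE.
  by rewrite map_mxB map_mxM -zE.
have [y' ->] := map_mx_surj y; rewrite -map_mxM => /rowsE yU.
have [//|z _ /rowsE zU] := H _ _ yU; exists (map_mx psi z) => //.
by rewrite -map_mxM -map_mxB.
Qed.

Lemma map_zerov b : (fun v : 'rV[B]_b => zerov (map_mx psi v)) = idv a.
Proof. by apply: pred_ext => v; exact: map_mx_ker. Qed.

Lemma map_rowspan p q (M : 'M[B]_(p, q)) :
  (fun v => rowspan (map_mx psi M) (map_mx psi v)) = sumv (idv a) (rowspan M).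
Proof.
apply: pred_ext => v; split=> [[w]|[u [_ [ua [w ->] ->]]]].
  have [w' ->] := map_mx_surj w; rewrite -map_mxM => vE.
  exists (v - w' *m M), (w' *m M); rewrite subrK; split=> //; last by exists w'.
  by apply/map_mx_ker; rewrite map_mxB vE subrr.
by exists (map_mx psi w); rewrite map_mxD map_mxM (iffRL (map_mx_ker _) ua) add0r.
Qed.

Lemma SAC_mx_transfer : SAC_mx C -> exact_mod D a ->
  (forall i, Hz D (b := 1) allv (idv a) i) ->
  (exists c, forall i, (c <= i)%N -> Hz D allv (idK D a) i) ->
  forall i, Hz D allv (idK D a) i.
Proof.
move=> sC Xa Ha [c Hc].
have K i : Hz Dp allv (rowspan (Dp 0%N)) i <-> Hz D allv (idK D a) i.
  by rewrite Hz_map map_rowspan.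
move=> i; apply/K; apply: sC.
- by move=> j; rewrite -map_mxM DD map_mx0.
- move=> j v; have [v' ->] := map_mx_surj v; rewrite -map_mxM => /map_mx_ker/Xa[u [w [ua ->]]].
  by exists (map_mx psi w); rewrite map_mxD map_mxM (iffRL (map_mx_ker _) ua) add0r.
- by move=> j; apply/Hz_map; rewrite map_zerov.
by exists c => j cj; apply/K/Hc.
Qed.

(** A cycle v modulo a that is not a boundary is detected by a column y with [D i.+1] y = 0 modulo
    a. By the vanishing of cohomology y = D_i z modulo a, so v y = (v D_i) z = 0 modulo a, a
    contradiction. *)
Lemma exact_mod_separation :
  (forall p q (M : 'M[C]_(p, q)) (z : 'rV_q), ~ rowspan M z ->
     exists2 y : 'cV_q, M *m y = 0 & z *m y <> 0) ->
  (forall i, Hz D (b := 1) allv (idv a) i) -> exact_mod D a.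
Proof.
move=> sep Ha i v va.
have [[w]|/sep[y]] := pselect (rowspan (Dp i.+1) (map_mx psi v)).
  have [w' ->] := map_mx_surj w; rewrite -map_mxM => vE.
  exists (v - w' *m D i.+1), w'; rewrite subrK; split=> //.
  by apply/map_mx_ker; rewrite map_mxB vE subrr.
have [y' ->] := map_mx_surj y; rewrite -!map_mxM => Dy vy; case: vy.
have [//||z _ zE] := Ha i y'.
  by move=> j; apply/map_mx_ker; rewrite map_row Dy row0.
have -> : v *m y' = v *m (y' - D i *m z) + v *m D i *m z.
  by rewrite mulmxBr mulmxA subrK.
rewrite map_mxD (iffRL (map_mx_ker _)) ?(iffRL (map_mx_ker _)) ?addr0 //.
  by apply: idv_mul => //; exact: ker_ideal.
move=> j; rewrite mxE; apply: ideal_sum; first exact: ker_ideal.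
move=> k; apply: idealM; first exact: ker_ideal.
by have := zE k j; rewrite mxE.
Qed.

End RingQuotientTransfer.

(* B / I is Artinian local: J is generated by s, B / J is a field, and the      *)
(* elements of s are nilpotent modulo I.                                       *)
Definition artinian_mod (B : comNzRingType) (J : B -> Prop) (s : seq B) (I : B -> Prop) :=
  [/\ forall a, ~ J a -> exists c, J (1 - c * a),
      forall a, J a -> lspan s a &
      forall a, a \in s -> exists t, I (a ^+ t)].

(** * Descent of vanishing through B / I *)

Section Descent.
Variables (B : comNzRingType) (J : B -> Prop) (s : seq B) (I : B -> Prop).
Hypotheses (hI : ideal_p I) (artI : artinian_mod J s I).
Variables (e : nat -> nat) (D : forall i, 'M[B]_(e i.+1, e i)).
Hypothesis DD : complex_mx D.

Lemma cohomology_finite_length b (F : 'rV[B]_b -> Prop) i : submodule F ->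
  (forall v, idv I v -> F v) -> exists n, ~ lgeH D n allv F i.
Proof.
move=> hF IF; have [Jf Js sn] := artI.
have hM := rowsin_submodule (e i.+1) hF.
have cs : cseries J (rowsin F (m := e i.+1)) (fun=> True).
  apply: (cseries_fin (s := s) (g := fun ij : 'I_(e i.+1) * 'I_b => delta_mx ij.1 ij.2)) => //.
    move=> a /sn[t at0]; exists t => x j; apply: IF => k.
    by rewrite !mxE mulrC; exact: idealM.
  move=> x; exists (fun ij => x ij.1 ij.2).
  rewrite -(pair_bigA _ (fun i j => x i j *: delta_mx i j)) /=; exact: matrix_sum_delta.
have [n nl] := cseries_finite_length Jf cs hM.
exists n => ln; apply: nl; apply: lge_mono ln => // y yF.
exact: coboundary_rows.
Qed.

Lemma idv_all b : idv (fun=> True) = @allv B b.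
Proof. by apply: pred_ext. Qed.

Lemma idK_all : idK D (fun=> True) = allv.
Proof.
apply: pred_ext => v; split=> // _; exists v, 0; rewrite addr0; split=> //.
exact: submodule_zero (rowspan_submodule _).
Qed.

Lemma Hz_down b (F U : 'rV[B]_b -> Prop) bs c : mflat F U bs F -> submodule F -> submodule U ->
  (forall i, Hz D allv U i) -> (forall i, (c <= i)%N -> Hz D allv F i) -> forall i, Hz D allv F i.
Proof.
move=> fl hF hU HU Hc.
have down k : forall i, (c <= i + k)%N -> Hz D allv F i.
  elim: k => [|k IH] i; first by rewrite addn0; exact: Hc.
  rewrite addnS -addSn => /IH h; exact: (Hz_mflat_back DD fl).
by move=> i; apply: (down c); exact: leq_addl.
Qed.

Variables (A C : comNzRingType) (phi : {rmorphism B -> A}) (psi : {rmorphism B -> C}).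
Variables (q a d : B -> Prop) (bs1 bs2 bs3 : seq B).
Hypotheses (phi_surj : forall c, exists x, phi x = c) (phi_ker : forall x, phi x = 0 <-> I x).
Hypotheses (psi_surj : forall c, exists x, psi x = c) (psi_ker : forall x, psi x = 0 <-> d x).
Hypothesis sepA : forall p q (M : 'M[A]_(p, q)) (z : 'rV_q), ~ rowspan M z ->
  exists2 y : 'cV_q, M *m y = 0 & z *m y <> 0.
Hypotheses (hq : ideal_p q) (flqa : rflat I q bs1 a) (flaI : rflat I a bs2 I).
Hypotheses (bs12 : ((size bs2).+1 < size bs1)%N).
Hypothesis (bs1q : forall beta c, beta \in bs1 -> I c -> q (beta * c)).
Hypotheses (fldI : rflat I d bs3 I).
Hypothesis sC : SAC_mx C.

(* Vanishing goes from B / q down to A = B / I by comparing lengths, from there *)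
(* up to C = B / d where SAC applies, and back to B / q through A.              *)
Lemma SAC_descent :
  (forall i, Hz D (b := 1) allv (idv q) i) ->
  (exists c, forall i, (c <= i)%N -> Hz D allv (idK D q) i) ->
  forall i, Hz D allv (idK D q) i.
Proof.
move=> HBq [c HMq].
have hd : ideal_p d := ker_ideal psi_ker; have ha := rflat_ideal flqa hq.
have flqI := rflat_cat flqa flaI; have fltop := rflat_top hI.
have hI1 := idv_submodule 1 hI; have hd1 := idv_submodule 1 hd.
have hIK := idK_submodule D hI; have hqK := idK_submodule D hq.
have hdK := idK_submodule D hd.
have HBI i : Hz D (b := 1) allv (idv I) i.
  apply: (Hz_mflat_descent DD (mflat_idv 1 flqa) (mflat_idv 1 flaI) bs12 _ _ _ _ (c := 0)) => //.
  - exact: idv_submodule.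
  - by move=> beta u bbs uI j; rewrite mxE; apply: bs1q => //; exact: uI.
  by move=> j; exact: cohomology_finite_length.
have XI : exact_mod D I := exact_mod_separation phi_surj phi_ker sepA HBI.
have Xa : exact_mod D a := exact_mod_rflat DD flaI hI ha XI XI.
have Xd : exact_mod D d := exact_mod_rflat DD fldI hI hd XI XI.
have Xall : exact_mod D (fun=> True) by move=> j v _; exact: exact_mod_all.
(* Only from c on: the lower degrees are reached after SAC has been applied to C. *)
have HMI : forall i, (c <= i)%N -> Hz D allv (idK D I) i.
  apply: (Hz_mflat_descent DD (mflat_idK DD flqa hI hq XI Xa) (mflat_idK DD flaI hI ha XI XI)) => //.
    move=> beta _ bbs [v [k [vI kK ->]]]; rewrite scalerDr; exists (beta *: v), (beta *: k).
    split=> //; last exact: submoduleZ (rowspan_submodule _) _.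
    by move=> j; rewrite mxE; apply: bs1q => //; exact: vI.
  move=> j; apply: cohomology_finite_length => // v vI; exists v, 0; rewrite addr0; split=> //.
  exact: submodule_zero (rowspan_submodule _).
have fld := mflat_idK DD (rflat_cat fldI fltop) hI hd XI Xall; rewrite idK_all in fld.
have flq := mflat_idK DD (rflat_cat flqI fltop) hI hq XI Xall; rewrite idK_all in flq.
have HMd : forall i, Hz D allv (idK D d) i.
  apply: (SAC_mx_transfer psi_surj psi_ker DD sC Xd).
    move=> i; have := mflat_idv 1 (rflat_cat fldI fltop); rewrite idv_all => fl1.
    exact: (Hz_mflat DD fl1).
  by exists c => i ci; apply: (Hz_mflat DD fld) => //; exact: HMI.
move=> i; apply: (Hz_mflat DD flq) => //.
exact: (Hz_down (mflat_idK DD fldI hI hd XI XI)) HMd HMI i.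
Qed.

End Descent.

(** * Noetherian modules *)

Section FinitelyGenerated.
Variable B : comNzRingType.
Implicit Types X Y Z : lmodType B.

Fixpoint vspan X (gs : seq X) (x : X) : Prop :=
  if gs is g :: hs then exists c y, vspan hs y /\ x = c *: g + y else x = 0.

Definition noetherian_module X :=
  forall U : X -> Prop, submodule U -> exists gs, forall x, U x <-> vspan gs x.

Lemma vspan_submodule X (gs : seq X) : submodule (vspan gs).
Proof.
elim: gs => [|g gs IH] /=; first by split=> // a u v -> ->; rewrite scaler0 addr0.
have [v0 vP] := IH; split; first by exists 0, 0; rewrite scale0r addr0.
move=> a _ _ [c [y [ys ->]]] [d [z [zs ->]]]; exists (a * c + d), (a *: y + z).
by split; [exact: vP | rewrite scalerDr scalerDl scalerA addrACA].
Qed.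

Lemma vspan_gen X (gs : seq X) g : g \in gs -> vspan gs g.
Proof.
elim: gs => // h gs IH; rewrite inE => /orP[/eqP->|/IH gh] /=.
  by exists 1, 0; rewrite scale1r addr0; split=> //; exact: submodule_zero (vspan_submodule gs).
by exists 0, g; rewrite scale0r add0r.
Qed.

Lemma vspan_min X (gs : seq X) (U : X -> Prop) : submodule U ->
  (forall g, g \in gs -> U g) -> incl (vspan gs) U.
Proof.
move=> hU; elim: gs => [|g gs IH] gU x /=; first by move=> ->; exact: submodule_zero.
move=> [c [y [ys ->]]]; apply: hU.2; first by apply: gU; exact: mem_head.
by apply: IH ys => h hs; apply: gU; rewrite inE hs orbT.
Qed.

Lemma noetherian_ext X Y Z (f : {linear X -> Y}) (p : {linear Y -> Z}) :
  (forall y, p y = 0 -> exists x, f x = y) ->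
  noetherian_module X -> noetherian_module Z -> noetherian_module Y.
Proof.
move=> ker nX nZ U hU.
have [|xs xsE] := nX (fun x => U (f x)).
  by split=> [|a u v uU vU]; rewrite ?linear0 ?linearP; [exact: submodule_zero | exact: hU.2].
have [|zs zsE] := nZ (fun z => exists2 y, U y & p y = z).
  split=> [|a _ _ [y yU <-] [z zU <-]]; first by exists 0; [exact: submodule_zero | rewrite linear0].
  by exists (a *: y + z); [exact: hU.2 | rewrite linearP].
have [ys [ysU ysE]] : exists ys, (forall y, y \in ys -> U y) /\ map p ys = zs.
  have : forall z, z \in zs -> exists2 y, U y & p y = z by move=> z /vspan_gen/zsE.
  elim: zs {zsE} => [|z zs IH] zsP; first by exists [::].
  have [|ys [ysU ysE]] := IH; first by move=> t ts; apply: zsP; rewrite inE ts orbT.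
  have [y yU yz] := zsP z (mem_head _ _); exists (y :: ys); split; last by rewrite /= yz ysE.
  by move=> t; rewrite inE => /orP[/eqP->|/ysU].
have lift z : vspan zs z -> exists2 y, vspan ys y & p y = z.
  rewrite -ysE; elim: ys {ysE ysU} z => [|y ys IH] z /= => [->|[c [w [/IH[v vs <-] ->]]]].
    by exists 0; rewrite ?linear0.
  by exists (c *: y + v); [exists c, v | rewrite linearP].
exists (map f xs ++ ys) => y; split.
  move=> yU; have [|w ws wy] := lift (p y); first by apply/zsE; exists y.
  have [|x xE] := ker (y - w); first by rewrite linearB wy subrr.
  have xs_x : vspan xs x.
    apply/xsE; rewrite xE; apply: submoduleB => //.
    by apply: vspan_min ws.
  have hs := vspan_submodule (map f xs ++ ys).
  rewrite -(subrK w y) -xE; apply: submoduleD => //.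
    elim: (xs) x {xE} xs_x {xsE hs} => [|g gs IH] x /=.
      by move=> ->; rewrite linear0; exact: submodule_zero (vspan_submodule _).
    by move=> [c [v [/IH vs ->]]]; exists c, (f v); rewrite linearP.
  apply: vspan_min ws => // g gs; apply: vspan_gen; by rewrite mem_cat gs orbT.
apply: vspan_min => // g; rewrite mem_cat => /orP[/mapP[x xs_x ->]|/ysU//].
by apply/xsE; exact: vspan_gen.
Qed.

Lemma noetherian_trivial X : (forall x : X, x = 0) -> noetherian_module X.
Proof.
move=> X0 U hU; exists [::] => x; split=> [_|->] /=; [exact: X0 | exact: submodule_zero].
Qed.

Lemma nakayama X (U V : X -> Prop) (x : B) gs : submodule U -> submodule V ->
  (forall a, exists c, c * (1 - a * x) = 1) ->
  (forall v, V v -> vspan gs v) -> (forall g, g \in gs -> V g) ->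
  (forall v, V v -> exists u w, [/\ U u, V w & v = u + x *: w]) -> incl V U.
Proof.
move=> hU hV radx Vgs gsV VUx.
(* The induction keeps only that V lies in U + span gs, which survives the removal of a generator g:
   in the equation for g the factor 1 - c x is invertible, so g is expressed by U and the others. *)
have {}Vgs v : V v -> exists u w, [/\ U u, vspan gs w & v = u + w].
  by move=> /Vgs vs; exists 0, v; rewrite add0r; split=> //; exact: submodule_zero.
elim: gs Vgs gsV => [|g gs IH] Vgs gsV.
  by move=> v /Vgs[u [w [uU -> ->]]]; rewrite addr0.
apply: IH; last by move=> h hs; apply: gsV; rewrite inE hs orbT.
have hs := vspan_submodule gs.
have [u [w [uU /Vgs[u' [_ [u'U [c [y [ys ->]] ->]]]] gE]]] := VUx g (gsV g (mem_head _ _)).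
have [d dE] := radx c.
have {}gE : g = d *: (u + x *: u') + d *: (x *: y).
  rewrite -[LHS]scale1r -dE -scalerA -scalerDr; congr (_ *: _).
  rewrite scalerBl scale1r {1}gE !scalerDr scalerA [c * x]mulrC.
  by rewrite !addrA [LHS]addrAC addrK.
move=> v /Vgs[u1 [_ [u1U [c1 [y1 [y1s ->]] ->]]]].
exists (u1 + c1 *: (d *: (u + x *: u'))), (c1 *: (d *: (x *: y)) + y1); split.
- by apply: submoduleD => //; do 2!apply: submoduleZ => //; apply: submoduleD => //; exact: submoduleZ.
- by apply: submoduleD => //; do 3!apply: submoduleZ => //.
by rewrite {1}gE scalerDr !addrA.
Qed.

End FinitelyGenerated.

Section NoetherianRing.
Variable R : comNzRingType.

Section PropIdeal.
Variables (U : R -> Prop) (hU : ideal_p U) (U1 : ~ U 1).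
Definition prop_ideal of ideal_p U & ~ U 1 : R -> bool := fun x => `[< U x >].
Fact prop_ideal_closed : idealr_closed (prop_ideal hU U1).
Proof.
split; first by apply/asboolP; exact: ideal0.
  by apply/asboolP.
by move=> a x y /asboolP xU /asboolP yU; apply/asboolP; exact: hU.2.
Qed.
HB.instance Definition _ := isIdealr.Build R (prop_ideal hU U1) prop_ideal_closed.
Lemma ex_idealr : exists J : idealr R, forall x, x \in J <-> U x.
Proof.
exists (Idealr.clone R (prop_ideal hU U1) _) => x.
by split=> [/asboolP|xU] //; apply/asboolP.
Qed.
End PropIdeal.

Lemma lspanE (s : seq R) (x : R) :
  lspan s x <-> exists c : 'I_(size s) -> R, x = \sum_i c i * s`_i.
Proof.
elim: s x => [|y s IH] x /=.
  by split=> [->|[c ->]]; [exists (fun=> 0)|]; rewrite big_ord0.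
split=> [[c [r [/IH[d ->] ->]]]|[c ->]].
  exists (fun i => if unlift ord0 i is Some j then d j else c).
  by rewrite big_ord_recl unlift_none; congr (_ + _); apply: eq_bigr => i _; rewrite liftK.
rewrite big_ord_recl; exists (c ord0), (\sum_(i < size s) c (lift ord0 i) * s`_i).
by split=> //; apply/IH; exists (fun i => c (lift ord0 i)).
Qed.

Lemma ideal_genP (s : seq R) x : x \in ideal_gen s <-> lspan s x.
Proof. by rewrite lspanE; split=> [/asboolP|?] //; apply/asboolP. Qed.

Lemma vspan_lspan (s : seq R) x : vspan (X := R^o) s x <-> lspan s x.
Proof. by elim: s x => //= y s IH x; split=> -[c [r [/IH rs ->]]]; exists c, r. Qed.

Lemma noetherian_regular : noetherian R -> noetherian_module (R^o : lmodType R).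
Proof.
move=> nR U hU; have [U1|U1] := pselect (U 1).
  exists [:: 1 : R^o] => x; split=> [_|_]; last by rewrite -[x]mulr1; exact: submoduleZ.
  by exists x, 0; rewrite addr0; split=> //; rewrite [_ *: _]mulr1.
have [J JE] := ex_idealr hU U1; have [s sE] := nR J; exists s => x.
by rewrite vspan_lspan -ideal_genP -sE JE.
Qed.

Lemma noetherian_row n : noetherian_module (R^o : lmodType R) ->
  noetherian_module ('rV[R]_n : lmodType R).
Proof.
move=> nR; elim: n => [|n IH]; first by apply: noetherian_trivial => x; apply/rowP => -[].
have fL : linear (row_mx (0 : 'rV[R]_1) : 'rV[R]_n -> 'rV[R]_(1 + n)).
  by move=> a u v; rewrite scale_row_mx add_row_mx scaler0 addr0.
have pL : linear (fun v : 'rV[R]_(1 + n) => v 0 0 : R^o) by move=> a u v; rewrite !mxE.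
have [f fE] := ex_linear fL; have [p pE] := ex_linear pL.
apply: (noetherian_ext (f := f) (p := p)) IH nR => v; rewrite pE => v0.
exists (rsubmx v); rewrite fE -[RHS]hsubmxK; congr row_mx.
by apply/rowP => i; rewrite !mxE ord1 -v0; congr (v _ _); apply: val_inj.
Qed.

Lemma noetherian_image (X Y : lmodType R) (f : {linear X -> Y}) :
  (forall y, exists x, f x = y) -> noetherian_module X -> noetherian_module Y.
Proof.
move=> f_surj nX; have zL : linear (fun _ : Y => 0 : Y).
  by move=> a u v; rewrite scaler0 addr0.
have [z zE] := ex_linear zL.
have Z0 : submodule (fun y : Y => y = 0) by split=> // a u v -> ->; rewrite scaler0 addr0.
have [Z [i [i_inj iE]]] := ex_submodule Z0.
have Zt (t : Z) : t = 0.
  by apply: i_inj; rewrite linear0; apply/iE; exists t.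
have pL : linear (fun _ : Y => 0 : Z) by move=> a u v; rewrite scaler0 addr0.
have [p pE] := ex_linear pL.
by apply: (noetherian_ext (f := f) (p := p)) => //; exact: noetherian_trivial.
Qed.

Lemma noetherian_matrix p q : noetherian_module (R^o : lmodType R) ->
  noetherian_module ('M[R]_(p, q) : lmodType R).
Proof.
move=> /(@noetherian_row (p * q)%N); apply: (noetherian_image (f := vec_mx)) => y.
by exists (mxvec y); exact: mxvecK.
Qed.

Lemma noetherian_mxE : noetherian_module (R^o : lmodType R) -> noetherian_mx R.
Proof.
move=> nR n U hU; have [gs gsE] := noetherian_row (n := n) nR hU.
exists (size gs), (\matrix_(i < size gs) gs`_i) => v; rewrite gsE {gsE}.
split.
  have hs := rowspan_submodule (\matrix_(i < size gs) gs`_i).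
  apply: vspan_min => // g /(nthP 0)[i isz <-].
  by have := rowspan_row (\matrix_(i < size gs) gs`_i) (Ordinal isz); rewrite rowK.
move=> [w ->]; rewrite mulmx_sum_row; apply: submodule_sum; first exact: vspan_submodule.
move=> i; rewrite rowK; apply: submoduleZ; first exact: vspan_submodule.
exact/vspan_gen/mem_nth.
Qed.

End NoetherianRing.

Lemma noetherian_mx_quotient (B C : comNzRingType) (psi : {rmorphism B -> C}) :
  (forall c, exists x, psi x = c) -> noetherian_mx B -> noetherian_mx C.
Proof.
move=> psi_surj nB n U hU.
have [|k [A AE]] := nB n (fun v => U (map_mx psi v)).
  split=> [|a u v uU vU]; first by rewrite map_mx0; exact: submodule_zero.
  by rewrite map_mxD map_mxZ; exact: hU.2.
exists k, (map_mx psi A) => v; have [v' ->] := map_mx_surj psi_surj v.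
rewrite AE; split=> [[w ->]|[w]]; first by exists (map_mx psi w); rewrite map_mxM.
have [w' ->] := map_mx_surj psi_surj w; rewrite -map_mxM => vE.
by apply/AE; rewrite vE; apply/AE; exists w'.
Qed.

(** * Reduction modulo a regular sequence *)

(* Each element is a nonzerodivisor modulo the ones that FOLLOW it in the list. *)
Fixpoint suffix_regular (B : comNzRingType) (xs : seq B) : Prop :=
  if xs is x :: t then
    suffix_regular t /\ forall r, lspan t (x * r) -> lspan t r
  else True.

Section RegularReduction.
Variable B : comNzRingType.

Lemma lspan_ideal (xs : seq B) : ideal_p (lspan xs).
Proof.
elim: xs => [|x xs IH] /=; first by split=> // c u v -> ->; rewrite mulr0 addr0.
split; first by exists 0, 0; rewrite mul0r addr0; split=> //; exact: ideal0.
move=> a _ _ [c [u [us ->]]] [d [v [vs ->]]]; exists (a * c + d), (a * u + v).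
by split; [exact: IH.2 | rewrite mulrDr mulrDl mulrA addrACA].
Qed.

Lemma lspan_cons (x : B) xs : lspan (x :: xs) = addr_p (lspan xs) x.
Proof.
by apply: pred_ext => r; split=> -[c [u [us ->]]]; exists c, u; rewrite mulrC.
Qed.

Lemma rflat_regular x (xs : seq B) : suffix_regular (x :: xs) ->
  rflat (lspan xs) (lspan xs) [:: x] (lspan (x :: xs)).
Proof.
move=> [_ reg]; apply: rflat_cons => //.
  by move=> c; apply: idealM; exact: lspan_ideal.
by rewrite -lspan_cons; exact: rflat_nil.
Qed.

Section Cochains.
Variables (e : nat -> nat) (D : forall i, 'M[B]_(e i.+1, e i)).
Hypothesis DD : complex_mx D.
Variables (b : nat) (U : 'rV[B]_b -> Prop) (x : B).
Hypotheses (hU : submodule U) (xU : forall v, U (x *: v) -> U v).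

(** Long exact sequence of multiplication by x on N/U, with N the row space and N/(U + xN) as
    cokernel. *)
Lemma Hz_stepv i : Hz D allv U i -> Hz D allv U i.+1 -> Hz D allv (stepv U x) i.
Proof.
move=> H0 H1 y _ /rowsin_stepv[w [u [uU Dy]]].
have [//||z _ zE] := H1 w.
  apply: (rowsin_unscale xU); have := DDK DD y; rewrite Dy mulmxDr -scalemxAr => /eqP.
  rewrite addr_eq0 => /eqP ->; apply: rowsinN => //; exact: rowsin_mul.
have [//||v _ vE] := H0 (y - x *: z).
  have -> : D i.+1 *m (y - x *: z) = x *: (w - D i.+1 *m z) + u.
    by rewrite mulmxBr Dy -scalemxAr scalerBr addrAC.
  by apply: rowsinP.
exists v => // j; have -> : y - D i *m v = x *: z + (y - x *: z - D i *m v).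
  by rewrite [_ - x *: z - _]addrAC [RHS]addrC subrK.
rewrite linearD linearZ; exists (row j z), (row j (y - x *: z - D i *m v)).
by split=> //; exact: vE.
Qed.

(** Vanishing modulo x makes every cocycle a coboundary plus x times a cocycle, and Nakayama's lemma
    applies to the finitely generated module of cocycles. *)
Lemma Hz_unstepv i : noetherian_module (B^o : lmodType B) ->
  (forall a, exists c, c * (1 - a * x) = 1) ->
  Hz D allv (stepv U x) i -> Hz D allv U i.
Proof.
move=> nB radx H; apply/HzE.
have hT : submodule (@allv B b) by [].
have hz := cocycle_submodule D i hU hT; have hb := coboundary_submodule D i hU hT.
have [gs gsE] := noetherian_matrix (p := e i.+1) (q := b) nB hz.
apply: (nakayama hb hz radx (gs := gs)).
- by move=> v /gsE.
- by move=> g gs_g; apply/gsE; exact: vspan_gen.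
move=> y [_ yU]; have [//||z _ /rowsin_stepv[w [u [uU yE]]]] := H y.
  by move=> j; exact/incl_stepv/yU.
exists (D i *m z + u), w; split.
- exact: coboundaryI.
- split=> //; apply: (rowsin_unscale xU).
  have -> : x *: (D i.+1 *m w) = D i.+1 *m y - D i.+1 *m u.
    by rewrite scalemxAr (canRL (addrK u) (esym yE)) !mulmxBr DDK // subr0.
  by apply: rowsinB => //; exact: rowsin_mul.
by rewrite -addrA [u + _]addrC -yE addrC subrK.
Qed.

End Cochains.

Section Regular.
Variables (e : nat -> nat) (D : forall i, 'M[B]_(e i.+1, e i)).
Hypothesis DD : complex_mx D.

Lemma stepv_idK a x : stepv (idK D a) x = idK D (addr_p a x).
Proof.
have hK := rowspan_submodule (D 0%N).
apply: pred_ext => v; split=> [[y [_ [[u [k [ua kK ->]]] ->]]]|].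
  exists (x *: y + u), k; rewrite addrA; split=> //.
  by rewrite -stepv_idv; exists y, u.
move=> [_ [k [/idv_addr[y [u [ua ->]]] kK ->]]].
by exists y, (u + k); rewrite addrA; split=> //; exists u, k.
Qed.

Lemma idK_regular x xs : suffix_regular (x :: xs) -> exact_mod D (lspan (x :: xs)) ->
  exact_mod D (lspan xs) -> forall v, idK D (lspan xs) (x *: v) -> idK D (lspan xs) v.
Proof.
move=> reg X1 X0; have hl := lspan_ideal xs.
have fl := mflat_idK DD (rflat_regular reg) hl hl X0 X1.
by move: {2 3}(idK _ _) fl => U fl; inversion fl.
Qed.

Lemma idv0 b : idv (fun r : B => r = 0) = @zerov B b.
Proof.
apply: pred_ext => v; split=> [v0|-> j]; last by rewrite mxE.
by apply/rowP => j; rewrite mxE v0.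
Qed.

Lemma idK0 : idK D (fun r => r = 0) = rowspan (D 0%N).
Proof.
apply: pred_ext => v; rewrite /idK idv0; split=> [[u [k [-> kK ->]]]|vK].
  by rewrite add0r.
by exists 0, v; rewrite add0r.
Qed.

Lemma Hz_regular xs c : suffix_regular xs -> (forall j, exact_mod D (lspan (drop j xs))) ->
  (forall i, Hz D (b := 1) allv zerov i) ->
  (forall i, (c <= i)%N -> Hz D allv (rowspan (D 0%N)) i) ->
  (forall i, Hz D (b := 1) allv (idv (lspan xs)) i) /\
  (forall i, (c <= i)%N -> Hz D allv (idK D (lspan xs)) i).
Proof.
elim: xs => [|x xs IH] reg X HB HM; first by rewrite /= idv0 idK0.
have [HB' HM'] := IH reg.1 (fun j => X j.+1) HB HM.
have hl := lspan_ideal xs; have hv := idv_submodule 1 hl; have hK := idK_submodule D hl.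
have xv (v : 'rV_1) : idv (lspan xs) (x *: v) -> idv (lspan xs) v.
  by move=> h j; apply: reg.2; have := h j; rewrite mxE.
rewrite lspan_cons; split=> i.
  by rewrite -stepv_idv; exact: (Hz_stepv DD hv xv).
move=> ci; rewrite -stepv_idK; apply: (Hz_stepv DD hK).
- by have := X 0%N; have := X 1%N; rewrite /= drop0; move=> X1 X0; exact: (idK_regular reg).
- exact: HM'.
exact/HM'/leqW.
Qed.

Lemma Hz_unregular xs : suffix_regular xs -> (forall j, exact_mod D (lspan (drop j xs))) ->
  noetherian_module (B^o : lmodType B) ->
  (forall x, x \in xs -> forall a, exists c, c * (1 - a * x) = 1) ->
  (forall i, Hz D allv (idK D (lspan xs)) i) -> forall i, Hz D allv (rowspan (D 0%N)) i.
Proof.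
move=> + + nB; elim: xs => [|x xs IH] reg X rad HM i; first by move: (HM i); rewrite idK0.
have hl := lspan_ideal xs; have hK := idK_submodule D hl.
apply: (IH reg.1) => [j|y ys|{}i]; first exact: (X j.+1).
  by apply: rad; rewrite inE ys orbT.
apply: (Hz_unstepv DD hK (x := x)) => //.
- by have := X 0%N; have := X 1%N; rewrite /= drop0; move=> X1 X0; exact: (idK_regular reg).
- by apply: rad; exact: mem_head.
by rewrite stepv_idK -lspan_cons.
Qed.

(** This is Tor_(i+1)(M, B/(xs)) = 0 beyond the length of the regular sequence; each element added
    costs one degree. *)
Lemma exact_regular xs i (v : 'rV_(e i.+1)) : exact_mx D -> suffix_regular xs ->
  (size xs <= i)%N -> idv (lspan xs) (v *m D i) ->
  exists u w, idv (lspan xs) u /\ v = u + w *m D i.+1.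
Proof.
move=> Dex; elim: xs i v => [|x xs IH] i v reg.
  move=> _ /=; rewrite idv0 => /Dex[w ->]; exists 0, w; rewrite add0r; split=> // j.
  by rewrite mxE.
case: i v => // i v; rewrite ltnS => szi.
have hl := lspan_ideal xs; have hv p := idv_submodule p hl.
rewrite lspan_cons => /idv_addr[w [u [ul vD]]].
(* Multiplying v [D i.+1] = x w + u by [D i] shows that w is a cycle modulo (xs). Subtracting x w2
   from v, with w2 bounding w, leaves a cycle modulo (xs). *)
have [|w1 [w2 [w1l wE]]] := IH i w reg.1 szi.
  move=> j; apply: reg.2.
  have : idv (lspan xs) (x *: (w *m D i)); last by move/(_ j); rewrite mxE.
  rewrite (_ : _ *: _ = - (u *m D i)).
    by apply: (submoduleN (hv _)); exact: idv_mul.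
  by apply/eqP; rewrite -addr_eq0 scalemxAl -mulmxDl -vD -mulmxA DD mulmx0.
have [|u' [w' [u'l vE]]] := IH i.+1 (v - x *: w2) reg.1 (leqW szi).
  rewrite mulmxBl vD wE scalerDr -scalemxAl addrAC addrK.
  apply: (submoduleD (hv _)) => //; exact: (submoduleZ _ (hv _)).
exists (x *: w2 + u'), w'; split; last by rewrite -addrA -vE addrC subrK.
by rewrite -stepv_idv; exists w2, u'.
Qed.

End Regular.

Lemma suffix_regular_drop j (xs : seq B) : suffix_regular xs -> suffix_regular (drop j xs).
Proof. by elim: xs j => // x xs IH [|j] //= [reg _]; exact: IH. Qed.

Lemma Hz_free_sum e (D : forall i, 'M[B]_(e i.+1, e i)) b i :
  Hz D (b := 1) allv zerov i -> Hz D (b := b) allv zerov i.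
Proof.
move=> H y _ /rowsin_zero Dy.
have /choice[z zE] j : exists z, col j y = D i *m z.
  have [//||z _ /rowsin_zero/subr0_eq zE] := H (col j y); last by exists z.
  by apply/rowsin_zero; rewrite colE mulmxA Dy mul0mx.
exists (\matrix_(k, j) z j k 0) => //; apply/rowsin_zero/eqP; rewrite subr_eq0; apply/eqP.
apply/matrixP => k j; have := congr1 (fun M : 'M_(_, 1) => M k 0) (zE j); rewrite !mxE => ->.
by apply: eq_bigr => l _; rewrite mxE.
Qed.

(* Ext(M, M) does not change when M is replaced by its syzygy. *)
Lemma Hz_syzygy e (D : forall i, 'M[B]_(e i.+1, e i)) i : complex_mx D -> exact_mx D ->
  (forall i, Hz D (b := 1) allv zerov i) ->
  Hz D allv (rowspan (D 0%N)) i <->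
  Hz (e := fun i => e i.+1) (fun i => D i.+1) allv (rowspan (D 1%N)) i.
Proof.
move=> DD Dex HB; split=> H y _ /rowsin_rowspan[t yE].
  (* y [D 0] is a cocycle with free coefficients, hence of the form [D i.+1] w; then w is a cocycle
     with values in M, and exactness brings its bounding cochain back to the syzygy. *)
  have [//||w _ /rowsin_zero/subr0_eq wE] := Hz_free_sum (HB i.+1) (y := y *m D 0%N).
    by apply/rowsin_zero; rewrite mulmxA yE -mulmxA DD mulmx0.
  have [//||v _ /rowsin_rowspan[z vE]] := H w.
    by apply/rowsin_rowspan; exists y.
  exists z => // j; apply: Dex; rewrite -row_mul mulmxBl -mulmxA -vE mulmxBr DDK // subr0.
  by rewrite wE subrr row0.
have [//||z _ /rowsin_rowspan[w zE]] := H t.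
  move=> j; apply: Dex; rewrite -row_mul -mulmxA -yE DDK // row0.
  by [].
have [//||v _ /rowsin_zero/subr0_eq vE] := Hz_free_sum (HB i) (y := y - z *m D 0%N).
  apply/rowsin_zero; rewrite mulmxBr yE mulmxA -mulmxBl zE -mulmxA DD mulmx0 //.
exists v => //; apply/rowsin_rowspan; exists z.
by rewrite -vE opprB addrCA subrr addr0.
Qed.

(* After as many syzygies as there are elements in xs, the sequence is regular  *)
(* on the module.                                                              *)
Lemma SAC_mx_regular xs : noetherian_module (B^o : lmodType B) ->
  (forall x, x \in xs -> forall a, exists c, c * (1 - a * x) = 1) ->
  suffix_regular xs ->
  (forall e (D : forall i, 'M[B]_(e i.+1, e i)), complex_mx D ->
    (forall i, Hz D (b := 1) allv (idv (lspan xs)) i) ->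
    (exists c, forall i, (c <= i)%N -> Hz D allv (idK D (lspan xs)) i) ->
    forall i, Hz D allv (idK D (lspan xs)) i) ->
  SAC_mx B.
Proof.
move=> nB rad reg core.
(* k syzygies have been taken and m suffice to finish; each lowers by one the degree from which D is
   exact modulo the tails of xs, so at m = 0 exactness holds everywhere. *)
suff main k m e (D : forall i, 'M[B]_(e i.+1, e i)) : (size xs <= k + m)%N ->
    complex_mx D -> exact_mx D ->
    (forall j i (v : 'rV_(e i.+1)), (size xs <= i + k)%N ->
       idv (lspan (drop j xs)) (v *m D i) ->
       exists u w, idv (lspan (drop j xs)) u /\ v = u + w *m D i.+1) ->
    (forall i, Hz D (b := 1) allv zerov i) ->
    (exists c, forall i, (c <= i)%N -> Hz D allv (rowspan (D 0%N)) i) ->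
    forall i, Hz D allv (rowspan (D 0%N)) i.
  move=> e D DD Dex; apply: (main 0%N (size xs)) => // j i v; rewrite addn0 => szi.
  apply: exact_regular => //; first exact: suffix_regular_drop.
  by apply: leq_trans szi; rewrite size_drop leq_subr.
elim: m k e D => [|m IH] k e D szk DD Dex X HB [c HM].
  have {}X j : exact_mod D (lspan (drop j xs)).
    by move=> i v; apply: X; apply: leq_trans szk _; rewrite addn0 leq_addl.
  have [HB' HM'] := Hz_regular DD reg X HB HM.
  by apply: (Hz_unregular DD reg X nB rad); apply: core => //; exists c.
move=> i; apply/(Hz_syzygy i DD Dex HB).
apply: (IH k.+1 (fun i => e i.+1) (fun i => D i.+1)).
- by rewrite addSnnS.
- by move=> j; exact: DD.
- by move=> j; exact: Dex.
- by move=> j l v; rewrite addnS -addSn; exact: X.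
- by move=> j; exact: HB.
by exists c => j cj; apply/(Hz_syzygy j DD Dex HB)/HM.
Qed.

End RegularReduction.

(** * Koszul complexes and depth *)

Section Koszul.
Variable R : comNzRingType.
Implicit Types (s ys : seq R) (U : R -> Prop).

(* The Koszul complex as an iterated mapping cone, without its grading: the    *)
(* homogeneous elements of degree p are singled out by [koszul_deg].           *)
Fixpoint koszul s : lmodType R :=
  if s is _ :: t then ((koszul t * koszul t)%type : lmodType R) else R^o.

Fixpoint koszul_d s : koszul s -> koszul s :=
  match s return koszul s -> koszul s with
  | [::] => fun=> 0
  | x :: t => fun u => (koszul_d u.1 + x *: u.2, - koszul_d u.2)
  end.

Fixpoint koszul_deg s (p : nat) : koszul s -> Prop :=
  match s return koszul s -> Prop with
  | [::] => fun u => p = 0%N \/ u = 0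
  | x :: t => fun u => koszul_deg p u.1 /\
                       if p is q.+1 then koszul_deg q u.2 else u.2 = 0
  end.

(** The subcomplex U K of the Koszul complex K: working up to it gives homology modulo U without
    forming quotients. *)
Fixpoint koszul_in s U : koszul s -> Prop :=
  match s return koszul s -> Prop with
  | [::] => fun u => U u
  | x :: t => fun u => koszul_in U u.1 /\ koszul_in U u.2
  end.

Lemma koszul_d_linear s : linear (@koszul_d s).
Proof.
elim: s => [|x s IH] a u v /=; first by rewrite scaler0 addr0.
apply: congr2; rewrite IH; last by rewrite opprD -scalerN.
by rewrite /= !scalerDr !scalerA [x * a]mulrC addrACA.
Qed.
HB.instance Definition _ s := GRing.isLinear.Build R (koszul s) (koszul s) _
  (@koszul_d s) (@koszul_d_linear s).

Lemma koszul_d_cons x s (u v : koszul s) :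
  koszul_d (s := x :: s) (u, v) = (koszul_d u + x *: v, - koszul_d v).
Proof. by []. Qed.

Lemma koszul_dN s (u : koszul s) : koszul_d (- u) = - koszul_d u.
Proof. exact: linearN. Qed.

Lemma pair_ext (X Y : Type) (u v : X * Y) : u.1 = v.1 -> u.2 = v.2 -> u = v.
Proof. by case: u v => [? ?] [? ?] /= -> ->. Qed.

Lemma koszul_dd s (u : koszul s) : koszul_d (koszul_d u) = 0.
Proof.
elim: s u => // x s IH [u v]; rewrite !koszul_d_cons; apply: (congr2 pair).
  by rewrite linearD linearZ /= IH add0r scalerN subrr.
by rewrite linearN /= IH !oppr0.
Qed.

Lemma koszul_deg_submodule s p : submodule (@koszul_deg s p).
Proof.
elim: s p => [|x s IH] p.
  split; first by right.
  by move=> a u v [p0|->] [p0'|->]; (by left) || (right; rewrite scaler0 addr0).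
split=> [|a u v [u1 u2] [v1 v2]] /=.
  by split; [exact: (IH p).1 | case: p => // p; exact: (IH p).1].
split; first exact: (IH p).2.
case: p u1 v1 u2 v2 => [|p] _ _; first by move=> -> ->; rewrite scaler0 addr0.
exact: (IH p).2.
Qed.

Lemma koszul_in_submodule s U : ideal_p U -> submodule (@koszul_in s U).
Proof.
move=> hU; elim: s => [|x s [IH0 IH]] //; split=> // a u v [u1 u2] [v1 v2].
by split; exact: IH.
Qed.

Lemma koszul_in_incl s U V (u : koszul s) : incl U V -> koszul_in U u -> koszul_in V u.
Proof.
by move=> UV; elim: s u => [u /UV //|x s IH] [u v] [/IH u1 /IH u2].
Qed.

Lemma koszul_d_in s U (u : koszul s) : ideal_p U -> koszul_in U u -> koszul_in U (koszul_d u).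
Proof.
move=> hU; elim: s u => [u _|x s IH [u v] [uU vU]] /=; first exact: ideal0.
have hK := @koszul_in_submodule s U hU.
split; last by apply: (submoduleN hK); exact: IH.
by apply: (submoduleD hK); [exact: IH | exact: (submoduleZ _ hK)].
Qed.

Lemma koszul_d_deg0 s (u : koszul s) : koszul_deg 0 u -> koszul_d u = 0.
Proof.
elim: s u => // x s IH [u v] [/IH u0 /= v0].
by rewrite /= u0 v0 scaler0 addr0 linear0 oppr0.
Qed.

Lemma koszul_d_deg s p (u : koszul s) : koszul_deg p.+1 u -> koszul_deg p (koszul_d u).
Proof.
elim: s p u => [p u _|x s IH p [u v] [/IH u1 /= v1]] /=; first by right.
have hp := @koszul_deg_submodule s p.
split; first exact/(submoduleD hp)/(submoduleZ _ hp).
case: p v1 hp {u1} => [|p] v1 hp; first by rewrite koszul_d_deg0 ?oppr0.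
exact/(submoduleN (@koszul_deg_submodule s p))/IH.
Qed.

Lemma koszul_deg_big s p (u : koszul s) : (size s < p)%N -> koszul_deg p u -> u = 0.
Proof.
elim: s p u => [[|p] u // _ []//|x s IH [//|p] [u v]].
rewrite ltnS /= => sp [u1 v1].
by apply: pair_ext; [exact: (IH p.+1 u (ltnW sp) u1) | exact: (IH p v sp v1)].
Qed.

Lemma koszul_in0 s (u : koszul s) : koszul_in (fun r => r = 0) u <-> u = 0.
Proof.
elim: s u => // x s IH [u v]; split=> [[/IH /= -> /IH /= ->]|[-> ->]] //.
by split; apply/IH.
Qed.

(** The ideal (s) annihilates Koszul homology. For c x + y the homotopy on the cone combines that
    for y with multiplication by c from the first component to the second. *)
Lemma koszul_homotopy s y : lspan s y -> exists h : koszul s -> koszul s,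
  [/\ linear h, forall u, koszul_d (h u) + h (koszul_d u) = y *: u,
      forall p u, koszul_deg p u -> koszul_deg p.+1 (h u) &
      forall U u, ideal_p U -> koszul_in U u -> koszul_in U (h u)].
Proof.
elim: s y => [y ->|x s IH _ [c [y [/IH[h [hL hd hdeg hin]] ->]]]].
  exists (fun=> 0); split=> [a u v|u|p u _|U u hU _]; rewrite ?scaler0 ?addr0 ?scale0r //.
    by right.
  exact: ideal0.
have [h' h'E] := ex_linear hL; have h0 : h 0 = 0 by rewrite -h'E linear0.
have hB u v : h (u - v) = h u - h v by rewrite -!h'E linearB.
exists (fun u => (h u.1, c *: u.1 - h u.2)); split.
- move=> a u v /=; apply: congr2; first exact: hL.
  by rewrite /= hL !scalerDr scalerN !scalerA [c * a]mulrC opprD addrACA.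
- move=> [u v]; apply: pair_ext.
    change (koszul_d (h u) + x *: (c *: u - h v) + h (koszul_d u + x *: v) = (c * x + y) *: u).
    rewrite [koszul_d u + _]addrC hL [_ + h _]addrC addrACA hd -scalerDr subrK.
    by rewrite scalerA mulrC -scalerDl addrC.
  change (- koszul_d (c *: u - h v) + (c *: (koszul_d u + x *: v) - h (- koszul_d v)) =
          (c * x + y) *: v).
  rewrite linearB linearZ -[- koszul_d v]add0r hB h0 add0r opprK opprB scalerDr scalerA.
  by rewrite -!addrA addKr addrCA hd -scalerDl.
- move=> p [u v] [u1 v1] /=; split; first exact: hdeg.
  have hK := @koszul_deg_submodule s p.
  apply: submoduleB => //; first exact: submoduleZ.
  case: p u1 v1 hK => [|p] u1 v1 hK; last exact: hdeg.
  by rewrite /= in v1; rewrite v1 h0; exact: submodule_zero hK.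
move=> U [u v] hU [uU vU] /=; have hK := @koszul_in_submodule s U hU.
split; first exact: hin.
by apply: submoduleB => //; [exact: submoduleZ | exact: hin].
Qed.

Fixpoint regular_mod U ys : Prop :=
  if ys is y :: t then (forall r, U (y * r) -> U r) /\ regular_mod (addr_p U y) t
  else True.

Lemma koszul_in_addr s U y p (w : koszul s) : ideal_p U ->
  koszul_in (addr_p U y) w -> koszul_deg p w ->
  exists u v, [/\ koszul_deg p u, koszul_in U v & w = y *: u + v].
Proof.
move=> hU; elim: s p w => [|x s IH] p w.
  move=> [c [u [uU wE]]] [p0|->]; first by exists c, u; split=> //; left.
  by exists 0, 0; rewrite scaler0 addr0; split; [right | exact: ideal0 |].
case: w => u v [uU vU] [up vp]; have [u1 [u2 [u1p u2U uE]]] := IH p u uU up.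
have [v1 [v2 [v1p v2U vE]]] : exists v1 v2,
    [/\ if p is q.+1 then koszul_deg q v1 else v1 = 0, koszul_in U v2 & v = y *: v1 + v2].
  case: (p) vp => [|q] /= vq; last exact: IH.
  exists 0, 0; rewrite vq scaler0 addr0; split=> //.
  exact: submodule_zero (koszul_in_submodule s hU).
by exists (u1, v1), (u2, v2); split=> //; apply: pair_ext.
Qed.

Lemma koszul_in_scale s U y (w : koszul s) : ideal_p U -> koszul_in (addr_p U y) (y *: w).
Proof.
move=> hU; elim: s w => [c|x s IH w]; last by split; exact: IH.
by exists c, 0; rewrite addr0; split=> //; exact: ideal0.
Qed.

Lemma koszul_in_unscale s U y (w : koszul s) : (forall r, U (y * r) -> U r) ->
  koszul_in U (y *: w) -> koszul_in U w.
Proof.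
by move=> yU; elim: s w => [w /yU //|x s IH] [u v] [/IH u1 /IH v1].
Qed.

(* Depth sensitivity: y is injective on H_p because H_(p+1) vanishes modulo y,  *)
(* and nilpotent because the ideal of the sequence kills the homology.         *)
Lemma koszul_acyclic s ys U p (z : koszul s) : ideal_p U -> regular_mod U ys ->
  (forall y, y \in ys -> exists t, lspan s (y ^+ t)) -> (size s < p + size ys)%N ->
  koszul_deg p z -> koszul_in U (koszul_d z) ->
  exists w, koszul_deg p.+1 w /\ koszul_in U (z - koszul_d w).
Proof.
elim: ys U p z => [|y ys IH] U p z hU.
  rewrite addn0 => _ _ sp /(koszul_deg_big sp) -> _; exists 0; split.
    exact: submodule_zero (koszul_deg_submodule s p.+1).
  by rewrite linear0 subrr; exact: submodule_zero (koszul_in_submodule s hU).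
move=> [yU reg] nil sp.
have hK := koszul_in_submodule s hU; have hp q := koszul_deg_submodule s q.
have [|t tE] := nil y; first exact: mem_head.
have [h [hL hd hdeg hin]] := koszul_homotopy tE.
(* If y c = d w modulo U, then w is a cycle modulo U + (y) in degree p + 1, and the induction
   hypothesis for the shorter list bounds it there. *)
have inj (c : koszul s) : koszul_deg p c -> koszul_in U (koszul_d c) ->
    (exists w, koszul_deg p.+1 w /\ koszul_in U (y *: c - koszul_d w)) ->
    exists w, koszul_deg p.+1 w /\ koszul_in U (c - koszul_d w).
  move=> cp dc [w [wp cw]].
  have hy := addr_ideal y hU; have hKy := koszul_in_submodule s hy.
  have dwU : koszul_in (addr_p U y) (koszul_d w).
    rewrite -(subKr (y *: c) (koszul_d w)); apply: (submoduleB hKy).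
      exact: koszul_in_scale.
    by apply: koszul_in_incl cw; exact: incl_addr.
  have [||w' [w'p ww']] := IH (addr_p U y) p.+1 w hy reg _ _ wp dwU.
  - by move=> r rys; apply: nil; rewrite inE rys orbT.
  - by rewrite addSnnS.
  have [|u [v [up vU wE]]] := koszul_in_addr hU ww' (p := p.+1).
    by apply: (submoduleB (hp _)) => //; exact: koszul_d_deg.
  exists u; split=> //; apply: (koszul_in_unscale yU).
  have -> : y *: (c - koszul_d u) = y *: c - koszul_d w + koszul_d v.
    have -> : koszul_d w = y *: koszul_d u + koszul_d v.
      by rewrite -(subrK (koszul_d w') w) linearD wE linearD linearZ /= koszul_dd addr0.
    by rewrite scalerBr opprD addrA subrK.
  by apply: (submoduleD hK) => //; exact: koszul_d_in.
have pow k : forall c : koszul s, koszul_deg p c -> koszul_in U (koszul_d c) ->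
    (exists w, koszul_deg p.+1 w /\ koszul_in U (y ^+ k *: c - koszul_d w)) ->
    exists w, koszul_deg p.+1 w /\ koszul_in U (c - koszul_d w).
  elim: k => [|k IHk] c cp dc; first by rewrite scale1r.
  rewrite exprS -scalerA => /inj h1; apply: IHk => //; apply: h1.
    exact: (submoduleZ _ (hp p)).
  by rewrite linearZ; exact: (submoduleZ _ hK).
move=> zp dz; apply: (pow t) => //; exists (h z); split; first exact: hdeg.
by rewrite -hd addrC addKr; exact: hin.
Qed.

Fixpoint koszul_one s : R -> koszul s :=
  match s return R -> koszul s with
  | [::] => fun r => r
  | x :: t => fun r => (koszul_one t r, 0)
  end.

Lemma koszul_oneZ s a r : koszul_one s (a * r) = a *: koszul_one s r.
Proof. by elim: s => //= x s ->; apply: pair_ext; rewrite //= scaler0. Qed.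

Lemma koszul_oneD s a b : koszul_one s (a + b) = koszul_one s a + koszul_one s b.
Proof. by elim: s => //= x s ->; apply: pair_ext; rewrite //= addr0. Qed.

Lemma koszul_one_deg s r : koszul_deg 0 (koszul_one s r).
Proof. by elim: s => [|x s IH] /=; [left | split]. Qed.

Lemma koszul_deg0 s (z : koszul s) : koszul_deg 0 z -> exists r, z = koszul_one s r.
Proof.
elim: s z => [z _|x s IH [u v] /= [/IH[r ->] ->]]; first by exists z.
by exists r.
Qed.

Lemma koszul_boundary0 s r :
  lspan s r <-> exists2 z : koszul s, koszul_deg 1 z & koszul_d z = koszul_one s r.
Proof.
elim: s r => [|x s IH] r.
  by split=> [->|[z _ /= zE]]; [exists 0 => //; right | rewrite -zE].
split=> [[c [r' [/IH[z z1 zd] ->]]]|[[u v] [u1 /koszul_deg0[c cE]]]].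
  exists (z, koszul_one s c); first by split=> //; exact: koszul_one_deg.
  rewrite koszul_d_cons zd koszul_d_deg0; last exact: koszul_one_deg.
  by apply: pair_ext; rewrite /= ?oppr0 // -koszul_oneZ -koszul_oneD addrC mulrC.
have {}cE : v = koszul_one s c := cE.
rewrite koszul_d_cons => /(congr1 fst); rewrite cE /= => h; exists c, (r - c * x); split; last by rewrite addrC subrK.
apply/IH; exists u => //; rewrite koszul_oneD -[- (c * x)]mulN1r koszul_oneZ -h.
by rewrite mulrC -koszul_oneZ scaleN1r addrK.
Qed.

Lemma koszul_noetherian s : noetherian_module (R^o : lmodType R) -> noetherian_module (koszul s).
Proof.
move=> nR; elim: s => // x s IH.
have fL : linear (fun u : koszul s => (u, 0) : koszul (x :: s)).
  by move=> a u v; apply: pair_ext => //=; rewrite scaler0 addr0.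
have pL : linear (fun u : koszul (x :: s) => u.2) by [].
have [f fE] := ex_linear fL; have [p pE] := ex_linear pL.
apply: (noetherian_ext (f := f) (p := p)) => // -[u v]; rewrite pE /= => ->.
by exists u; rewrite fE.
Qed.

Definition koszul_H1 s := forall z : koszul s, koszul_deg 1 z -> koszul_d z = 0 ->
  exists2 w, koszul_deg 2 w & z = koszul_d w.

(** A cycle v of s gives the cycle (v, 0) of the cone; bounding it writes v as a boundary plus x
    times a cycle, so H_1(s) = x H_1(s). Removing the head in this way is why regularity is relative
    to the elements that follow. *)
Lemma koszul_H1_tail x s : noetherian_module (R^o : lmodType R) ->
  (forall a, exists c, c * (1 - a * x) = 1) -> koszul_H1 (x :: s) -> koszul_H1 s.
Proof.
move=> nR radx H z z1 dz.
have hp q := koszul_deg_submodule s q.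
pose V (z : koszul s) := koszul_deg 1 z /\ koszul_d z = 0.
pose U (z : koszul s) := exists2 w, koszul_deg 2 w & z = koszul_d w.
have hV : submodule V.
  split=> [|a u v [u1 u0] [v1 v0]]; first by split; [exact: (hp _).1 | exact: linear0].
  by split; [exact: (hp _).2 | rewrite (koszul_d_linear a u v) u0 v0 scaler0 addr0].
have hU : submodule U.
  split=> [|a _ _ [u u2 ->] [v v2 ->]]; first by exists 0; [exact: (hp _).1 | rewrite linear0].
  by exists (a *: u + v); [exact: (hp _).2 | rewrite linearP].
have [gs gsE] := koszul_noetherian (s := s) nR hV.
apply: (nakayama hU hV radx (gs := gs)) => //.
- by move=> v /gsE.
- by move=> g g_gs; apply/gsE; exact: vspan_gen.
move=> v [v1 v0]; have [||[w1 w2] [w1d w2d]] := H (v, 0).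
- by split=> //; exact: (hp _).1.
- rewrite koszul_d_cons v0 scaler0 linear0 oppr0 addr0 //.
rewrite koszul_d_cons => -[vE w2E]; exists (koszul_d w1), w2; split=> //.
  by exists w1.
by split=> //; apply/eqP; rewrite -oppr_eq0 -w2E.
Qed.

(* If x r is in (s), a degree-one a with d a = x r makes (- a, r) a cycle.      *)
Lemma koszul_H1_regular x s : koszul_H1 (x :: s) ->
  forall r, lspan s (x * r) -> lspan s r.
Proof.
move=> H r /koszul_boundary0[z z1 zE].
have [||[w1 w2] [_ w2d]] := H (- z, koszul_one s r).
- by split; [exact: submoduleN (koszul_deg_submodule _ _) _ | exact: koszul_one_deg].
- rewrite koszul_d_cons koszul_dN zE (koszul_d_deg0 (koszul_one_deg s r)) oppr0.
  by rewrite koszul_oneZ addNr.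
rewrite koszul_d_cons => -[_ rE]; apply/koszul_boundary0; exists (- w2).
  exact: submoduleN (koszul_deg_submodule _ _) _.
by rewrite koszul_dN rE.
Qed.

Lemma suffix_regular_koszul s : noetherian_module (R^o : lmodType R) ->
  (forall x, x \in s -> forall a, exists c, c * (1 - a * x) = 1) ->
  koszul_H1 s -> suffix_regular s.
Proof.
move=> nR; elim: s => // x s IH rad H; split; last exact: koszul_H1_regular.
apply: IH; first by move=> y ys; apply: rad; rewrite inE ys orbT.
by apply: koszul_H1_tail H => //; apply: rad; exact: mem_head.
Qed.

(** Koszul homology of s vanishes in degrees above size s - size ys, in particular in degree 1. One
    long enough regular sequence in the radical of (s) thus makes s regular. *)
Lemma suffix_regular_depth s ys : noetherian_module (R^o : lmodType R) ->
  (forall x, x \in s -> forall a, exists c, c * (1 - a * x) = 1) ->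
  regular_mod (fun r => r = 0) ys -> (size s <= size ys)%N ->
  (forall y, y \in ys -> exists t, lspan s (y ^+ t)) -> suffix_regular s.
Proof.
move=> nR rad reg sz nil; apply: suffix_regular_koszul => // z z1 z0.
have h0 : ideal_p (fun r : R => r = 0) by split=> // c u v -> ->; rewrite mulr0 addr0.
have [||w [w2 /koszul_in0/subr0_eq zE]] := koszul_acyclic h0 reg nil _ z1.
- by rewrite add1n ltnS.
- by apply/koszul_in0.
by exists w.
Qed.

End Koszul.

(** * Quasi-regular sequences *)

Section Monomials.
Variable R : comNzRingType.
Implicit Types (s t ms zs : seq R) (c d : nat -> R) (A U I : R -> Prop).

Fixpoint comb c s : R :=
  if s is x :: t then c 0%N * x + comb (fun i => c i.+1) t else 0.

Lemma comb_cat c s t : comb c (s ++ t) = comb c s + comb (fun i => c (size s + i)%N) t.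
Proof. by elim: s c => [|x s IH] c /=; rewrite ?add0r // IH addrA. Qed.

Lemma comb_map a c s : comb c (map ( *%R a) s) = a * comb c s.
Proof. by elim: s c => [|x s IH] c /=; rewrite ?mulr0 // IH mulrDr mulrCA. Qed.

Lemma combM a c s : comb (fun i => a * c i) s = a * comb c s.
Proof. by elim: s c => [|x s IH] c /=; rewrite ?mulr0 // IH mulrDr mulrA. Qed.

Lemma combB c d s : comb (fun i => c i - d i) s = comb c s - comb d s.
Proof.
by elim: s c d => [|x s IH] c d /=; rewrite ?subrr // IH mulrBl opprD addrACA.
Qed.

Lemma combD c d s : comb (fun i => c i + d i) s = comb c s + comb d s.
Proof. by elim: s c d => [|x s IH] c d /=; rewrite ?addr0 // IH mulrDl addrACA. Qed.

Lemma comb0 s : comb (fun=> 0) s = 0.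
Proof. by elim: s => //= x s ->; rewrite mul0r addr0. Qed.

Lemma eq_comb c d s : (forall i, (i < size s)%N -> c i = d i) -> comb c s = comb d s.
Proof.
elim: s c d => //= x s IH c d cd; rewrite (cd 0%N) //; congr (_ + _).
by apply: IH => i; exact: (cd i.+1).
Qed.

Lemma comb_cons a c s x : comb (fun i => if i is j.+1 then c j else a) (x :: s) = a * x + comb c s.
Proof. by []. Qed.

(* Combinations of the list with coefficients in A: the product of ideals A s. *)
Definition lc A s r := exists c, (forall i, A (c i)) /\ r = comb c s.

Lemma lc_ideal A s : ideal_p A -> ideal_p (lc A s).
Proof.
move=> hA; split; first by exists (fun=> 0); rewrite comb0; split=> // _; exact: ideal0.
move=> a _ _ [c [cA ->]] [d [dA ->]]; exists (fun i => a * c i + d i).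
by split=> [i|]; [exact: hA.2 | rewrite combD combM].
Qed.

Lemma lc_mem A s a m : ideal_p A -> m \in s -> A a -> lc A s (a * m).
Proof.
move=> hA + aA; elim: s => // x s IH; rewrite inE => /orP[/eqP->|/IH[c [cA ->]]].
  exists (fun i => if i is j.+1 then 0 else a); rewrite comb_cons comb0 addr0.
  by split=> // -[|i] //; exact: ideal0.
exists (fun i => if i is j.+1 then c j else 0); rewrite comb_cons mul0r add0r.
by split=> // -[|i] //; exact: ideal0.
Qed.

Lemma lc_min A s U : ideal_p U -> (forall m a, m \in s -> A a -> U (a * m)) -> incl (lc A s) U.
Proof.
move=> hU; elim: s => [|x s IH] h r [c [cA ->]] /=; first exact: ideal0.
apply: idealD => //; first by apply: h => //; exact: mem_head.
apply: IH; last by exists (fun i => c i.+1).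
by move=> m a ms; apply: h; rewrite inE ms orbT.
Qed.

Lemma lspan_lc s : lspan s = lc (fun=> True) s.
Proof.
apply: pred_ext => r; elim: s r => [|x s IH] r /=.
  by split=> [->|[c [_ ->]]] //; exists (fun=> 0).
split=> [[c [r' [/IH[d [_ ->]] ->]]]|[c [_ ->]]].
  by exists (fun i => if i is j.+1 then d j else c).
by exists (c 0%N), (comb (fun i => c i.+1) s); split=> //; apply/IH; exists (fun i => c i.+1).
Qed.

Lemma lspan_mem s m : m \in s -> lspan s m.
Proof. by move=> ms; rewrite lspan_lc -[m]mul1r; exact: lc_mem. Qed.

Lemma lspan_comb s c : lspan s (comb c s).
Proof. by rewrite lspan_lc; exists c. Qed.

Lemma lspan_min s U : ideal_p U -> (forall m, m \in s -> U m) -> incl (lspan s) U.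
Proof.
by move=> hU sU; rewrite lspan_lc; apply: lc_min => // m a /sU mU _; exact: idealM.
Qed.

Lemma lc_lspan A s : incl (lc A s) (lspan s).
Proof. by move=> r [c [_ ->]]; exact: lspan_comb. Qed.

Lemma colon_ideal U y : ideal_p U -> ideal_p (fun r => U (r * y)).
Proof.
move=> hU; split=> [|a u v uU vU]; first by rewrite mul0r; exact: ideal0.
by rewrite mulrDl -mulrA; exact: hU.2.
Qed.

Fixpoint monos t : nat -> seq R :=
  match t with
  | [::] => fun j => if j is 0 then [:: 1] else [::]
  | x :: t' => fix aux j :=
      if j is k.+1 then map ( *%R x) (aux k) ++ monos t' k.+1 else [:: 1]
  end.

Lemma monos0 t : monos t 0 = [:: 1].
Proof. by case: t. Qed.

Lemma monosS x t j : monos (x :: t) j.+1 = map ( *%R x) (monos (x :: t) j) ++ monos t j.+1.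
Proof. by []. Qed.

Lemma monos1 t : monos t 1 = t.
Proof. by elim: t => // x t IH; rewrite monosS monos0 IH /= mulr1. Qed.

Lemma mem_monosM t j q m : q \in t -> m \in monos t j -> q * m \in monos t j.+1.
Proof.
elim: t j q m => // x t IHt; elim=> [|j IHj] q m.
  by move=> qt; rewrite monos0 inE => /eqP ->; rewrite monos1 mulr1.
rewrite inE => /orP[/eqP-> mj|qt].
  by rewrite monosS mem_cat map_f.
rewrite monosS mem_cat => /orP[/mapP[m' m'j ->]|mt].
  rewrite mulrCA monosS mem_cat map_f //; apply: IHj => //.
  by rewrite inE qt orbT.
by rewrite monosS mem_cat [X in _ || X]IHt // orbT.
Qed.

Lemma monos_fac t j m : m \in monos t j.+1 ->
  exists q m', [/\ q \in t, m' \in monos t j & m = q * m'].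
Proof.
elim: t => // x t IHt; rewrite monosS mem_cat => /orP[/mapP[m' m'j ->]|/IHt[q [m' [qt m'j ->]]]].
  by exists x, m'; rewrite mem_head.
exists q, m'; rewrite inE qt orbT; split=> //.
by case: j m'j {IHt} => [|j] m'j; [rewrite monos0 -(monos0 t) | rewrite monosS mem_cat m'j orbT].
Qed.

Lemma lspan_monosS t j : lspan (monos t j.+1) = lc (lspan t) (monos t j).
Proof.
have ht := lspan_ideal t; have hj := lspan_ideal (monos t j.+1).
apply: pred_ext => r; split; move: r.
  apply: lspan_min; first exact: lc_ideal.
  by move=> _ /monos_fac[q [m [qt mj ->]]]; apply: lc_mem => //; exact: lspan_mem.
apply: lc_min => // m a mj; move: a; apply: lspan_min; first exact: colon_ideal.
by move=> q qt; exact/lspan_mem/mem_monosM.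
Qed.

(* Quasi-regularity: the associated graded ring of (t) is a polynomial ring     *)
(* over R / (t).                                                               *)
Definition quasi_regular t := forall j c, comb c (monos t j) = 0 ->
  forall i, (i < size (monos t j))%N -> lspan t (c i).

Lemma quasi_regular_lspan t j c : quasi_regular t ->
  lspan (monos t j.+1) (comb c (monos t j)) ->
  forall i, (i < size (monos t j))%N -> lspan t (c i).
Proof.
move=> qr; rewrite lspan_monosS => -[d [dt cd]] i isz.
rewrite -(subrK (d i) (c i)); apply: idealD => //; first exact: lspan_ideal.
by apply: (qr j (fun i => c i - d i)) => //; rewrite combB cd subrr.
Qed.

(** Each (t)^j/(t)^(j+1) is free over R/(t), so y remains a nonzerodivisor on it. *)
Lemma nonzerodivisor_power y t j u : quasi_regular t ->
  (forall r, lspan t (y * r) -> lspan t r) ->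
  lspan (monos t j) (y * u) -> lspan (monos t j) u.
Proof.
move=> qr reg; elim: j u => [|j IH] u.
  by move=> _; rewrite monos0 -[u]mulr1; apply: idealM; [exact: lspan_ideal | exact/lspan_mem/mem_head].
move=> yu; have : lspan (monos t j) (y * u).
  move: yu; rewrite lspan_monosS; exact: lc_lspan.
move=> /IH; rewrite {1}lspan_lc => -[c [_ uE]].
move: yu; rewrite uE -combM => /(quasi_regular_lspan qr) h.
rewrite lspan_monosS; exists (fun i => if (i < size (monos t j))%N then c i else 0).
split=> [i|]; last by apply: eq_comb => i ->.
by case: ifP => [/h/reg|_] //; exact: ideal0 (lspan_ideal t).
Qed.

(** A vanishing form of degree j + 1 is y H + G with G in t alone. Then H lies in (t)^(j+1), as y is
    a nonzerodivisor modulo it. Induction on j settles the coefficients of H; rewriting H in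
    monomials of t, those of G follow from quasi-regularity of t. *)
Lemma suffix_quasi_regular t : suffix_regular t -> quasi_regular t.
Proof.
elim: t => [_ [|j] c //= c0 [|i] // _|y t IHt [reg yreg]].
  by move: c0; rewrite mulr1 addr0.
have qr := IHt reg; have ht := lspan_ideal t; have hyt := lspan_ideal (y :: t).
have sub : incl (lspan t) (lspan (y :: t)) by move=> r rt; exists 0, r; rewrite mul0r add0r.
elim=> [|j IHj] c.
  by rewrite monos0 /= mulr1 addr0 => c0 [|i] // _; rewrite c0; exact: ideal0 hyt.
rewrite monosS comb_cat comb_map size_map.
set H := comb c _; set n := size _; set g := fun i => c (n + i)%N => HG.
have HQ : lspan (monos t j.+1) H.
  apply: (nonzerodivisor_power qr yreg).
  by rewrite (canRL (addrK _) HG) add0r; apply: idealN; [exact: lspan_ideal | exact: lspan_comb].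
have subm : incl (lspan (monos t j.+1)) (lspan (monos (y :: t) j.+1)).
  apply: lspan_min; first exact: lspan_ideal.
  by move=> m mt; apply: lspan_mem; rewrite monosS mem_cat mt orbT.
have hH : forall i, (i < n)%N -> lspan (y :: t) (c i).
  have qrj c' : comb c' (monos (y :: t) j) = 0 -> forall i, (i < n)%N -> lspan (y :: t) (c' i).
    exact: IHj.
  have := subm _ HQ; rewrite lspan_monosS => -[d [dt cd]] i isz.
  rewrite -(subrK (d i) (c i)); apply: idealD => //.
  by apply: (qrj (fun i => c i - d i)) => //; rewrite combB -cd subrr.
move: HQ; rewrite lspan_lc => -[h [_ hE]].
have hg : forall i, (i < size (monos t j.+1))%N -> lspan t (y * h i + g i).
  by apply: qr; rewrite combD combM -hE.
move=> i; rewrite size_cat size_map -/n => isz; have [iln|nli] := ltnP i n; first exact: hH.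
have -> : c i = - h (i - n)%N * y + (y * h (i - n)%N + g (i - n)%N).
  by rewrite /g subnKC // mulNr mulrC addKr.
by exists (- h (i - n)%N), (y * h (i - n)%N + g (i - n)%N); split=> //; apply: hg; rewrite ltn_subLR.
Qed.

End Monomials.

(** * Powers of an Ulrich ideal *)

Section FlatLists.
Variable R : comNzRingType.
Implicit Types (I a : R -> Prop).

Definition sum_p (a b : R -> Prop) : R -> Prop :=
  fun r => exists u v, [/\ a u, b v & r = u + v].

Lemma rflat_indep I a bs : ideal_p a ->
  (forall c, a (comb c bs) -> forall i, (i < size bs)%N -> I (c i)) ->
  (forall beta c, beta \in bs -> I c -> a (beta * c)) ->
  rflat I a bs (sum_p a (lspan bs)).
Proof.
elim: bs a => [|beta bs IH] a ha ind kill.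
  rewrite (_ : sum_p _ _ = a); first exact: rflat_nil.
  apply: pred_ext => r; split=> [[u [v [ua -> ->]]]|ra]; first by rewrite addr0.
  by exists r, 0; rewrite addr0.
apply: rflat_cons.
- by move=> c; apply: kill; exact: mem_head.
- move=> c ac; apply: (ind (fun i => if i is j.+1 then 0 else c) _ 0%N) => //.
  by rewrite comb_cons comb0 addr0 mulrC.
have -> : sum_p a (lspan (beta :: bs)) = sum_p (addr_p a beta) (lspan bs).
  apply: pred_ext => r; split=> [[u [_ [ua [c [v [vs ->]]] ->]]]|[_ [v [[c [u [ua ->]]] vs ->]]]].
    by exists (beta * c + u), v; split=> //; [exists c, u | rewrite addrCA addrA mulrC].
  by exists u, (c * beta + v); split=> //; [exists c, v | rewrite mulrC addrCA addrA].
apply: IH; first exact: addr_ideal.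
  move=> c [d [u [ua cE]]] i isz.
  apply: (ind (fun i => if i is j.+1 then c j else - d) _ i.+1) => //.
  by rewrite comb_cons cE mulNr mulrC addKr.
by move=> gamma c gs Ic; apply: incl_addr; apply: kill => //; rewrite inE gs orbT.
Qed.

Fixpoint prods (ms zs : seq R) : seq R :=
  if ms is m :: ms' then map ( *%R m) zs ++ prods ms' zs else [::].

Lemma size_prods ms zs : size (prods ms zs) = (size ms * size zs)%N.
Proof. by elim: ms => //= m ms IH; rewrite size_cat size_map IH mulSn. Qed.

Lemma comb_prods c ms zs :
  comb c (prods ms zs) = comb (fun k => comb (fun i => c (k * size zs + i)%N) zs) ms.
Proof.
elim: ms c => //= m ms IH c; rewrite comb_cat comb_map IH mulrC size_map.
congr (_ + _); apply: eq_comb => k _; apply: eq_comb => i _.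
by rewrite mulSn addnA.
Qed.

Lemma mem_prods ms zs b : b \in prods ms zs ->
  exists m z, [/\ m \in ms, z \in zs & b = m * z].
Proof.
elim: ms => //= m ms IH; rewrite mem_cat => /orP[/mapP[z zz ->]|/IH[m' [z [m's zz ->]]]].
  by exists m, z; rewrite mem_head.
by exists m', z; rewrite inE m's orbT.
Qed.

Lemma prods_mem ms zs m z : m \in ms -> z \in zs -> m * z \in prods ms zs.
Proof.
elim: ms => //= m' ms IH; rewrite inE mem_cat => /orP[/eqP->|mm] zz.
  by rewrite map_f.
by rewrite IH // orbT.
Qed.

Variables (t zs : seq R) (I : R -> Prop).
Hypotheses (hI : ideal_p I) (qr : quasi_regular t).
Hypotheses (tI : forall q, q \in t -> I q) (zI : forall z, z \in zs -> I z).
Hypothesis I2 : forall x y, I x -> I y -> lc I t (x * y).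
Hypothesis Iz : forall y, I y -> sum_p (lspan t) (lspan zs) y.
Hypothesis zind : forall c, lspan t (comb c zs) -> forall i, (i < size zs)%N -> I (c i).

(* The power I^(j+1) = (t)^j I. *)
Definition upow j : R -> Prop := lc I (monos t j).

Let ht := lspan_ideal t.
Let lspan_tI : incl (lspan t) I. Proof. exact: lspan_min. Qed.

Lemma upow_ideal j : ideal_p (upow j). Proof. exact: lc_ideal. Qed.

Lemma upow0 : upow 0 = I.
Proof.
apply: pred_ext => r; rewrite /upow monos0; split=> [[c [cI ->]] /=|rI].
  by rewrite mulr1 addr0.
by rewrite -[r]mulr1; apply: lc_mem => //; exact: mem_head.
Qed.

Lemma upowM j (x y : R) : I x -> upow j y -> upow j.+1 (x * y).
Proof.
move=> Ix; rewrite mulrC; move: y; apply: lc_min; first exact/colon_ideal/upow_ideal.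
move=> m y mj Iy; rewrite -mulrA mulrC -mulrA; have := I2 Ix Iy.
rewrite mulrC; move: (x * y); apply: lc_min; first exact/colon_ideal/upow_ideal.
move=> q c qt Ic; rewrite -mulrA; apply: lc_mem => //; exact: mem_monosM.
Qed.

Lemma lspan_monos_upow j : incl (lspan (monos t j.+1)) (upow j).
Proof. by move=> r; rewrite lspan_monosS => -[c [ct ->]]; exists c; split=> // i; exact: lspan_tI. Qed.

(** A relation among the monomials with value in (t)^j I differs by coefficients in I from one with
    value 0, to which quasi-regularity applies. *)
Lemma rflat_upow_monos j : rflat I (upow j) (monos t j) (lspan (monos t j)).
Proof.
have -> : lspan (monos t j) = sum_p (upow j) (lspan (monos t j)).
  apply: pred_ext => r; split=> [rs|[u [v [uu vs ->]]]].
    by exists 0, r; rewrite add0r; split=> //; exact: ideal0 (upow_ideal j).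
  by apply: idealD => //; [exact: lspan_ideal | exact: lc_lspan uu].
apply: rflat_indep; first exact: upow_ideal.
  move=> c [d [dI cd]] i isz; rewrite -(subrK (d i) (c i)); apply: idealD => //.
  by apply/lspan_tI/(qr (j := j) (c := fun i => c i - d i)); rewrite // combB cd subrr.
by move=> beta c bj Ic; rewrite mulrC; exact: lc_mem.
Qed.

(** (t)^j/(t)^(j+1) is free over R/(t) on the monomials and I/(t) is free over R/I on zs, so the
    products are independent. *)
Lemma rflat_prods j : rflat I (lspan (monos t j.+1)) (prods (monos t j) zs) (upow j).
Proof.
have hS := lspan_ideal (monos t j.+1).
have kill m c : m \in monos t j -> lspan t c -> lspan (monos t j.+1) (c * m).
  by move=> mj ct; rewrite lspan_monosS; exact: lc_mem.
have -> : upow j = sum_p (lspan (monos t j.+1)) (lspan (prods (monos t j) zs)).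
  apply: pred_ext => r; split; move: r.
    have hs : ideal_p (sum_p (lspan (monos t j.+1)) (lspan (prods (monos t j) zs))).
      have := sumv_submodule (ideal_submodule hS) (ideal_submodule (lspan_ideal (prods (monos t j) zs))).
      by [].
    apply: lc_min => // m a mj /Iz[u [v [ut vs ->]]].
    exists (u * m), (v * m); split; [exact: kill | | exact: mulrDl].
    move: v vs; apply: lspan_min; first exact/colon_ideal/lspan_ideal.
    by move=> z zz; rewrite mulrC; exact/lspan_mem/prods_mem.
  move=> _ [u [v [us vs ->]]]; apply: (idealD (upow_ideal j)); first exact: lspan_monos_upow.
  move: v vs; apply: lspan_min; first exact: upow_ideal.
  by move=> _ /mem_prods[m [z [mj /zI zz ->]]]; rewrite mulrC; exact: lc_mem.
apply: rflat_indep => //.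
  move=> c; rewrite comb_prods => /(quasi_regular_lspan qr) h i; rewrite size_prods => isz.
  have zpos : (0 < size zs)%N by case: (size zs) isz => //; rewrite muln0.
  rewrite (divn_eq i (size zs)); apply: (zind (c := fun l => c (i %/ size zs * size zs + l)%N)).
    by apply: h; rewrite ltn_divLR.
  by rewrite ltn_mod.
move=> _ c /mem_prods[m [z [mj /zI zz ->]]] Ic.
by rewrite -mulrA mulrC; apply: kill => //; exact: lc_lspan (I2 zz Ic).
Qed.

(** From I^(j+2) = (t)^(j+1) I to I^(j+1) = (t)^j I the filtration passes through (t)^(j+1). *)
Definition bottom_list j := monos t j.+1 ++ prods (monos t j) zs.
Fixpoint chain_list j := if j is k.+1 then bottom_list k ++ chain_list k else [::].

Lemma rflat_bottom j : rflat I (upow j.+1) (bottom_list j) (upow j).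
Proof. exact: rflat_cat (rflat_upow_monos j.+1) (rflat_prods j). Qed.

Lemma rflat_chain j : rflat I (upow j) (chain_list j) I.
Proof.
elim: j => [|j IH]; first by rewrite upow0; exact: rflat_nil.
exact: rflat_cat (rflat_bottom j) IH.
Qed.

(** I^(j+1)/I^(j+2) is a module over R/I: this is the splitting condition under which lengths
    add. *)
Lemma bottom_kill j beta c : beta \in bottom_list j -> I c -> upow j.+1 (beta * c).
Proof.
move=> + Ic; rewrite mem_cat => /orP[bj|/mem_prods[m [z [mj /zI zz ->]]]].
  by rewrite mulrC; exact: lc_mem.
rewrite -mulrA mulrC; have := I2 zz Ic; move: (z * c).
apply: lc_min; first exact/colon_ideal/upow_ideal.
by move=> q b qt Ib; rewrite -mulrA; apply: lc_mem => //; exact: mem_monosM.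
Qed.

Lemma rflat_zs : rflat I (lspan t) zs I.
Proof.
have := rflat_prods 0; rewrite upow0 monos0 monos1 /= cats0.
by rewrite (eq_map (@mul1r R)) map_id.
Qed.

End FlatLists.

Lemma size_monos (R : comNzRingType) (t : seq R) j :
  size (monos t j) = if size t is n.+1 then 'C(n + j, j) else (j == 0%N).
Proof.
elim: t j => [[]//|x t IHt]; elim=> [|j IHj]; first by rewrite monos0 /= bin0.
rewrite monosS size_cat size_map IHj IHt /=.
case: (size t) => [|n]; first by rewrite !add0n !binn.
by rewrite -[(n + j.+1)%N]addSnnS [(n.+1 + j.+1)%N]addnS binS addnC.
Qed.

(** By the hockey-stick identity the ranks in the chain add up to one binomial coefficient for the
    monomials and one for the products; each is compared with its neighbour in the same row of
    Pascal's triangle. *)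
Lemma size_chain_list (R : comNzRingType) (t zs : seq R) j : (j.+2 <= size t)%N ->
  ((size (chain_list t zs j)).+1 < size (bottom_list t zs j))%N.
Proof.
case st : (size t) => [//|n]; rewrite ltnS => jn.
(* The ratio of the two is (n + 1)/(m + 1), where n is one less than [size t]. *)
have binlt m : (m < n)%N -> ('C(n.+1 + m, m) < 'C(n + m.+1, m.+1))%N.
  move=> mn; rewrite addSnnS -(ltn_pmul2l (ltn0Sn m)) mul_bin_left.
  rewrite -addSnnS addnK ltn_pmul2r ?bin_gt0 ?leq_addl //.
pose rest k := if k is l.+1 then 'C(n.+1 + l, l) else 0%N.
have szb k : size (bottom_list t zs k) = ('C(n + k.+1, k.+1) + 'C(n + k, k) * size zs)%N.
  by rewrite size_cat size_prods !size_monos st.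
have chE k : (size (chain_list t zs k)).+1 = ('C(n.+1 + k, k) + rest k * size zs)%N.
  elim: k => [|k IH]; first by rewrite bin0.
  rewrite [chain_list _ _ _]/(bottom_list t zs k ++ chain_list t zs k) size_cat -addnS IH szb.
  have -> : 'C(n.+1 + k.+1, k.+1) = ('C(n + k.+1, k.+1) + 'C(n.+1 + k, k))%N.
    by rewrite addnS binS addSnnS.
  have -> : rest k.+1 = ('C(n + k, k) + rest k)%N.
    by case: k {IH} => [|k]; rewrite /= ?bin0 // addnS binS addSnnS.
  by rewrite mulnDl addnACA.
rewrite chE szb -addSn; apply: leq_add; first exact: binlt.
rewrite leq_mul2r; apply/orP; right.
case: j jn => [|j] jn //=; apply: ltnW; apply: binlt; exact: ltnW.
Qed.

(** * Minimal generators of I modulo the parameter ideal *)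

Section IdealBasis.
Variable R : comNzRingType.
Implicit Types (c d : nat -> R).

Lemma combE c (s : seq R) : comb c s = \sum_(i < size s) c i * s`_i.
Proof.
elim: s c => [|x s IH] c /=; first by rewrite big_ord0.
by rewrite big_ord_recl IH.
Qed.

Lemma comb_row (s : seq R) (r : 'rV[R]_(size s)) : exists c : nat -> R,
  (forall i : 'I_(size s), c i = r 0 i) /\ comb c s = (r *m \col_i s`_i) 0 0.
Proof.
exists (fun i => if insub i is Some j then r 0 j else 0).
split=> [i|]; first by rewrite valK.
by rewrite combE mxE; apply: eq_bigr => i _; rewrite valK mxE.
Qed.

Variables (J I : R -> Prop) (s t : seq R).
Hypotheses (hI : ideal_p I) (artI : artinian_mod J s I).
Hypothesis J_nil : forall x, J x -> exists k, I (x ^+ k).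
Hypothesis I1 : ~ I 1.
Hypothesis tI : forall q, q \in t -> I q.
Hypothesis tind : forall c, comb c t = 0 -> forall i, (i < size t)%N -> lspan t (c i).
Let I2 : R -> Prop := lc I t.
Hypothesis IM2 : forall x y, I x -> I y -> I2 (x * y).
Hypothesis Ifg : exists gs, I = lspan gs.

Let hI2 : ideal_p I2. Proof. exact: lc_ideal. Qed.
Let ht := lspan_ideal t.
Let lspan_tI : incl (lspan t) I. Proof. exact: lspan_min. Qed.
Let I2t : incl I2 (lspan t). Proof. exact: lc_lspan. Qed.

(** 1 - c a lies in J, hence is nilpotent modulo I, and a geometric series inverts c a. *)
Lemma unit_mod (a : R) : ~ J a -> exists b : R, I (1 - b * a).
Proof.
have [Jf _ _] := artI => /Jf[c /[dup] Jc /J_nil[k Ik]].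
exists (c * \sum_(i < k) (1 - c * a) ^+ i).
have := subrX1 (1 - c * a) k; rewrite addrAC subrr add0r mulNr => /(canRL (subrK _)) E.
suff -> : 1 - c * (\sum_(i < k) (1 - c * a) ^+ i) * a = (1 - c * a) ^+ k by [].
by rewrite E addrC mulrAC.
Qed.

Lemma ex_socle_mod : exists x, ~ I x /\ forall a, J a -> I (a * x).
Proof.
have [_ Js sn] := artI; have hI' := ideal_submodule hI.
have cs : cseries J (I : (R^o : lmodType R) -> Prop) (fun=> True).
  apply: (cseries_fin (s := s) (g := fun _ : 'I_1 => 1 : R^o)) => //.
    by move=> a /sn[k ak]; exists k => x; rewrite [_ *: _]mulrC; exact: idealM.
  by move=> x; exists (fun=> x); rewrite big_ord1 [_ *: _]mulr1.
have [|x [_ xI Jx]] := cseries_socle cs hI'; first by move=> /(_ 1 Logic.I).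
by exists x.
Qed.

Definition generates_mod (zs : seq R) :=
  (forall z, z \in zs -> I z) /\ forall y, I y -> sum_p (lspan t) (lspan zs) y.

Lemma sum_ideal zs : ideal_p (sum_p (lspan t) (lspan zs)).
Proof.
exact: (sumv_submodule (ideal_submodule ht) (ideal_submodule (lspan_ideal zs))).
Qed.

Lemma ex_minimal_generators : exists zs, generates_mod zs /\
  forall zs', generates_mod zs' -> (size zs <= size zs')%N.
Proof.
have [gs Igs] := Ifg.
have ex0 : exists n, `[< exists zs, generates_mod zs /\ size zs = n >].
  exists (size gs); apply/asboolP; exists gs; split=> //; split.
    by move=> z zgs; rewrite Igs; exact: lspan_mem.
  by rewrite Igs => y ygs; exists 0, y; rewrite add0r; split=> //; exact: ideal0 ht.
case: (ex_minnP ex0) => n /asboolP[zs [zsg <-]] nmin.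
by exists zs; split=> // zs' zs'g; apply: nmin; apply/asboolP; exists zs'.
Qed.

Section Minimal.
Variable zs : seq R.
Hypothesis zs_gen : generates_mod zs.
Hypothesis zs_min : forall zs', generates_mod zs' -> (size zs <= size zs')%N.

Lemma minimal_relation c : lspan t (comb c zs) -> forall i, (i < size zs)%N -> J (c i).
Proof.
move=> ct i isz; apply: contrapT => /unit_mod[b bI].
pose zs' := take i zs ++ drop i.+1 zs.
have zsE : zs = take i zs ++ zs`_i :: drop i.+1 zs by rewrite -drop_nth // cat_take_drop.
suff /zs_min : generates_mod zs'.
  by rewrite size_cat size_take size_drop isz leqNgt => /negP[]; lia.
have sub z : z \in zs' -> z \in zs.
  by rewrite mem_cat => /orP[/mem_take|/mem_drop].
have hS := sum_ideal zs'.
split=> [z /sub /zs_gen.1 //|y /zs_gen.2[u [v [ut vs ->]]]].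
apply: (idealD hS).
  by exists u, 0; rewrite addr0; split=> //; exact: ideal0 (lspan_ideal _).
have zs'S z : z \in zs' -> sum_p (lspan t) (lspan zs') z.
  by move=> zz; exists 0, z; rewrite add0r; split=> //; [exact: ideal0 ht | exact: lspan_mem].
have tS x : lspan t x -> sum_p (lspan t) (lspan zs') x.
  by move=> xt; exists x, 0; rewrite addr0; split=> //; exact: ideal0 (lspan_ideal _).
have ziI : I zs`_i by apply: zs_gen.1; exact: mem_nth.
have ziS : sum_p (lspan t) (lspan zs') zs`_i.
  (* (1 - b c_i) z_i is in I^2, hence in (t), while c_i z_i is a combination of the other generators
     modulo (t); so z_i could be dropped. *)
  rewrite -[zs`_i]mul1r -(subrK (b * c i) 1) mulrDl; apply: (idealD hS).
    by apply/tS/I2t/IM2.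
  rewrite -mulrA; apply: (idealM _ hS).
  have := comb_cat c (take i zs) (zs`_i :: drop i.+1 zs); rewrite -zsE /=.
  rewrite size_take isz addn0 addrCA => /(canLR (addrK _)) <-.
  apply: (idealB hS); first exact: tS.
  apply: (idealD hS).
    apply: (lspan_min (s := take i zs) hS) (lspan_comb _ _) => z zz.
    by apply: zs'S; rewrite mem_cat zz.
  apply: (lspan_min (s := drop i.+1 zs) hS) (lspan_comb _ _) => z zz.
  by apply: zs'S; rewrite mem_cat zz orbT.
move: v vs; apply: lspan_min => // z; rewrite {1}zsE mem_cat inE => /or3P[zz|/eqP->//|zz].
  by apply: zs'S; rewrite mem_cat zz.
by apply: zs'S; rewrite mem_cat zz orbT.
Qed.

Variables (k : nat) (bb : 'cV[R]_k).
Hypotheses (bI : forall i, I (bb i 0)).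
Hypothesis bgen : forall y, I y -> exists c : 'rV_k, I2 (y - (c *m bb) 0 0).
Hypothesis bind : forall c : 'rV_k, I2 ((c *m bb) 0 0) -> idv I c.

Let w := t ++ zs.
Let wv : 'cV_(size w) := \col_i w`_i.

(** Minimality puts the coefficients of zs in J. A socle element x of R/I then sends the zs part
    into I^2, so x c_i lies in I for each coefficient on t; if c_i were a unit modulo I, so would
    x. *)
Lemma relation_max (r : 'rV_(size w)) : I2 ((r *m wv) 0 0) -> forall j, J (r 0 j).
Proof.
have [c [cE <-]] := comb_row r; rewrite comb_cat => rI j; rewrite -cE.
pose c' i := c (size t + i)%N.
have cz : forall i, (i < size zs)%N -> J (c' i).
  apply: minimal_relation; rewrite -(addKr (comb c t) (comb c' zs)) addrC.
  by apply: (idealB ht); [exact: I2t | exact: lspan_comb].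
have [x [xI Jx]] := ex_socle_mod.
have xz : I2 (x * comb c' zs).
  rewrite -combM combE; apply: (@ideal_sum R I2 _ _ _ hI2) => i; apply: IM2.
    by rewrite mulrC; exact/Jx/cz.
  by apply: zs_gen.1; exact: mem_nth.
have [d [dI xcd]] : I2 (x * comb c t).
  rewrite -(addrK (x * comb c' zs) (x * comb c t)) -mulrDr.
  by apply: (idealB hI2) => //; exact: idealM.
have ct i : (i < size t)%N -> J (c i).
  move=> isz; apply: contrapT => /unit_mod[b bI']; apply: xI.
  have xc : I (x * c i).
    rewrite -(subrK (d i) (x * c i)); apply: (idealD hI) => //; apply: lspan_tI.
    by apply: (tind (c := fun i => x * c i - d i)); rewrite // combB combM xcd subrr.
  rewrite -[x]mul1r -(subrK (b * c i) 1) mulrDl; apply: (idealD hI).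
    by rewrite mulrC; exact: idealM.
  by rewrite -mulrA [c i * x]mulrC; exact: idealM.
have [jt|tj] := ltnP j (size t); first exact: ct.
have := cz (j - size t)%N; rewrite /c' subnKC //; apply.
by rewrite ltn_subLR // -size_cat.
Qed.

Let mI p q (M : 'M[R]_(p, q)) := forall i j, I (M i j).

Let mIB p q (M N : 'M_(p, q)) : mI M -> mI N -> mI (M - N).
Proof. by move=> MI NI i j; rewrite !mxE; exact: idealB. Qed.
Let mID p q (M N : 'M_(p, q)) : mI M -> mI N -> mI (M + N).
Proof. by move=> MI NI i j; rewrite !mxE; exact: idealD. Qed.
Let mIMl p q r (M : 'M_(p, q)) (N : 'M_(q, r)) : mI N -> mI (M *m N).
Proof. by move=> NI i j; rewrite mxE; apply: ideal_sum => // l; exact: idealM. Qed.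
Let mIMr p q r (M : 'M_(p, q)) (N : 'M_(q, r)) : mI M -> mI (M *m N).
Proof. by move=> MI i j; rewrite mxE; apply: ideal_sum => // l; rewrite mulrC; exact: idealM. Qed.

Let m2 p (M : 'cV[R]_p) := forall i, I2 (M i 0).

Let m2M p q (M : 'M_(p, q)) (N : 'cV_q) : m2 N -> m2 (M *m N).
Proof. by move=> NI i; rewrite mxE; apply: ideal_sum => // l; exact: idealM. Qed.
(* Write w = G bb and bb = H w modulo I^2.  Since bb is a basis of I / I^2,     *)
(* E = 1 - G H is idempotent modulo I; its rows are relations between the      *)
(* elements of w, so its entries lie in J, and therefore in I.                 *)
Lemma minimal_independent c : lspan t (comb c zs) -> forall i, (i < size zs)%N -> I (c i).
Proof.
have wI i : I (wv i 0).
  rewrite mxE; have : w`_i \in w by exact: mem_nth.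
  by rewrite mem_cat => /orP[/tI|/zs_gen.1].
have /choice[g gE] i := bgen (wI i); pose G := \matrix_i g i.
have GE : m2 (wv - G *m bb).
  move=> i; have -> : (wv - G *m bb) i 0 = wv i 0 - (g i *m bb) 0 0; last exact: gE.
  by rewrite !mxE; congr (_ - _); apply: eq_bigr => j _; rewrite mxE.
have /choice[h hE] i : exists r : 'rV_(size w), bb i 0 = (r *m wv) 0 0.
  have [u [v [ut vs ->]]] := zs_gen.2 _ (bI i).
  have [d [_ dE]] : lc (fun=> True) w (u + v).
    rewrite -lspan_lc; apply: (idealD (lspan_ideal w)).
      by move: u ut; apply: lspan_min => [|q qt]; [exact: lspan_ideal | apply: lspan_mem; rewrite mem_cat qt].
    by move: v vs; apply: lspan_min => [|q qz]; [exact: lspan_ideal | apply: lspan_mem; rewrite mem_cat qz orbT].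
  exists (\row_i d i); rewrite dE combE mxE; apply: eq_bigr => l _; rewrite !mxE //.
pose H := \matrix_i h i.
have HE : bb = H *m wv.
  apply/matrixP => i j; rewrite ord1 hE !mxE; apply: eq_bigr => l _; by rewrite !mxE.
have rowm2 p (M : 'M_(p, k)) : m2 (M *m bb) -> mI M.
  move=> Mb i j; have := bind (c := row i M); rewrite -row_mul mxE => /(_ (Mb i)) /(_ j).
  by rewrite mxE.
have HG : mI (1%:M - H *m G).
  apply: rowm2; rewrite mulmxBl mul1mx {1}HE -mulmxA -mulmxBr; exact: m2M.
pose E := 1%:M - G *m H.
have EJ i j : J (E i j).
  have -> : E i j = row i E 0 j by rewrite [RHS]mxE.
  apply: relation_max; rewrite -row_mul mxE mulmxBl mul1mx -mulmxA -HE; exact: GE.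
have EE : mI (E - E *m E).
  have -> : E - E *m E = G *m (1%:M - H *m G) *m H.
    rewrite /E mulmxBl mul1mx opprB addrCA subrr addr0.
    by rewrite mulmxBr mulmx1 mulmxBr mulmx1 mulmxBl !mulmxA.
  exact/mIMr/mIMl.
(* Otherwise some M = a E modulo I is nonzero and killed by J. Entries of E lie in J, so M E = 0
   modulo I, while idempotency gives a E = M E modulo I. *)
have EI : mI E.
  apply: contrapT => nE.
  have hm : submodule (fun M : 'M[R]_(size w) => mI M).
    split=> [i j|a M N MI NI i j]; first by rewrite mxE; exact: ideal0.
    by rewrite !mxE; exact: hI.2.
  have [_ Js sn] := artI.
  have cs : cseries J (fun M : 'M[R]_(size w) => mI M) (addx (fun M => mI M) E).
    apply: (cseries_addx (s := s) hm).
      by move=> a /sn[l al]; exists l => i j; rewrite mxE mulrC; exact: idealM.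
    by move=> a /Js aS; exists 0; rewrite subr0 scale0r; split=> //; exact: submodule_zero hm.
  have [|M [[a [N [NI ME]]] nM JM]] := cseries_socle cs hm.
    by move=> /(_ E (mem_addx E hm)).
  apply: nM; rewrite ME; apply: mID => //.
  have aE : a *: E = a *: (E - E *m E) + (M - N) *m E.
    have -> : M - N = a *: E by rewrite ME addrK.
    by rewrite -scalemxAl -scalerDr subrK.
  rewrite aE; apply: mID; first by move=> i j; rewrite mxE; exact: idealM.
  rewrite mulmxBl; apply: mIB; last exact: mIMr.
  move=> i j; rewrite mxE; apply: (@ideal_sum R I _ _ _ hI) => l.
  by have := JM _ (EJ l j) i l; rewrite mxE mulrC.
move=> ct i isz.
have [d [_ dE]] : lc (fun=> True) t (comb c zs) by rewrite -lspan_lc.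
(* Coefficients on t complete the relation modulo (t) to an exact one, r w = 0; then r = r E + (r G)
   H and both terms have entries in I. *)
pose cf j := if (j < size t)%N then - d j else c (j - size t)%N.
pose r : 'rV_(size w) := \row_j cf j.
have rw0 : (r *m wv) 0 0 = 0.
  have -> : (r *m wv) 0 0 = comb cf w.
    by rewrite combE mxE; apply: eq_bigr => l _; rewrite !mxE.
  rewrite comb_cat (eq_comb (d := fun i => 0 - d i)); last by move=> l lt; rewrite /cf lt sub0r.
  rewrite combB comb0 sub0r -dE; apply/eqP; rewrite addrC subr_eq0; apply/eqP.
  by apply: eq_comb => l _; rewrite /cf ltnNge leq_addr addKn.
have rG : mI (r *m G).
  apply: rowm2 => l; rewrite ord1.
  have -> : r *m G *m bb = r *m wv - r *m (wv - G *m bb).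
    by rewrite mulmxBr subKr mulmxA.
  rewrite mxE rw0 add0r mxE; apply: idealN => //; exact: m2M.
have rI : mI r.
  have -> : r = r *m E + r *m G *m H by rewrite mulmxBr mulmx1 mulmxA subrK.
  by apply: mID; [exact: mIMl | exact: mIMr].
have isz' : (size t + i < size w)%N by rewrite size_cat ltn_add2l.
have := rI 0 (Ordinal isz'); rewrite mxE /= /cf ltnNge leq_addr addKn //.
Qed.

End Minimal.
End IdealBasis.

(** * Quotient rings and local rings *)

Section RMorphismOf.
Variables (B C : comNzRingType) (f : B -> C).
Hypotheses (fB : zmod_morphism f) (fM : monoid_morphism f).
Definition rmorphism_of of zmod_morphism f & monoid_morphism f := f.
HB.instance Definition _ := GRing.isZmodMorphism.Build B C (rmorphism_of fB fM) fB.
HB.instance Definition _ := GRing.isMonoidMorphism.Build B C (rmorphism_of fB fM) fM.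
Lemma ex_rmorphism : exists g : {rmorphism B -> C}, g =1 f.
Proof. by exists (rmorphism_of fB fM). Qed.
End RMorphismOf.

Lemma rmorphism_factor (B C A : comNzRingType) (psi : {rmorphism B -> C})
    (chi : {rmorphism B -> A}) :
  (forall c, exists x, psi x = c) -> (forall x, psi x = 0 -> chi x = 0) ->
  exists phi : {rmorphism C -> A}, forall x, phi (psi x) = chi x.
Proof.
move=> psi_surj ker; have /choice[g gE] := psi_surj.
have fE x : chi (g (psi x)) = chi x.
  by apply/eqP; rewrite -subr_eq0 -rmorphB ker // rmorphB gE subrr.
have fB : zmod_morphism (fun c => chi (g c)).
  by move=> c d; rewrite -{1}(gE c) -{1}(gE d) -rmorphB fE rmorphB.
have fM : monoid_morphism (fun c => chi (g c)).
  split=> [|c d]; first by rewrite -(rmorph1 psi) fE rmorph1.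
  by rewrite -{1}(gE c) -{1}(gE d) -rmorphM fE rmorphM.
by have [phi phiE] := ex_rmorphism fB fM; exists phi => x; rewrite phiE fE.
Qed.

Lemma ideal_quot_pi (R : comNzRingType) (I : idealr R) :
  exists p : {rmorphism R -> {ideal_quot I}},
    (forall c, exists x, p x = c) /\ forall x, p x = 0 <-> x \in I.
Proof.
exists (\pi_{ideal_quot I}); split=> [c|x]; first by exists (repr c); exact: reprK.
rewrite -(rmorph0 (\pi_{ideal_quot I})) -{2}[x]subr0 Quotient.idealrBE.
by split=> [->|/eqP].
Qed.

Section Image.
Variables (B C : comNzRingType) (psi : {rmorphism B -> C}) (d : B -> Prop).
Hypotheses (psi_surj : forall c, exists x, psi x = c) (psi_ker : forall x, psi x = 0 <-> d x).

Definition img (a : B -> Prop) : C -> Prop := fun y => exists2 x, a x & psi x = y.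

Lemma img_ideal a : ideal_p a -> ideal_p (img a).
Proof.
move=> ha; split; first by exists 0; [exact: ideal0 | rewrite rmorph0].
move=> c _ _ [x ax <-] [y ay <-]; have [c' <-] := psi_surj c.
by exists (c' * x + y); [exact: ha.2 | rewrite rmorphD rmorphM].
Qed.

Lemma img_mem a x : ideal_p a -> incl d a -> img a (psi x) <-> a x.
Proof.
move=> ha da; split=> [[y ay yx]|]; last by exists x.
rewrite -(subrK y x); apply: (idealD ha) => //; apply/da/psi_ker.
by rewrite rmorphB yx subrr.
Qed.

Lemma img_ker : img d = (fun y => y = 0).
Proof.
apply: pred_ext => y; split=> [[x /psi_ker xd <-]//|->].
by exists 0; rewrite ?rmorph0 //; apply/psi_ker; rewrite rmorph0.
Qed.

Lemma img_rflat I a bs a' : ideal_p I -> ideal_p a -> incl d a -> incl d I ->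
  rflat I a bs a' -> rflat (img I) (img a) (map psi bs) (img a').
Proof.
move=> hI + + dI fl; elim: fl => {a bs a'} [a _ _|a beta bs a' Ia aI _ IH ha da].
  exact: rflat_nil.
apply: rflat_cons.
- by move=> _ [x xI <-]; rewrite -rmorphM; apply/img_mem/Ia.
- move=> c; have [x <-] := psi_surj c; rewrite -rmorphM => /(img_mem _ ha da)/aI xI.
  by exists x.
have -> : addr_p (img a) (psi beta) = img (addr_p a beta).
  apply: pred_ext => y; split=> [[c [_ [[u ua <-] ->]]]|[_ [c [u [ua ->]]] <-]].
    have [c' <-] := psi_surj c; exists (beta * c' + u); first by exists c', u.
    by rewrite rmorphD rmorphM.
  by exists (psi c), (psi u); rewrite rmorphD rmorphM; split=> //; exists u.
by apply: IH; [exact: addr_ideal | move=> x /da; exact: incl_addr].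
Qed.

Lemma img_lspan s x : lspan s x -> lspan (map psi s) (psi x).
Proof.
elim: s x => [x ->|y s IH _ [c [r [/IH rs ->]]]] /=; first exact: rmorph0.
by exists (psi c), (psi r); rewrite rmorphD rmorphM.
Qed.

Lemma img_artinian J s I : incl d J -> ideal_p J ->
  artinian_mod J s I -> artinian_mod (img J) (map psi s) (img I).
Proof.
move=> dJ hJ [Jf Js sn]; split.
- move=> c; have [x <-] := psi_surj c => nJ.
  have [|y yJ] := Jf x; first by move=> xJ; apply: nJ; exists x.
  exists (psi y); rewrite -(rmorph1 psi) -rmorphM -rmorphB; by exists (1 - y * x).
- by move=> _ [x /Js xs <-]; exact: img_lspan.
by move=> _ /mapP[x /sn[t xt] ->]; exists t; rewrite -rmorphXn; exists (x ^+ t).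
Qed.

End Image.

Section LocalRing.
Variables (R : comNzRingType) (m : idealr R).

Lemma idealr_ideal (K : idealr R) : ideal_p (fun x => x \in K).
Proof.
by split=> [|c u v uK vK]; [exact: idealr0 | rewrite rpredD // idealMr].
Qed.

Lemma maximal_field a : maximal_ideal m -> ~ a \in m -> exists c, 1 - c * a \in m.
Proof.
move=> mmax am; apply: contrapT => h.
have hU := addr_ideal a (idealr_ideal m).
have [|K KE] := ex_idealr hU.
  by move=> [c [u [um E]]]; apply: h; exists c; rewrite mulrC {1}E addrC addKr.
apply: am; apply: (mmax K) => [x xm|]; first exact/KE/incl_addr.
by apply/KE; exists 1, 0; rewrite mulr1 addr0 idealr0.
Qed.

(** Otherwise dependent choice gives a strictly ascending sequence, whose union is finitely
    generated and so equals one of its terms. *)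
Lemma ex_maximal_ideal (U : R -> Prop) : noetherian R -> ideal_p U -> ~ U 1 ->
  exists K : idealr R, maximal_ideal K /\ forall x, U x -> x \in K.
Proof.
move=> nR hU U1; apply: contrapT => nmax.
pose Q (i : nat) (K : idealr R) := forall x, U x -> x \in K.
pose S (i : nat) (K L : idealr R) := {subset K <= L} /\ exists2 x, x \in L & x \notin K.
have [||f fP] := @dependent_choice (fun=> idealr R) Q S.
- by have [K KE] := ex_idealr hU U1; exists K => x /KE.
- move=> i K UK; have /existsNP[L /not_implyP[KL /existsNP[x /not_implyP[xL xK]]]] : ~ maximal_ideal K.
    by move=> Kmax; apply: nmax; exists K.
  by exists L; split=> [y /UK/KL //|]; split=> //; exists x => //; exact/negP.
have fS i j : (i <= j)%N -> {subset f i <= f j}.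
  elim: j => [|j IH]; first by rewrite leqn0 => /eqP ->.
  rewrite leq_eqVlt => /predU1P[->//|/IH sub] x /sub; exact: (fP j).2.1.
pose V x := exists i, x \in f i.
have hV : ideal_p V.
  split=> [|c u v [i ui] [j vj]]; first by exists 0%N; exact: idealr0.
  exists (maxn i j); rewrite rpredD //; last exact: (fS j _ (leq_maxr i j) v vj).
  by rewrite idealMr //; exact: (fS i _ (leq_maxl i j) u ui).
have [gs gsE] := noetherian_regular nR (ideal_submodule hV).
have [N gsN] : exists N, forall g, g \in gs -> g \in f N.
  have : forall g, g \in gs -> V g by move=> g /vspan_gen/gsE.
  elim: gs {gsE} => [|g gs IH] gV; first by exists 0%N.
  have [|N NP] := IH; first by move=> h hs; apply: gV; rewrite inE hs orbT.
  have [i gi] := gV g (mem_head _ _); exists (maxn i N) => h.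
  rewrite inE => /orP[/eqP->|/NP hN]; first exact: (fS i _ (leq_maxl i N) g gi).
  exact: (fS N _ (leq_maxr i N) h hN).
have [_ [_ [x xN1 /negP]]] := fP N; apply.
have /gsE/vspan_lspan : V x by exists N.+1.
exact: (@lspan_min _ gs (fun y => y \in f N) (idealr_ideal (f N)) gsN).
Qed.

Lemma local_unit x a : noetherian R -> is_local m -> x \in m ->
  exists c, c * (1 - a * x) = 1.
Proof.
move=> nR [_ muniq] xm; apply: contrapT => nu.
pose U r := exists c, r = c * (1 - a * x).
have hU : ideal_p U.
  split=> [|c _ _ [u ->] [v ->]]; first by exists 0; rewrite mul0r.
  by exists (c * u + v); rewrite mulrDl mulrA.
have [|K [/muniq Km UK]] := ex_maximal_ideal nR hU.
  by move=> [c E]; apply: nu; exists c.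
have : 1 \in K.
  have yK : 1 - a * x \in K by apply: UK; exists 1; rewrite mul1r.
  by rewrite -(subrK (a * x) 1) rpredD // Km idealMr.
by rewrite idealr1.
Qed.

Lemma prime_chain_leq d e : (e <= d)%N -> prime_chain R d -> prime_chain R e.
Proof.
move=> ed [p pP]; have ed' : (e.+1 <= d.+1)%N by [].
by exists (fun i => p (widen_ord ed' i)) => i j ij; exact: pP.
Qed.

Lemma krull_dim_uniq d e : krull_dim R d -> krull_dim R e -> d = e.
Proof.
have aux a b : krull_dim R a -> krull_dim R b -> (a <= b)%N.
  move=> [ca _] [_ nb]; rewrite leqNgt; apply/negP => ba.
  by apply: nb; exact: prime_chain_leq ca.
by move=> hd he; apply/eqP; rewrite eqn_leq !aux.
Qed.

Lemma regular_seq_mod (s : seq R) : regular_seq s -> regular_mod (fun r => r = 0) s.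
Proof.
move=> [reg _].
suff main j : (j <= size s)%N -> regular_mod (lspan (take (size s - j) s)) (drop (size s - j) s).
  by have := main _ (leqnn _); rewrite subnn take0 drop0.
elim: j => [|j IH] js; first by rewrite subn0 drop_size.
have isz : (size s - j.+1 < size s)%N by rewrite ltn_subrL (leq_trans _ js).
have iE : (size s - j = (size s - j.+1).+1)%N by rewrite subnSK.
have := IH (ltnW js); rewrite iE; set i := (size s - j.+1)%N in isz *.
move=> regi; rewrite (drop_nth 0 isz); split.
  by move=> r /ideal_genP/(reg i isz)/ideal_genP.
suff -> : addr_p (lspan (take i s)) s`_i = lspan (take i.+1 s) by [].
rewrite (take_nth 0 isz) -cats1; apply: pred_ext => r; split.
  move=> [c [u [us ->]]]; apply: (idealD (lspan_ideal _)).
    rewrite mulrC; apply: (idealM _ (lspan_ideal _)); apply: lspan_mem.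
    by rewrite mem_cat mem_head orbT.
  apply: lspan_min us => [|x xs]; first exact: lspan_ideal.
  by apply: lspan_mem; rewrite mem_cat xs.
apply: lspan_min; first exact/addr_ideal/lspan_ideal.
move=> x; rewrite mem_cat inE => /orP[xs|/eqP->]; first exact/incl_addr/lspan_mem.
exists 1, 0; rewrite mulr1 addr0; split=> //; exact: ideal0 (lspan_ideal _).
Qed.

End LocalRing.

(* The parameter ideal is (t), and I = (t) + (zs) with zs independent modulo (t). *)
Record ulrich_data (R : comNzRingType) (m I : idealr R) (n : nat) (t zs s : seq R) : Prop :=
  UlrichData {
    ud_size : size t = n;
    ud_max : forall x, x \in t -> x \in m;
    ud_regular : suffix_regular t;
    ud_t : forall x, x \in t -> x \in I;
    ud_z : forall x, x \in zs -> x \in I;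
    ud_gen : forall y, y \in I -> sum_p (lspan t) (lspan zs) y;
    ud_indep : forall c, lspan t (comb c zs) -> forall i, (i < size zs)%N -> c i \in I;
    ud_square : forall x y, x \in I -> y \in I -> lc (fun r => r \in I) t (x * y);
    ud_artin : artinian_mod (fun r => r \in m) s (fun r => r \in I);
    ud_sub : {subset I <= m};
    ud_exp : forall l x, x \in ideal_exp I l.+1 <-> upow t (fun r => r \in I) l x
  }.

Section Conormal.
Variables (R : comNzRingType) (I : idealr R) (t : seq R).
Hypothesis exp2 : forall x, x \in ideal_exp I 2 <-> lc (fun r => r \in I) t x.

Lemma conormal_basis : free_module (conormal I) -> exists k (bb : 'cV[R]_k),
  [/\ forall i, bb i 0 \in I,
      forall y, y \in I -> exists c : 'rV_k, lc (fun r => r \in I) t (y - (c *m bb) 0 0) &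
      forall c : 'rV_k, lc (fun r => r \in I) t ((c *m bb) 0 0) -> idv (fun r => r \in I) c].
Proof.
pose I2 := ideal_pow I (isT : (0 < 2)%N).
move=> [k [b bP]]; exists k, (\col_i repr (val (b i))).
have bI i : repr (val (b i)) \in I by case: (b i) => x xI; exact: xI.
have sumE (c : 'I_k -> R) : val (\sum_i \pi_{ideal_quot I} (c i) *: b i) =
    \pi_{ideal_quot I2} (\sum_i c i * repr (val (b i))).
  rewrite rmorph_sum raddf_sum; apply: eq_bigr => i _.
  apply: etrans (conormal_scaleE (c i) (b i)) _.
  by rewrite rmorphM [X in _ = _ * X]reprK.
have mulE (c : 'rV_k) : (c *m \col_i repr (val (b i))) 0 0 = \sum_i c 0 i * repr (val (b i)).
  by rewrite mxE; apply: eq_bigr => i _; rewrite mxE.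
have piE (x : R) : \pi_{ideal_quot I} x = 0 <-> x \in I.
  rewrite -(rmorph0 (\pi_{ideal_quot I})) -{2}[x]subr0 Quotient.idealrBE.
  by split=> [->|/eqP].
split=> [i|y yI|c]; first by rewrite mxE.
  have yP : \pi_{ideal_quot I2} y \in conormal_pred (I := I) by rewrite conormal_predE.
  have [c [cE _]] := bP (@Conormal R I _ yP); exists (\row_i repr (c 0 i)).
  have toI2 x : x \in I2 -> x \in ideal_exp I 2 by [].
  rewrite mulE; apply/exp2/toI2; rewrite Quotient.idealrBE; apply/eqP.
  have := congr1 val cE; rewrite (eq_bigr (fun i => \pi_{ideal_quot I} (repr (c 0 i)) *: b i)).
    by rewrite sumE /= => ->; congr (\pi _); apply: eq_bigr => i _; rewrite mxE.
  by move=> i _; rewrite reprK.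
rewrite mulE => /exp2 cI.
(* Linear independence is the uniqueness of the coordinates of 0. *)
have [c0 [_ c0U]] := bP 0.
have E1 : c0 = 0 by apply: c0U; rewrite big1 // => i _; rewrite mxE scale0r.
have E2 : c0 = \row_i \pi_{ideal_quot I} (c 0 i).
  apply: c0U; apply: val_inj.
  rewrite (eq_bigr (fun i => \pi_{ideal_quot I} (c 0 i) *: b i)) => [|i _]; last by rewrite mxE.
  rewrite sumE; apply/eqP; rewrite eq_sym -[X in _ == X](rmorph0 (\pi_{ideal_quot I2})).
  by rewrite -Quotient.idealrBE subr0.
move=> j; apply/piE; have := congr1 (fun M : 'rV_k => M 0 j) E2.
by rewrite E1 !mxE.
Qed.

End Conormal.

(** Cohen-Macaulayness supplies a regular sequence [ys] of length n in m. Its elements have powers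
    in Q = (t) and t has n elements, so [suffix_regular_depth] makes t regular. *)
Lemma ex_ulrich_data (R : comNzRingType) (m I : idealr R) n :
  cohen_macaulay_local m -> krull_dim R n -> ulrich_ideal m I ->
  exists t zs s, ulrich_data m I n t zs s.
Proof.
move=> [nR loc [d kd [[ys [sy ym yreg]] _]]] kn [primI [Q [[t [kt QE primQ]] QI exp2]] free].
have nM := noetherian_regular nR.
have st : size t = n := krull_dim_uniq kt kn.
have hI := idealr_ideal I; have ht := lspan_ideal t.
have Qt x : x \in Q <-> lspan t x by rewrite QE; exact: ideal_genP.
have tQ x : x \in t -> x \in Q by move=> xt; apply/Qt/lspan_mem.
have tm x : x \in t -> x \in m by move=> /tQ xQ; apply/primQ.2; exists 1%N.
have tI x : x \in t -> x \in I by move=> /tQ/QI.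
have reg : suffix_regular t.
  apply: (suffix_regular_depth nM) (regular_seq_mod yreg) _ _.
  - by move=> x /tm xm a; exact: (local_unit a nR loc xm).
  - by rewrite st sy (krull_dim_uniq kd kn).
  - by move=> y /ym/primQ.2[k yk]; exists k; apply/Qt.
have qr := suffix_quasi_regular reg.
have exp2E x : x \in ideal_exp I 2 <-> lc (fun r => r \in I) t x.
  rewrite exp2; split; last first.
    move: x; apply: lc_min.
      by split=> [|c u v uU vU]; [exact: ideal_mul0 | rewrite ideal_mulD // ideal_mulM].
    by move=> q a /tQ qQ aI; rewrite mulrC mem_ideal_mul.
  move=> /ideal_mulP[u /allP uP ->]; rewrite big_seq.
  have hL := lc_ideal t hI.
  elim/big_ind: _ => [|x1 x2|p /uP /andP[p1 p2]]; first exact: ideal0.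
    exact: idealD.
  move/Qt: p1; move: (p.1); apply: lspan_min; first exact: colon_ideal.
  by move=> q qt; rewrite mulrC; exact: lc_mem.
have sq x y : x \in I -> y \in I -> lc (fun r => r \in I) t (x * y).
  move=> xI yI; apply/exp2E; rewrite [ideal_exp _ _]/(ideal_mul I (ideal_mul I predT)).
  by rewrite mem_ideal_mul // -[y]mulr1 mem_ideal_mul.
have Im : {subset I <= m} by move=> x xI; apply/primI.2; exists 1%N.
have [s sE] := nR m.
have art : artinian_mod (fun r => r \in m) s (fun r => r \in I).
  split.
  - by move=> a am; apply: maximal_field am; case: loc.
  - by move=> a; rewrite sE => /ideal_genP.
  - move=> a sa; apply/primI.2; rewrite sE; apply/ideal_genP; exact: lspan_mem.
have Ifg : exists gs, (fun r : R => is_true (r \in I)) = lspan gs.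
  have [gs gsE] := nR I; exists gs; apply: pred_ext => r; rewrite gsE; exact: ideal_genP.
have tind c : comb c t = 0 -> forall i, (i < size t)%N -> lspan t (c i).
  by have := qr 1%N c; rewrite monos1.
have I1 : ~ 1 \in I by rewrite idealr1.
have [zs [zg zmin]] := ex_minimal_generators t Ifg.
have [k [bb [bI bgen bind]]] := conormal_basis exp2E free.
exists t, zs, s; split=> //.
- by case: zg.
- by case: zg.
- apply: (minimal_independent hI art _ I1 tI tind sq zg zmin bI bgen bind).
  by move=> x /primI.2.
have hT l := upow_ideal t hI l.
elim=> [|l IH] x.
  rewrite upow0 //; split=> [|xI]; first exact: ideal_mul_sub.
  by rewrite -[x]mulr1 mem_ideal_mul.
split.
  move=> /ideal_mulP[u /allP uP ->]; rewrite big_seq.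
  elim/big_ind: _ => [|x1 x2|p /uP /andP[p1 p2]]; first exact: ideal0.
    exact: idealD.
  by apply: upowM => //; apply/IH.
have hE : ideal_p (fun r => r \in ideal_exp I l.+2).
  by split=> [|c u v uU vU]; [exact: ideal_mul0 | rewrite ideal_mulD // ideal_mulM].
move: x; apply: lc_min => // _ a /monos_fac[q [b [qt bl ->]]] aI.
rewrite mulrCA; apply: mem_ideal_mul; first exact: tI.
by apply/IH; exact: lc_mem.
Qed.

(** * Proof of the theorem *)

Section UlrichSAC.
Variables (R : comNzRingType) (m I : idealr R) (n : nat) (t zs s : seq R).
Hypothesis U : ulrich_data m I n t zs s.
Hypothesis gorA : gorenstein_local {ideal_quot I}.

Let Ip : R -> Prop := fun r => r \in I.
Let mp : R -> Prop := fun r => r \in m.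
Let hI : ideal_p Ip := idealr_ideal I.
Let hm : ideal_p mp := idealr_ideal m.
Let Im : incl Ip mp := ud_sub U.

Lemma quotient_separation p q (M : 'M[{ideal_quot I}]_(p, q)) (z : 'rV_q) :
  ~ rowspan M z -> exists2 y : 'cV_q, M *m y = 0 & z *m y <> 0.
Proof.
have [piA [piA_surj piA_ker]] := ideal_quot_pi I.
have [_ _ injA] := gorA.
have [Jf Js sn] := img_artinian piA_surj Im hm (ud_artin U).
have h0 := img_ker piA_ker.
apply: (rowspan_separation Jf Js _ (img_ideal piA_surj hm)) injA.
by move=> a /sn[k]; rewrite h0 => ak; exists k.
Qed.

Let upow_exp l (l_gt0 : (0 < l.+1)%N) x : x \in ideal_pow I l_gt0 <-> upow t Ip l x.
Proof. exact: ud_exp U l x. Qed.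

Let qr : quasi_regular t := suffix_quasi_regular (ud_regular U).

(** Descent over B = R/I^(l+2) with q = 0 and a the image of I^(l+1). SAC is known for A itself, so
    both quotient maps are B -> A and the third filtration is empty. *)
Lemma SAC_power l (l_gt0 : (0 < l.+2)%N) : noetherian R -> (l.+2 <= n)%N ->
  SAC {ideal_quot I} -> SAC {ideal_quot (ideal_pow I l_gt0)}.
Proof.
move=> nR ln sA.
have [piA [piA_surj piA_ker]] := ideal_quot_pi I.
have [piS [piS_surj piS_ker']] := ideal_quot_pi (ideal_pow I l_gt0).
have piS_ker x : piS x = 0 <-> upow t Ip l.+1 x.
  by rewrite piS_ker'; exact: upow_exp.
have hW j : ideal_p (upow t Ip j) by exact: upow_ideal.
have fl := rflat_bottom hI qr (ud_t U) (ud_z U) (ud_square U) (ud_gen U) (ud_indep U) l.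
have flc := rflat_chain hI qr (ud_t U) (ud_z U) (ud_square U) (ud_gen U) (ud_indep U) l.
have dW : incl (upow t Ip l.+1) (upow t Ip l) := rflat_incl fl.
have dI : incl (upow t Ip l.+1) Ip by move=> x /dW; exact: rflat_incl flc x.
have [phi phiE] := rmorphism_factor piS_surj (fun x xd => iffRL (piA_ker x) (dI x (iffLR (piS_ker x) xd))).
have phi_surj c : exists x, phi x = c.
  by have [x <-] := piA_surj c; exists (piS x).
have phi_ker y : phi y = 0 <-> img piS Ip y.
  by have [x <-] := piS_surj y; rewrite phiE (img_mem piS_ker) // piA_ker.
have nS := noetherian_mx_quotient piS_surj (noetherian_mxE (noetherian_regular nR)).
apply: SAC_of_mx nS _ => e D DD Dex HB HM.
have hq : ideal_p (fun y : {ideal_quot (ideal_pow I l_gt0)} => y = 0).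
  by rewrite -(img_ker piS_ker); exact: img_ideal.
have art := img_artinian piS_surj (fun x xd => Im (dI x xd)) hm (ud_artin U).
have flS := img_rflat piS_surj piS_ker hI (hW _) (fun x => id) dI fl.
rewrite (img_ker piS_ker) in flS.
have flcS := img_rflat piS_surj piS_ker hI (hW _) dW dI flc.
have hIS := img_ideal piS_surj hI.
have main := @SAC_descent _ _ _ _ hIS art _ _ DD _ _ phi phi _ _ _ _ _ [::]
  phi_surj phi_ker phi_surj phi_ker quotient_separation hq flS flcS _ _ (rflat_nil _ _) (SAC_mx_of sA).
rewrite -idK0; apply: main.
- by rewrite !size_map; apply: size_chain_list; rewrite (ud_size U).
- move=> _ c /mapP[b bl ->] [x xI <-]; rewrite -rmorphM; apply/piS_ker.
  exact: (bottom_kill hI (ud_z U) (ud_square U) bl).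
- by move=> i; rewrite idv0.
by have [c Hc] := HM; exists c; rewrite idK0.
Qed.

(** Descent over R with q = (t), a = I and C = R/I^(l+1). The middle filtration is empty, so the
    rank condition becomes [1 < size zs]. *)
Lemma SAC_base l (l_gt0 : (0 < l.+1)%N) : noetherian R -> is_local m -> (1 < size zs)%N ->
  SAC {ideal_quot (ideal_pow I l_gt0)} -> SAC R.
Proof.
move=> nR loc rz sS.
have [piA [piA_surj piA_ker]] := ideal_quot_pi I.
have [piS [piS_surj piS_ker']] := ideal_quot_pi (ideal_pow I l_gt0).
have piS_ker x : piS x = 0 <-> upow t Ip l x by rewrite piS_ker'; exact: upow_exp.
have nM := noetherian_regular nR.
apply: (SAC_of_mx (noetherian_mxE nM)).
apply: (SAC_mx_regular nM _ (ud_regular U)).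
  by move=> x /(ud_max U) xm a; exact: (local_unit a nR loc xm).
move=> e D DD.
have flz := rflat_zs hI qr (ud_t U) (ud_z U) (ud_square U) (ud_gen U) (ud_indep U).
have flc := rflat_chain hI qr (ud_t U) (ud_z U) (ud_square U) (ud_gen U) (ud_indep U) l.
apply: (SAC_descent hI (ud_artin U) DD piA_surj piA_ker piS_surj piS_ker quotient_separation
  (lspan_ideal t) flz (rflat_nil _ _) rz _ flc (SAC_mx_of sS)).
by move=> z c zz cI; exact: lc_lspan (ud_square U (ud_z U zz) cI).
Qed.

(** Since t and zs together generate I, mu - n > 1 forces zs to have more than one element. *)
Lemma min_generators_bound mu : min_generators I mu -> (mu <= n + size zs)%N.
Proof.
move=> [_ muP]; rewrite -(ud_size U) -size_cat; apply: muP => x.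
apply/idP/idP => [xI|/ideal_genP].
  apply/ideal_genP; have [u [v [ut vz ->]]] := ud_gen U xI.
  apply: (idealD (lspan_ideal _)).
    move: u ut; apply: lspan_min; first exact: lspan_ideal.
    by move=> q qt; apply: lspan_mem; rewrite mem_cat qt.
  move: v vz; apply: lspan_min; first exact: lspan_ideal.
  by move=> q qz; apply: lspan_mem; rewrite mem_cat qz orbT.
move: x; apply: (lspan_min (U := Ip)) => // y.
by rewrite mem_cat => /orP[/(ud_t U)|/(ud_z U)].
Qed.

End UlrichSAC.

Theorem theorem4p5 (R : comNzRingType) (m : idealr R) (n : nat) (I : idealr R) :
  cohen_macaulay_local m -> krull_dim R n ->
  ulrich_ideal m I -> gorenstein_local {ideal_quot I} ->
  (SAC {ideal_quot I} -> (2 <= n)%N ->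
     forall (l : nat) (l_gt0 : (0 < l)%N), (2 <= l)%N -> (l <= n)%N ->
       SAC {ideal_quot (ideal_pow I l_gt0)})
  /\
  ((exists (l : nat) (l_gt0 : (0 < l)%N), SAC {ideal_quot (ideal_pow I l_gt0)}) ->
     forall mu : nat, min_generators I mu -> (1 < mu - n)%N ->
       SAC R).
Proof.
move=> cm kn ul gor; have [nR loc _] := cm.
have [t [zs [s U]]] := ex_ulrich_data cm kn ul.
split=> [sA _ [|[|l]] // l_gt0 _ ln|[[|l] [l_gt0 sS]] // mu /(min_generators_bound U) muz mun].
  exact: SAC_power U gor l l_gt0 nR ln sA.
apply: (SAC_base U gor nR loc _ sS); apply: leq_trans mun _.
by rewrite leq_subLR.
Qed.
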